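(* Let $\pi : (M, g_0) \rightarrow (N, g_N)$ be a Riemannian submersion, where $M$ is compact. Let $$J_h(g_t) = \int_{M} \| h_t \|^2 \, \mathrm{vol}_{g_t}, \qquad J_H(g_t) = \int_{M} g_t(H_t,H_t) \, \mathrm{vol}_{g_t}.$$ If $g_0$ is a critical point of $J_h$ (respectively, of $J_H$) with respect to variations preserving the Riemannian submersion $\pi$, then for all such variations $\{g_t, t\in(-\epsilon,\epsilon)\}$ we have $\partial^2_{tt} J_{h}(g_t)\vert_{t=0} \geq 0$ (respectively, $\partial^2_{tt} J_{H}(g_t)\vert_{t=0} \geq 0$).
   Context: Manifolds are smooth, connected and oriented; all functions and tensor fields are smooth. A Riemannian submersion $\pi:(M,g)\to(N,g_N)$ is a smooth map with $\operatorname{rank}\pi_*=\dim N$ and $g(X,Y)=g_N(\pi_*X,\pi_*Y)$ for all $X,Y$ that are $g$-orthogonal to $\ker\pi_*$. $\mathcal{V}=\ker\pi_*$ is the vertical distribution, $n=\dim\mathcal{V}$; vertical vector fields are those with values in $\mathcal{V}$. $\mathrm{Riem}(M,\mathcal{V},g_0)$ is the set of Riemannian metrics $g$ on $M$ with $g(X,Y)=g_0(X,Y)$ for all vertical $X,Y$. A variation of $g_0$ is a one-parameter family $\{g_t, t\in(-\epsilon,\epsilon)\}\subset \mathrm{Riem}(M,\mathcal{V},g_0)$ depending smoothly on $t$, whose member at $t=0$ is $g_0$; it preserves the Riemannian submersion $\pi$ if $\pi:(M,g_t)\to(N,g_N)$ is a Riemannian submersion for all $t$. The second fundamental form of the fibers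 is $h_t(X,Y)=P_{\mathcal{H}}^t\nabla^t_XY$ for vertical $X,Y$, where $\nabla^t$ is the Levi-Civita connection of $g_t$ and $P_{\mathcal{H}}^t$ is the $g_t$-orthogonal projection onto the $g_t$-orthogonal complement of $\mathcal{V}$. For a local $g_t$-orthonormal frame $\{E_1,\ldots,E_n\}$ of $\mathcal{V}$, $H_t=\sum_{a=1}^n h_t(E_a,E_a)$ and $\|h_t\|^2=\sum_{a,b=1}^n g_t(h_t(E_a,E_b),h_t(E_a,E_b))$. $\mathrm{vol}_{g_t}$ is the volume form of $(M,g_t)$. $g_0$ is critical for a functional $J$ with respect to variations preserving $\pi$ if $\partial_t J(g_t)|_{t=0}=0$ for all such variations. *)

(* Defs.v *)
From HB Require Import structures.
From mathcomp Require Import all_boot all_order all_algebra.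
From mathcomp Require Import all_classical all_reals all_analysis.
From mathcomp Require Import ring.

Set Implicit Arguments.
Unset Strict Implicit.
Unset Printing Implicit Defensive.

Import Order.TTheory GRing.Theory Num.Theory.
Import numFieldNormedType.Exports.

Local Open Scope classical_set_scope.
Local Open Scope ring_scope.

(* Tensor fields are given by their components in the charts of an atlas.
   Tangent vectors are row vectors, so a tangent map acts by right
   multiplication by the Jacobian matrix 'J. *)

(* C^infinity on the open set U: all iterated directional derivatives are
   Frechet differentiable at the points of U. *)
Definition smooth_on (R : realType) (V W : normedModType R) (U : set V)
    (f : V -> W) : Prop :=
  forall (s : seq V) (x : V), U x ->
    differentiable (foldr (fun (v : V) (h : V -> W) => 'D_v h) f s) x.

(* A smooth, connected, oriented manifold of dimension m. The map [coord i] is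
   the chart with domain [dom i], and [param i] is its inverse; the values of
   these total functions off [dom i], resp. off the image of the chart, are
   irrelevant. The orientation is carried by the atlas: transition maps have
   positive Jacobian determinant. *)
Record manifold (R : realType) (m : nat) := Manifold {
  carrier :> topologicalType;
  chart : Type;
  dom : chart -> set carrier;
  coord : chart -> carrier -> 'rV[R]_m;
  param : chart -> 'rV[R]_m -> carrier;
  chart_at : carrier -> chart;
  chart_at_dom : forall p, dom (chart_at p) p;
  dom_open : forall i, open (dom i);
  coord_open : forall i, open (coord i @` dom i);
  coord_cont : forall i p, dom i p -> {for p, continuous (coord i)};
  param_cont : forall i x, (coord i @` dom i) x ->
    {for x, continuous (param i)};
  coordK : forall i p, dom i p -> param i (coord i p) = p;
  transition_smooth : forall i j,
    smooth_on (coord i @` (dom i `&` dom j)) (coord j \o param i);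
  transition_oriented : forall i j p, dom i p -> dom j p ->
    0 < \det ('J (coord j \o param i) (coord i p));
  manifold_hausdorff : hausdorff_space carrier;
  manifold_second_countable : @second_countable carrier;
  manifold_connected : connected [set: carrier]
}.
Arguments dom {R m} _ _.
Arguments coord {R m} _ _ _.
Arguments param {R m} _ _ _.
Arguments chart_at {R m} _ _.

Section Geometry.
Variable R : realType.

Definition chart_image (m : nat) (M : manifold R m) (i : chart M) :
  set 'rV[R]_m := coord M i @` dom M i.

Definition inner (m : nat) (G : 'M[R]_m) (u v : 'rV[R]_m) : R :=
  (u *m G *m v^T) 0 0.

Record metric (m : nat) (M : manifold R m) := Metric {
  gram :> chart M -> 'rV[R]_m -> 'M[R]_m;
  gram_smooth : forall i, smooth_on (chart_image i) (gram i);
  gram_sym : forall i x, chart_image i x -> (gram i x)^T = gram i x;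
  gram_pos : forall i x, chart_image i x ->
    forall u, u != 0 -> 0 < inner (gram i x) u u;
  gram_transition : forall i j p, dom M i p -> dom M j p ->
    let J := 'J (coord M j \o param M i) (coord M i p) in
    gram i (coord M i p) = J *m gram j (coord M j p) *m J^T
}.

(* Maps between manifolds *)

Section Maps.
Variables (m q : nat) (M : manifold R m) (N : manifold R q) (f : M -> N).

Definition smooth_map : Prop :=
  continuous f /\
  forall i a, smooth_on (coord M i @` (dom M i `&` f @^-1` dom N a))
                        (coord N a \o f \o param M i).

Definition target_chart (i : chart M) (x : 'rV[R]_m) : chart N :=
  chart_at N (f (param M i x)).

Definition tangent_map (i : chart M) (x : 'rV[R]_m) : 'M[R]_(m, q) :=
  'J (coord N (target_chart i x) \o f \o param M i) x.

(* The rows of this matrix span the kernel of the tangent map. *)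
Definition vertical_space (i : chart M) (x : 'rV[R]_m) : 'M[R]_m :=
  kermx (tangent_map i x).

Definition vertical (i : chart M) (x v : 'rV[R]_m) : Prop :=
  v *m tangent_map i x = 0.

Definition horizontal (g : metric M) (i : chart M) (x u : 'rV[R]_m) : Prop :=
  forall v, vertical i x v -> inner (g i x) u v = 0.

Definition riemannian_submersion (g : metric M) (gN : metric N) : Prop :=
  smooth_map /\
  forall i x, chart_image i x ->
    let D := tangent_map i x in
    let a := target_chart i x in
    \rank D = q /\
    forall u v, horizontal g i x u -> horizontal g i x v ->
      inner (g i x) u v =
      inner (gN a (coord N a (f (param M i x)))) (u *m D) (v *m D).

(* g belongs to Riem(M, V, g0), where V is the vertical distribution of f *)
Definition riem_rel_vertical (g0 g : metric M) : Prop :=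
  forall i x, chart_image i x ->
    forall u v, vertical i x u -> vertical i x v ->
      inner (g i x) u v = inner (g0 i x) u v.

(* The rows of this matrix span the orthogonal complement of the vertical
   space. *)
Definition horizontal_space (g : metric M) (i : chart M) (x : 'rV[R]_m) :
  'M[R]_m := kermx (g i x *m (vertical_space i x)^T).

Definition horizontal_proj (g : metric M) (i : chart M) (x v : 'rV[R]_m) :
  'rV[R]_m := v *m proj_mx (horizontal_space g i x) (vertical_space i x).

End Maps.

(* The Levi-Civita connection of a metric G on an open set of R^m *)

Definition partial (m : nat) (k : 'I_m) (f : 'rV[R]_m -> R) (x : 'rV[R]_m) : R :=
  'D_(delta_mx 0 k) f x.

(* christoffel G x k i j is the symbol of the second kind with upper index k
   and lower indices i, j. *)
Definition christoffel (m : nat) (G : 'rV[R]_m -> 'M[R]_m) (x : 'rV[R]_m)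
    (k i j : 'I_m) : R :=
  2^-1 * \sum_l invmx (G x) k l *
    (partial i (fun y => G y j l) x + partial j (fun y => G y i l) x
     - partial l (fun y => G y i j) x).

Definition nabla (m : nat) (G : 'rV[R]_m -> 'M[R]_m)
    (X Y : 'rV[R]_m -> 'rV[R]_m) (x : 'rV[R]_m) : 'rV[R]_m :=
  'D_(X x) Y x
  + \row_k \sum_i \sum_j christoffel G x k i j * X x 0 i * Y x 0 j.

Lemma partial_gram_sym (m : nat) (G : 'rV[R]_m -> 'M[R]_m) (x : 'rV[R]_m)
    (k i j : 'I_m) :
  (\forall y \near x, (G y)^T = G y) ->
  partial k (fun y => G y i j) x = partial k (fun y => G y j i) x.
Proof.
move=> Gs; apply: near_eq_derive.
by apply: filterS Gs => y Gy; rewrite -[in LHS]Gy mxE.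
Qed.

(* The next two lemmas check the conditions that characterize the Levi-Civita
   connection. *)
Lemma nabla_torsion_free (m : nat) (G : 'rV[R]_m -> 'M[R]_m)
    (X Y : 'rV[R]_m -> 'rV[R]_m) (x : 'rV[R]_m) :
  (\forall y \near x, (G y)^T = G y) ->
  nabla G X Y x - nabla G Y X x = 'D_(X x) Y x - 'D_(Y x) X x.
Proof.
move=> Gs; rewrite /nabla opprD addrACA.
rewrite (_ : \row__ _ - \row__ _ = 0) ?addr0//.
apply/rowP => k; rewrite !mxE exchange_big -sumrB big1// => i _.
rewrite -sumrB big1// => j _.
rewrite (_ : christoffel G x k j i = christoffel G x k i j); first by ring.
rewrite /christoffel; congr (_ * _); apply: eq_bigr => l _.
by rewrite (partial_gram_sym l j i Gs); ring.
Qed.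

Lemma christoffel_metric (m : nat) (G : 'rV[R]_m -> 'M[R]_m) (x : 'rV[R]_m)
    (k i j : 'I_m) :
  G x \in unitmx -> (\forall y \near x, (G y)^T = G y) ->
  partial k (fun y => G y i j) x =
  \sum_l (christoffel G x l k i * G x l j + christoffel G x l k j * G x i l).
Proof.
move=> Gu Gs; have Gx : (G x)^T = G x by exact: nbhs_singleton Gs.
have lower a b : \sum_l christoffel G x l k a * G x b l =
    2^-1 * (partial k (fun y => G y a b) x + partial a (fun y => G y k b) x
            - partial b (fun y => G y k a) x).
  under eq_bigr do rewrite /christoffel -mulrA mulr_suml.
  rewrite -mulr_sumr exchange_big/=; congr (_ * _).
  rewrite (bigD1 b)//= [X in _ + X]big1 ?addr0 => [|p pb].
    under eq_bigr do rewrite mulrC mulrA.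
    rewrite -mulr_suml -[RHS]mul1r; congr (_ * _).
    by have := congr1 (fun A : 'M[R]_m => A b b) (mulmxV Gu); rewrite !mxE eqxx.
  under eq_bigr do rewrite mulrC mulrA.
  rewrite -mulr_suml (_ : \sum_l _ = 0) ?mul0r//.
  have := congr1 (fun A : 'M[R]_m => A b p) (mulmxV Gu).
  by rewrite !mxE eq_sym (negbTE pb).
rewrite big_split/= lower.
under eq_bigr do rewrite -Gx mxE.
rewrite lower (partial_gram_sym k j i Gs); by field.
Qed.

(* The second fundamental form of the fibers *)

Section SecondFundamentalForm.
Variables (m q : nat) (M : manifold R m) (N : manifold R q) (f : M -> N).
Variable g : metric M.

Definition second_form (i : chart M) (X Y : 'rV[R]_m -> 'rV[R]_m)
    (x : 'rV[R]_m) : 'rV[R]_m :=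
  horizontal_proj f g i x (nabla (g i) X Y x).

(* A smooth orthonormal frame of the vertical distribution on a neighborhood
   of x, read in the chart i; the fibers have dimension m - q. *)
Definition vertical_frame (i : chart M) (x : 'rV[R]_m)
    (E : 'I_(m - q) -> 'rV[R]_m -> 'rV[R]_m) : Prop :=
  exists U : set 'rV[R]_m,
    [/\ open U, U x, U `<=` chart_image i,
        forall a, smooth_on U (E a)
      & forall y, U y ->
          (forall a, vertical f i y (E a y)) /\
          (forall a b, inner (g i y) (E a y) (E b y) = (a == b)%:R)].

(* The next two values do not depend on the frame; [xget] selects the unique
   element of a singleton. *)
Definition sqnorm_second_form (i : chart M) (x : 'rV[R]_m) : R :=
  xget 0 [set r | exists2 E, vertical_frame i x E &
    r = \sum_a \sum_b let h := second_form i (E a) (E b) x in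
                      inner (g i x) h h].

Definition sqnorm_mean_curvature (i : chart M) (x : 'rV[R]_m) : R :=
  xget 0 [set r | exists2 E, vertical_frame i x E &
    let H := \sum_a second_form i (E a) (E a) x in r = inner (g i x) H H].

End SecondFundamentalForm.

(* Integration *)

(* Iterated Lebesgue integral over R^m *)
Fixpoint integral_rV (m : nat) : ('rV[R]_m -> R) -> R :=
  match m return ('rV[R]_m -> R) -> R with
  | 0 => fun F => F 0
  | m'.+1 => fun F =>
      \int[@lebesgue_measure R]_(s in [set: R])
        integral_rV (fun v : 'rV[R]_m' => F (row_mx (s%:M : 'rV[R]_1) v))
  end.

(* A finite smooth partition of unity subordinate to the atlas; one exists
   when M is compact. *)
Record partition_of_unity (m : nat) (M : manifold R m) := PartitionOfUnity {
  bump_num : nat;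
  bump : 'I_bump_num -> M -> R;
  bump_chart : 'I_bump_num -> chart M;
  bump_smooth : forall k i, smooth_on (chart_image i) (bump k \o param M i);
  bump_ge0 : forall k p, 0 <= bump k p;
  bump_supp : forall k,
    closure [set p | bump k p != 0] `<=` dom M (bump_chart k);
  bump_sum : forall p, \sum_k bump k p = 1
}.

(* The integral of u vol_g over a compact M, where the function u on M is given
   by its expressions in the charts. Its value does not depend on rho. *)
Definition integral_vol (m : nat) (M : manifold R m)
    (rho : partition_of_unity M) (g : metric M)
    (u : chart M -> 'rV[R]_m -> R) : R :=
  \sum_(k < bump_num rho)
    let i := bump_chart k in
    integral_rV ((fun x => bump k (param M i x) * u i x *
                           Num.sqrt (\det (g i x))) \_ (chart_image i)).

(* Functionals and variations *)

Section Variations.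
Variables (m q : nat) (M : manifold R m) (N : manifold R q) (f : M -> N).

Definition J_h (rho : partition_of_unity M) (g : metric M) : R :=
  integral_vol rho g (sqnorm_second_form f g).

Definition J_H (rho : partition_of_unity M) (g : metric M) : R :=
  integral_vol rho g (sqnorm_mean_curvature f g).

(* A variation is indexed by R, but only its members with |t| < eps matter. *)
Definition variation (g0 : metric M) (eps : R) (g : R -> metric M) : Prop :=
  [/\ 0 < eps,
      forall t, `|t| < eps -> riem_rel_vertical f g0 (g t),
      forall i x, chart_image i x -> g 0 i x = g0 i x
    & forall i, smooth_on [set z : R * 'rV[R]_m | `|z.1| < eps /\ chart_image i z.2]
                          (fun z : R * 'rV[R]_m => g z.1 i z.2)].

Definition preserving_variation (gN : metric N) (g0 : metric M) (eps : R)
    (g : R -> metric M) : Prop :=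
  variation g0 eps g /\
  forall t, `|t| < eps -> riemannian_submersion f (g t) gN.

Definition critical (gN : metric N) (J : metric M -> R) (g0 : metric M) : Prop :=
  forall (eps : R) (g : R -> metric M), preserving_variation gN g0 eps g ->
    is_derive (0 : R) 1 (J \o g) 0.

End Variations.

(* F is twice differentiable at 0 with nonnegative second derivative. *)
Definition second_derivative_ge0 (F : R -> R) : Prop :=
  [/\ \forall t \near (0 : R), derivable F t 1,
      derivable (derive1 F) 0 1
    & 0 <= derive1n 2 F 0].

End Geometry.

(* Main.v *)
(* A metric g that agrees with g0 on the vertical bundle and keeps f a Riemannian
   submersion is determined by its horizontal lift L_g of vector fields of N, and
   such lifts form an affine space, with vertical differences. For vertical X, Y and
   the g-lift xi of a coordinate field of N, pairing the second fundamental form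
   with xi gives
     g(nabla_X Y, xi) = - (L_xi g0)(X, Y) / 2,
   which is affine in the lift, while the restriction of g to horizontal vectors and
   the volume form do not depend on g. So the functionals are convex along affine
   paths of lifts. Such a path from g0 to g_t is itself a variation preserving f,
   hence a critical g0 satisfies J(g0) <= J(g_t) for every t, and the second
   derivative of J(g_t) at 0, which exists by differentiation under the integral
   sign, is nonnegative. *)

Require Import Defs.
From mathcomp Require Import all_boot all_order all_algebra.
From mathcomp Require Import all_classical all_reals all_analysis.
From mathcomp Require Import ring lra.

Set Implicit Arguments.
Unset Strict Implicit.
Unset Printing Implicit Defensive.

Import Order.TTheory GRing.Theory Num.Theory.
Import numFieldNormedType.Exports.

Local Open Scope classical_set_scope.
Local Open Scope ring_scope.


(** * Smooth functions *)

Section SmoothCalculus.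
Variable R : realType.

(** The affine structure lives on lifts and not on metrics: along an affine path of lifts the Gram
    matrix is quadratic in the parameter. Let D be the matrix of the tangent map and L0, L the
    matrices of the lifts of g0 and g. Then g = T g0 T^T for the shear T = 1 - D (L - L0), and (L -
    L0) D = 0 makes T unipotent. Its determinant 1 keeps the volume density constant and makes the
    path positive definite for every real parameter. Lifts exist only chart by chart on N, but D L =
    (f^* gN) g^-1, so the shear is a tensor on M and the path is globally defined. Affineness of the
    pairing is not visible term by term: derivatives of g contain products of two lifts, and these
    cancel only in the full Koszul formula, thanks to the symmetry of the second derivatives of f.
    The integrals are iterated one-dimensional integrals of continuous functions vanishing off a
    box; uniform estimates on the compact box take the place of convergence theorems. The integrand
    is smooth in t and x jointly because a vertical frame orthonormal for g0 is orthonormal for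
    every g_t. *)

Lemma near_eq_differentiable (V W : normedModType R) (f g : V -> W) (x : V) :
  (\forall y \near x, f y = g y) -> differentiable f x -> differentiable g x.
Proof.
move=> fg df; have /diff_locallyP[dfc dfx] := df.
have gx : g \o shift x = cst (g x) + 'd f x +o_ 0 id.
  apply/eqaddoP => e e0; move/eqaddoP : dfx => /(_ e e0) dfe.
  have fg0 : \forall h \near (0 : V), f (h + x) = g (h + x).
    have shx : (fun h : V => h + x) @ (0 : V) --> x.
      by rewrite -[X in _ --> X]add0r; apply: cvgD; [exact: cvg_id|exact: cvg_cst].
    exact: shx fg.
  apply: filterS2 fg0 dfe => h fgh.
  by rewrite !fctE/= fgh (nbhs_singleton fg).
by apply/diff_locallyP; rewrite (diff_unique dfc gx).
Qed.

Section Order.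
Variables (V W : normedModType R).
Implicit Types (U : set V) (f g : V -> W).

(** All directional derivatives of order at most [n] are differentiable on [U]. The product,
    quotient and chain rules mix derivatives of different orders, so closure properties are proved
    by induction on this order rather than on the lists of directions in [smooth_on]. *)
Fixpoint Cn (n : nat) U f : Prop :=
  (forall x, U x -> differentiable f x) /\
  if n is n'.+1 then forall v, Cn n' U ('D_v f) else True.

Lemma Cn_differentiable n U f x : U x -> Cn n U f -> differentiable f x.
Proof. by case: n => [|n] Ux [df _]; exact: df. Qed.

Lemma Cn_derive n U f v : Cn n.+1 U f -> Cn n U ('D_v f).
Proof. by case=> _; apply. Qed.

Lemma CnS n U f : Cn n.+1 U f -> Cn n U f.
Proof.
elim: n f => [|n IH] f [df Df]; split => // v; exact/IH/Df.
Qed.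

Lemma smooth_onP U f : smooth_on U f <-> forall n, Cn n U f.
Proof.
split=> [sf n|sf s x Ux].
  elim: n f sf => [|n IH] f sf; split => //; [exact: (sf [::])|exact: (sf [::])|].
  (* In [foldr] the last direction of the list is the innermost derivative, which is the one that
     [Cn] takes first; hence [rcons]. *)
  by move=> v; apply: IH => s x Ux; have := sf (rcons s v) x Ux; rewrite foldr_rcons.
elim/last_ind: s f sf => [|s v IH] f sf; first by case: (sf 0%N) => + _; apply.
by rewrite foldr_rcons; apply: IH => n; exact: Cn_derive.
Qed.

Lemma Cn_eq n U f g : open U -> (forall x, U x -> f x = g x) -> Cn n U f -> Cn n U g.
Proof.
move=> oU; elim: n f g => [|n IH] f g fg sf; split => //.
- move=> x Ux; apply: near_eq_differentiable (Cn_differentiable Ux sf).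
  by near=> y; apply: fg; near: y; exact: open_nbhs_nbhs.
- move=> x Ux; apply: near_eq_differentiable (Cn_differentiable Ux sf).
  by near=> y; apply: fg; near: y; exact: open_nbhs_nbhs.
- move=> v; apply: IH (Cn_derive v sf) => x Ux; apply: near_eq_derive.
  by near=> y; apply: fg; near: y; exact: open_nbhs_nbhs.
Unshelve. all: by end_near. Qed.

Lemma Cn_cst n U (w : W) : Cn n U (fun=> w).
Proof.
elim: n w => [|n IH] w; split; try by move=> x _; exact: differentiable_cst.
  by [].
move=> v; have -> : 'D_v (fun _ : V => w) = fun=> 0; last exact: IH.
by apply/funext => x; rewrite derive_cst.
Qed.

Lemma CnD n U f g : open U -> Cn n U f -> Cn n U g -> Cn n U (fun x => f x + g x).
Proof.
move=> oU; elim: n f g => [|n IH] f g sf sg; split => //.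
- by move=> x Ux; apply: (@differentiableD _ _ _ f g); first [exact: (Cn_differentiable Ux sf)|exact: (Cn_differentiable Ux sg)].
- by move=> x Ux; apply: (@differentiableD _ _ _ f g); first [exact: (Cn_differentiable Ux sf)|exact: (Cn_differentiable Ux sg)].
- move=> v; apply: Cn_eq (IH _ _ (Cn_derive v sf) (Cn_derive v sg)) => // x Ux.
  by rewrite -(@deriveD _ _ _ f g)//; apply: diff_derivable; first [exact: (Cn_differentiable Ux sf)|exact: (Cn_differentiable Ux sg)].
Qed.

End Order.

Section Scalar.
Variables (V : normedModType R).
Implicit Types (U : set V) (f g : V -> R).

Lemma CnM n U f g : open U -> Cn n U f -> Cn n U g -> Cn n U (fun x => f x * g x).
Proof.
move=> oU; elim: n f g => [|n IH] f g sf sg; split => //.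
- by move=> x Ux; apply: (@differentiableM _ _ f g); first [exact: (Cn_differentiable Ux sf)|exact: (Cn_differentiable Ux sg)].
- by move=> x Ux; apply: (@differentiableM _ _ f g); first [exact: (Cn_differentiable Ux sf)|exact: (Cn_differentiable Ux sg)].
- move=> v; have H := CnD oU (IH _ _ (CnS sf) (Cn_derive v sg)) (IH _ _ (CnS sg) (Cn_derive v sf)).
  apply: Cn_eq H => // x Ux; rewrite (@deriveM _ _ f g)//.
  - by apply: diff_derivable; first [exact: (Cn_differentiable Ux sf)|exact: (Cn_differentiable Ux sg)].
  - by apply: diff_derivable; first [exact: (Cn_differentiable Ux sf)|exact: (Cn_differentiable Ux sg)].
Qed.

Lemma CnV n U f : open U -> (forall x, U x -> f x != 0) -> Cn n U f ->
  Cn n U (fun x => (f x)^-1).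
Proof.
move=> oU f0; elim: n => [|n IH] sf; split => //.
- by move=> x Ux; apply: differentiableV; [first [exact: (Cn_differentiable Ux sf)|exact: (Cn_differentiable Ux sg)]|exact: f0].
- by move=> x Ux; apply: differentiableV; [first [exact: (Cn_differentiable Ux sf)|exact: (Cn_differentiable Ux sg)]|exact: f0].
- move=> v; have H1 := IH (CnS sf).
  have H := CnM oU (CnM oU (Cn_cst n U (-1 : R)) (CnM oU H1 H1)) (Cn_derive v sf).
  apply: Cn_eq H => // x Ux; rewrite deriveV ?f0//; last first.
    by apply: diff_derivable; first [exact: (Cn_differentiable Ux sf)|exact: (Cn_differentiable Ux sg)].
  by rewrite [RHS]/GRing.scale/= -invfM expr2 mulN1r.
Qed.

Lemma Cn_sqrt n U f : open U -> (forall x, U x -> 0 < f x) -> Cn n U f ->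
  Cn n U (fun x => Num.sqrt (f x)).
Proof.
move=> oU f0.
have dsq x : U x -> differentiable (Num.sqrt : R -> R) (f x).
  by move=> Ux; apply/derivable1_diffP; have [] := is_derive1_sqrt (f0 x Ux).
elim: n => [|n IH] sf; split => //.
- by move=> x Ux; apply: (@differentiable_comp _ _ _ _ f Num.sqrt); [first [exact: (Cn_differentiable Ux sf)|exact: (Cn_differentiable Ux sg)]|exact: dsq].
- by move=> x Ux; apply: (@differentiable_comp _ _ _ _ f Num.sqrt); [first [exact: (Cn_differentiable Ux sf)|exact: (Cn_differentiable Ux sg)]|exact: dsq].
- move=> v; have H1 := CnV oU _ (IH (CnS sf)).
  have {}H1 := H1 (fun x Ux => lt0r_neq0 (etrans (sqrtr_gt0 _) (f0 x Ux))).
  have H := CnM oU (CnM oU (Cn_cst n U (2^-1 : R)) H1) (Cn_derive v sf).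
  apply: Cn_eq H => // x Ux.
  have df := Cn_differentiable Ux sf.
  rewrite [RHS]deriveE; last by apply: differentiable_comp => //; exact: dsq.
  rewrite [RHS](congr1 (@^~ v) (diff_comp df (dsq x Ux))).
  rewrite /= -(deriveE v df) diff1E; last exact: dsq.
  by rewrite derive1E derive_sqrt ?f0// invfM [RHS]/GRing.scale/= mulrC.
Qed.

Lemma Cn_sum (I : Type) (r : seq I) (P : pred I) n U (F : I -> V -> R) : open U ->
  (forall i, P i -> Cn n U (F i)) -> Cn n U (fun x => \sum_(i <- r | P i) F i x).
Proof.
move=> oU sF; elim: r => [|i r IH].
  by apply: Cn_eq (Cn_cst n U (0 : R)) => // x _; rewrite big_nil.
have [Pi|Pi] := boolP (P i).
  by apply: Cn_eq (CnD oU (sF i Pi) IH) => // x _; rewrite big_cons Pi.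
by apply: Cn_eq IH => // x _; rewrite big_cons (negbTE Pi).
Qed.

Lemma Cn_prod (I : Type) (r : seq I) (P : pred I) n U (F : I -> V -> R) : open U ->
  (forall i, P i -> Cn n U (F i)) -> Cn n U (fun x => \prod_(i <- r | P i) F i x).
Proof.
move=> oU sF; elim: r => [|i r IH].
  by apply: Cn_eq (Cn_cst n U (1 : R)) => // x _; rewrite big_nil.
have [Pi|Pi] := boolP (P i).
  by apply: Cn_eq (CnM oU (sF i Pi) IH) => // x _; rewrite big_cons Pi.
by apply: Cn_eq IH => // x _; rewrite big_cons (negbTE Pi).
Qed.

End Scalar.

Section Matrices.
Variables (V : normedModType R).
Implicit Types (U : set V).

Lemma differentiable_mxP a b (M : V -> 'M[R]_(a, b)) x :
  differentiable M x <-> forall i j, differentiable (fun y => M y i j) x.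
Proof.
split=> [dM i j|dM].
  by apply: (@differentiable_comp _ _ _ _ M (fun N : 'M[R]_(a, b) => N i j : R)) => //;
    exact: differentiable_coord.
rewrite (_ : M = \sum_i \sum_j (fun y => M y i j *: delta_mx i j)).
  apply: differentiable_sum => i; apply: differentiable_sum => j.
  exact: differentiableZl.
apply/funext => y; rewrite [LHS]matrix_sum_delta fct_sumE; apply: eq_bigr => i _.
by rewrite fct_sumE.
Qed.

Lemma derive_mxE a b (M : V -> 'M[R]_(a, b)) x v i j : differentiable M x ->
  ('D_v M x) i j = 'D_v (fun y => M y i j) x.
Proof. by move=> dM; rewrite derive_mx ?mxE//; exact: diff_derivable. Qed.

Lemma Cn_mxP n a b U (M : V -> 'M[R]_(a, b)) : open U ->
  Cn n U M <-> forall i j, Cn n U (fun x => M x i j).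
Proof.
move=> oU; elim: n M => [|n IH] M; split => [sM|sM].
- by move=> i j; split => // x Ux; have /differentiable_mxP := Cn_differentiable Ux sM.
- by split => // x Ux; apply/differentiable_mxP => i j; case: (sM i j) => + _; apply.
- move=> i j; split; first by move=> x Ux; have /differentiable_mxP := Cn_differentiable Ux sM.
  move=> v; have /IH/(_ i j) := Cn_derive v sM.
  apply: Cn_eq => // x Ux; rewrite derive_mxE//; exact: (Cn_differentiable Ux sM).
- have dM x : U x -> differentiable M x.
    by move=> Ux; apply/differentiable_mxP => i j; case: (sM i j) => + _; apply.
  split => // v; apply/IH => i j; apply: Cn_eq (Cn_derive v (sM i j)) => // x Ux.
  by rewrite derive_mxE//; exact: dM.
Qed.

(** The derivative of the composite has the moving outer direction ['D_v phi x]. Since the middle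
    space has coordinates, it expands into partials of [h] along fixed vectors, composed with the
    same [phi]; so the induction varies [h] only. *)
Lemma Cn_comp n q (U : set V) (O : set 'rV[R]_q) (phi : V -> 'rV[R]_q) (h : 'rV[R]_q -> R) :
  open U -> (forall x, U x -> O (phi x)) -> Cn n U phi -> Cn n O h ->
  Cn n U (fun x => h (phi x)).
Proof.
move=> oU UO; elim: n h => [|n IH] h sphi sh.
  split => // x Ux; apply: differentiable_comp; first exact: (Cn_differentiable Ux sphi).
  by apply: Cn_differentiable sh; exact: UO.
have dphi x : U x -> differentiable phi x by move=> Ux; exact: (Cn_differentiable Ux sphi).
have dh x : U x -> differentiable h (phi x).
  by move=> Ux; apply: Cn_differentiable sh; exact: UO.
split => [x Ux|v].
  by apply: differentiable_comp; [exact: dphi|exact: dh].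
have H : Cn n U (fun x => \sum_k ('D_v phi x) 0 k * 'D_(delta_mx 0 k) h (phi x)).
  apply: Cn_sum => // k _; apply: CnM => //.
    by have /(Cn_mxP _ _ oU)/(_ 0 k) := Cn_derive v sphi.
  by apply: (IH ('D_(delta_mx 0 k) h)); [exact: CnS|exact: Cn_derive].
apply: Cn_eq H => // x Ux.
rewrite [RHS]deriveE; last by apply: differentiable_comp; [exact: dphi|exact: dh].
rewrite [RHS](congr1 (@^~ v) (diff_comp (dphi x Ux) (dh x Ux))) /=.
rewrite -(deriveE v (dphi x Ux)).
rewrite [in RHS](row_sum_delta ('D_v phi x)) linear_sum/=; apply: eq_bigr => k _.
by rewrite linearZ/= (deriveE _ (dh x Ux)).
Qed.

End Matrices.

Section Smooth.
Variable V : normedModType R.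
Implicit Types U : set V.

Lemma smooth_on_differentiable (W : normedModType R) U (f : V -> W) x :
  smooth_on U f -> U x -> differentiable f x.
Proof. by move=> sf Ux; exact: (sf [::]). Qed.

Lemma smooth_on_derive (W : normedModType R) U (f : V -> W) v :
  smooth_on U f -> smooth_on U ('D_v f).
Proof. by move=> /smooth_onP sf; apply/smooth_onP => n; exact: Cn_derive. Qed.

Lemma smooth_on_subset (W : normedModType R) U U' (f : V -> W) :
  U' `<=` U -> smooth_on U f -> smooth_on U' f.
Proof. by move=> sU sf s x U'x; apply: sf; exact: sU. Qed.

Lemma smooth_on_eq (W : normedModType R) U (f g : V -> W) : open U ->
  (forall x, U x -> f x = g x) -> smooth_on U f -> smooth_on U g.
Proof. by move=> oU fg /smooth_onP sf; apply/smooth_onP => n; exact: Cn_eq (sf n). Qed.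

Lemma smooth_on_cst (W : normedModType R) U (w : W) : smooth_on U (fun=> w).
Proof. by apply/smooth_onP => n; exact: Cn_cst. Qed.

Lemma smooth_onD (W : normedModType R) U (f g : V -> W) : open U ->
  smooth_on U f -> smooth_on U g -> smooth_on U (fun x => f x + g x).
Proof.
by move=> oU /smooth_onP sf /smooth_onP sg; apply/smooth_onP => n; exact: CnD.
Qed.

Lemma smooth_onM U (f g : V -> R) : open U ->
  smooth_on U f -> smooth_on U g -> smooth_on U (fun x => f x * g x).
Proof.
by move=> oU /smooth_onP sf /smooth_onP sg; apply/smooth_onP => n; exact: CnM.
Qed.

Lemma smooth_onV U (f : V -> R) : open U -> (forall x, U x -> f x != 0) ->
  smooth_on U f -> smooth_on U (fun x => (f x)^-1).
Proof. by move=> oU f0 /smooth_onP sf; apply/smooth_onP => n; exact: CnV. Qed.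

Lemma smooth_on_sqrt U (f : V -> R) : open U -> (forall x, U x -> 0 < f x) ->
  smooth_on U f -> smooth_on U (fun x => Num.sqrt (f x)).
Proof. by move=> oU f0 /smooth_onP sf; apply/smooth_onP => n; exact: Cn_sqrt. Qed.

Lemma smooth_on_sum (I : Type) (r : seq I) (P : pred I) U (F : I -> V -> R) : open U ->
  (forall i, P i -> smooth_on U (F i)) -> smooth_on U (fun x => \sum_(i <- r | P i) F i x).
Proof.
move=> oU sF; apply/smooth_onP => n; apply: Cn_sum => // i Pi.
by have /smooth_onP := sF i Pi.
Qed.

Lemma smooth_on_prod (I : Type) (r : seq I) (P : pred I) U (F : I -> V -> R) : open U ->
  (forall i, P i -> smooth_on U (F i)) -> smooth_on U (fun x => \prod_(i <- r | P i) F i x).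
Proof.
move=> oU sF; apply/smooth_onP => n; apply: Cn_prod => // i Pi.
by have /smooth_onP := sF i Pi.
Qed.

Lemma smooth_on_mxP a b U (M : V -> 'M[R]_(a, b)) : open U ->
  smooth_on U M <-> forall i j, smooth_on U (fun x => M x i j).
Proof.
move=> oU; split=> [/smooth_onP sM i j|sM]; apply/smooth_onP => n.
  by have /Cn_mxP := sM n; apply.
by apply/Cn_mxP => // i j; have /smooth_onP := sM i j.
Qed.

End Smooth.

Section SmoothMatrices.
Variable V : normedModType R.
Implicit Types U : set V.

Lemma smooth_on_comp q U (O : set 'rV[R]_q) (phi : V -> 'rV[R]_q) (h : 'rV[R]_q -> R) :
  open U -> (forall x, U x -> O (phi x)) -> smooth_on U phi -> smooth_on O h ->
  smooth_on U (fun x => h (phi x)).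
Proof.
move=> oU UO /smooth_onP sphi /smooth_onP sh; apply/smooth_onP => n.
exact: Cn_comp (sphi n) (sh n).
Qed.

Lemma smooth_on_comp_mx q a b U (O : set 'rV[R]_q) (phi : V -> 'rV[R]_q)
    (h : 'rV[R]_q -> 'M[R]_(a, b)) : open U -> open O ->
  (forall x, U x -> O (phi x)) -> smooth_on U phi -> smooth_on O h ->
  smooth_on U (fun x => h (phi x)).
Proof.
move=> oU oO UO sphi /(smooth_on_mxP _ oO) sh; apply/smooth_on_mxP => // i j.
exact: (smooth_on_comp oU UO sphi (sh i j)).
Qed.

Lemma smooth_on_mulmx a b c U (M : V -> 'M[R]_(a, b)) (N : V -> 'M[R]_(b, c)) : open U ->
  smooth_on U M -> smooth_on U N -> smooth_on U (fun x => M x *m N x).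
Proof.
move=> oU /(smooth_on_mxP _ oU) sM /(smooth_on_mxP _ oU) sN; apply/smooth_on_mxP => // i j.
apply: (@smooth_on_eq _ _ _ (fun x => \sum_k M x i k * N x k j)) => //.
  by move=> x _; rewrite mxE.
by apply: smooth_on_sum => // k _; exact: smooth_onM.
Qed.

Lemma smooth_on_trmx a b U (M : V -> 'M[R]_(a, b)) : open U ->
  smooth_on U M -> smooth_on U (fun x => (M x)^T).
Proof.
move=> oU /(smooth_on_mxP _ oU) sM; apply/smooth_on_mxP => // i j.
by apply: (smooth_on_eq oU _ (sM j i)) => x _; rewrite mxE.
Qed.

Lemma smooth_on_scalemx a b U (f : V -> R) (M : V -> 'M[R]_(a, b)) : open U ->
  smooth_on U f -> smooth_on U M -> smooth_on U (fun x => f x *: M x).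
Proof.
move=> oU sf /(smooth_on_mxP _ oU) sM; apply/smooth_on_mxP => // i j.
by apply: (smooth_on_eq oU _ (smooth_onM oU sf (sM i j))) => x _; rewrite mxE.
Qed.

Lemma smooth_onN_mx a b U (M : V -> 'M[R]_(a, b)) : open U ->
  smooth_on U M -> smooth_on U (fun x => - M x).
Proof.
move=> oU sM; have s1 : smooth_on U (fun _ : V => -1 : R) by exact: smooth_on_cst.
apply: smooth_on_eq (smooth_on_scalemx oU s1 sM) => // x _.
by rewrite scaleN1r.
Qed.

Lemma smooth_on_det a U (M : V -> 'M[R]_a) : open U ->
  smooth_on U M -> smooth_on U (fun x => \det (M x)).
Proof.
move=> oU /(smooth_on_mxP _ oU) sM; rewrite /determinant.
apply: smooth_on_sum => // s _; apply: smooth_onM => //; first exact: smooth_on_cst.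
by apply: smooth_on_prod => // i _.
Qed.

Lemma smooth_on_invmx a U (M : V -> 'M[R]_a) : open U ->
  (forall x, U x -> M x \in unitmx) -> smooth_on U M -> smooth_on U (fun x => invmx (M x)).
Proof.
move=> oU uM sM; have sMij := (smooth_on_mxP _ oU).1 sM; apply/smooth_on_mxP => // i j.
pose g x := (\det (M x))^-1 * ((-1) ^+ (j + i) * \det (row' j (col' i (M x)))).
apply: (@smooth_on_eq _ _ _ g) => //.
  by move=> x Ux; rewrite /invmx uM// !mxE.
apply: smooth_onM => //.
  apply: smooth_onV => //; last exact: smooth_on_det.
  by move=> x Ux; have := uM x Ux; rewrite unitmxE unitfE.
apply: smooth_onM => //; first exact: smooth_on_cst.
apply: smooth_on_det => //; apply/smooth_on_mxP => // k l.
by apply: (smooth_on_eq oU _ (sMij (lift j k) (lift i l))) => x _; rewrite !mxE.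
Qed.

End SmoothMatrices.
End SmoothCalculus.

(** * Symmetry of second derivatives, products of matrices, functions on R x V *)

Section Derivatives.
Variable R : realType.

Lemma is_derive_line (V W : normedModType R) (f : V -> W) (u w : V) (r : R) :
  derivable f (r *: u + w) u ->
  is_derive r (1 : R) (fun s : R => f (s *: u + w)) ('D_u f (r *: u + w)).
Proof.
move=> df; have E : (fun h : R => h^-1 *: (f ((h *: (1 : R) + r) *: u + w) - f (r *: u + w))) =
    (fun h : R => h^-1 *: (f (h *: u + (r *: u + w)) - f (r *: u + w))).
  by apply/funext => h; rewrite [h *: 1]mulr1 scalerDl addrA.
by split; rewrite /derivable /derive /= E.
Qed.

(** The mean value theorem is applied twice: along [u] to the difference [phi] of two parallel
    edges, then along [v] to ['D_u f]. *)
Lemma second_difference (V : normedModType R) (f : V -> R) (u v x : V) (s : R) :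
  0 < s ->
  (forall a b, 0 <= a <= s -> 0 <= b <= s ->
    differentiable f (a *: u + (b *: v + x)) /\
    differentiable ('D_u f) (a *: u + (b *: v + x))) ->
  exists a b, [/\ 0 <= a <= s, 0 <= b <= s &
    f (s *: u + (s *: v + x)) - f (s *: u + x) - f (s *: v + x) + f x =
    'D_v ('D_u f) (a *: u + (b *: v + x)) * s ^+ 2].
Proof.
move=> s0 df.
have Oitv b : b \in `]0, s[ -> 0 <= b <= s by rewrite in_itv/= => /andP[/ltW -> /ltW ->].
have bnd0 : 0 <= (0 : R) <= s by rewrite lexx ltW.
have bnds : 0 <= s <= s by rewrite lexx ltW.
pose phi r := f (r *: u + (s *: v + x)) - f (r *: u + x).
pose dphi r := 'D_u f (r *: u + (s *: v + x)) - 'D_u f (r *: u + x).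
have df0 a : 0 <= a <= s -> differentiable f (a *: u + x) /\ differentiable ('D_u f) (a *: u + x).
  by move=> /df/(_ bnd0); rewrite scale0r add0r.
have dphiP r : 0 <= r <= s -> is_derive r 1 phi (dphi r).
  move=> rs; apply: is_deriveB; apply: is_derive_line; apply: diff_derivable.
    by have [] := df _ _ rs bnds.
  by have [] := df0 _ rs.
have cphi : {within `[0, s], continuous phi}.
  apply: continuous_in_subspaceT => r; rewrite inE/= in_itv/= => rs.
  apply: differentiable_continuous; apply/derivable1_diffP.
  by have [] := dphiP _ rs.
have [a /Oitv as_ phiE] := MVT s0 (fun r rs => dphiP r (Oitv r rs)) cphi.
pose psi r := 'D_u f (r *: v + (a *: u + x)).
have psiP r : 0 <= r <= s -> is_derive r 1 psi ('D_v ('D_u f) (r *: v + (a *: u + x))).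
  move=> rs; apply: is_derive_line; apply: diff_derivable.
  by rewrite addrCA; have [] := df _ _ as_ rs.
have cpsi : {within `[0, s], continuous psi}.
  apply: continuous_in_subspaceT => r; rewrite inE/= in_itv/= => rs.
  apply: differentiable_continuous; apply/derivable1_diffP.
  by have [] := psiP _ rs.
have [b /Oitv bs psiE] := MVT s0 (fun r rs => psiP r (Oitv r rs)) cpsi.
exists a, b; split => //.
have -> : a *: u + (b *: v + x) = b *: v + (a *: u + x) by rewrite addrCA.
rewrite expr2 mulrA.
have <- : dphi a = 'D_v ('D_u f) (b *: v + (a *: u + x)) * s.
  by move: psiE; rewrite subr0 /psi scale0r add0r => <-; rewrite [s *: v + _]addrCA.
move: phiE; rewrite subr0 /phi !scale0r !add0r => <-.
by rewrite opprB; ring.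
Qed.

Lemma continuous_pair_ball (V : normedModType R) (U : set V) (g h : V -> R) (x : V) (e : R) :
  nbhs x U -> {for x, continuous g} -> {for x, continuous h} -> 0 < e ->
  exists2 d, 0 < d & forall y, ball x d y ->
    [/\ U y, `|g x - g y| < e & `|h x - h y| < e].
Proof.
move=> Ux /cvgrPdist_lt cg /cvgrPdist_lt ch e0.
have : \forall y \near x, [/\ U y, `|g x - g y| < e & `|h x - h y| < e].
  by apply: filterS3 Ux (cg _ e0) (ch _ e0) => y Uy gy hy; split.
by move=> /nbhs_ballP[d /= d0 dP]; exists d.
Qed.

Lemma quotient_close (D p p' q q' s e : R) : 0 < s -> D = p' * s ^+ 2 -> D = q' * s ^+ 2 ->
  `|p - p'| < e / 2 -> `|q - q'| < e / 2 -> `|q - p| <= e.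
Proof.
move=> s0 -> /(mulIf _) -> ; last by rewrite expf_neq0// gt_eqF.
move=> pe qe; rewrite (splitr e) (le_trans _ (ltW (ltrD qe pe)))//.
by rewrite [X in _ <= _ + X]distrC; apply: le_trans (ler_normD _ _); rewrite addrA subrK.
Qed.

(** Schwarz's theorem: the second difference over the parallelogram with sides [s *: u] and [s *: v]
    is symmetric in [u] and [v]. Divided by [s ^+ 2] it is a value of either mixed derivative at a
    point close to [x], and both are continuous. *)
Lemma derive_swap (V : normedModType R) (U : set V) (f : V -> R) (u v x : V) :
  open U -> smooth_on U f -> U x -> 'D_u ('D_v f) x = 'D_v ('D_u f) x.
Proof.
move=> oU sf Ux.
apply/eqP; rewrite -subr_eq0 -normr_le0; apply/ler_addgt0Pr => e e0; rewrite add0r.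
have cont w w' : {for x, continuous ('D_w ('D_w' f))}.
  apply: differentiable_continuous; apply: smooth_on_differentiable Ux.
  by do 2 apply: smooth_on_derive.
have e20 : 0 < e / 2 by rewrite divr_gt0.
have [d d0 dP] := continuous_pair_ball (open_nbhs_nbhs (conj oU Ux)) (cont u v) (cont v u) e20.
(* Keeps the whole parallelogram in the ball of radius [d]; the summand 1 covers the case where [u]
   and [v] both vanish. *)
pose s := d / (2 * (`|u| + `|v| + 1)).
have c0 : 0 < `|u| + `|v| + 1 by rewrite ltr_wpDl// addr_ge0.
have s0 : 0 < s by rewrite divr_gt0// mulr_gt0.
have near_s a b : 0 <= a <= s -> 0 <= b <= s -> ball x d (a *: u + (b *: v + x)).
  move=> /andP[a0 as_] /andP[b0 bs]; rewrite -ball_normE/= distrC addrA addrK.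
  rewrite (le_lt_trans (ler_normD _ _))// !normrZ !ger0_norm//.
  apply: (@le_lt_trans _ _ (s * (`|u| + `|v|))).
    by rewrite mulrDr lerD// ler_wpM2r.
  apply: (@lt_le_trans _ _ (s * (2 * (`|u| + `|v| + 1)))).
    by rewrite ltr_pM2l//; lra.
  by rewrite /s divfK// gt_eqF// mulr_gt0.
have sd w y : ball x d y -> differentiable f y /\ differentiable ('D_w f) y.
  move=> /dP[Uy _ _]; split; first exact: smooth_on_differentiable Uy.
  by apply: smooth_on_differentiable Uy; exact: smooth_on_derive.
have [a [b [as_ bs E1]]] := second_difference s0 (fun a b as_ bs => sd u _ (near_s a b as_ bs)).
have near_s' a' b' : 0 <= a' <= s -> 0 <= b' <= s -> ball x d (a' *: v + (b' *: u + x)).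
  by move=> ? ?; rewrite addrCA; exact: near_s.
have [a' [b' [as' bs' E2]]] := second_difference s0 (fun a b as_ bs => sd v _ (near_s' a b as_ bs)).
have [_ _ H1] := dP _ (near_s _ _ as_ bs).
have [_ H2 _] := dP _ (near_s' _ _ as' bs').
apply: (quotient_close s0 E1 _ H1 H2).
rewrite -E2 [s *: v + (s *: u + _)]addrCA; congr (_ + _); exact: addrAC.
Qed.

Lemma derive_mulmx (V : normedModType R) a b c (M : V -> 'M[R]_(a, b))
    (N : V -> 'M[R]_(b, c)) (x v : V) : differentiable M x -> differentiable N x ->
  'D_v (fun y => M y *m N y) x = 'D_v M x *m N x + M x *m 'D_v N x.
Proof.
move=> dM dN.
have dMij i j : differentiable (fun y => M y i j) x by have /differentiable_mxP := dM.
have dNij i j : differentiable (fun y => N y i j) x by have /differentiable_mxP := dN.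
have E i j : (fun y => (M y *m N y) i j) = \sum_k ((fun y => M y i k) * (fun y => N y k j)).
  by apply/funext => y; rewrite mxE fct_sumE.
have dMN : differentiable (fun y => M y *m N y) x.
  apply/differentiable_mxP => i j; rewrite E; apply: differentiable_sum => k.
  exact: differentiableM.
apply/matrixP => i j; rewrite derive_mxE// E derive_sum; last first.
  by move=> k; apply: derivableM; exact: diff_derivable.
rewrite !mxE -big_split; apply: eq_bigr => k _ /=.
rewrite deriveM; [|exact: diff_derivable|exact: diff_derivable].
rewrite (derive_mxE _ _ _ dM) (derive_mxE _ _ _ dN).
by rewrite [X in _ = X + _]mulrC addrC.
Qed.

Lemma differentiable_mulmx (V : normedModType R) a b c (M : V -> 'M[R]_(a, b))
    (N : V -> 'M[R]_(b, c)) (x : V) : differentiable M x -> differentiable N x ->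
  differentiable (fun y => M y *m N y) x.
Proof.
move=> dM dN; apply/differentiable_mxP => i j.
rewrite (_ : (fun y => _) = \sum_k ((fun y => M y i k) * (fun y => N y k j))).
  apply: differentiable_sum => k; apply: differentiableM.
    by have /differentiable_mxP := dM.
  by have /differentiable_mxP := dN.
by apply/funext => y; rewrite mxE fct_sumE.
Qed.

Lemma differentiable_trmx (V : normedModType R) a b (M : V -> 'M[R]_(a, b)) (x : V) :
  differentiable M x -> differentiable (fun y => (M y)^T) x.
Proof.
move=> /differentiable_mxP dM; apply/differentiable_mxP => i j.
by rewrite (_ : (fun y => _) = (fun y => M y j i))//; apply/funext => y; rewrite mxE.
Qed.

Lemma derive_trmx (V : normedModType R) a b (M : V -> 'M[R]_(a, b)) (x v : V) :
  differentiable M x -> 'D_v (fun y => (M y)^T) x = ('D_v M x)^T.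
Proof.
move=> dM; apply/matrixP => i j; rewrite derive_mxE; last exact: differentiable_trmx.
rewrite mxE derive_mxE//; congr ('D_v _ x); apply/funext => y; by rewrite mxE.
Qed.

(** The two difference quotients are literally the same function of [h], so differentiability is not
    assumed. *)
Lemma derive_comp_linear (V V' W : normedModType R) (L : V' -> V) (f : V -> W) x v :
  (forall (h : R) v x, L (h *: v + x) = h *: L v + L x) ->
  'D_v (f \o L) x = 'D_(L v) f (L x).
Proof.
move=> linL; apply: (congr1 (fun F => lim (fmap F (dnbhs (0 : R))))).
by apply/funext => h; rewrite /= linL.
Qed.

(** Turns a derivative in space at fixed [t] into a derivative of the joint function, whose
    smoothness is what a variation provides. *)
Lemma derive_slice (V W : normedModType R) (F : R * V -> W) (t : R) (x v : V) :
  'D_v (fun y => F (t, y)) x = 'D_(0, v) F (t, x).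
Proof.
apply: (congr1 (fun F => lim (fmap F (dnbhs (0 : R))))).
apply/funext => h /=; congr (_ *: (F _ - _)).
by congr (_, _); rewrite /= ?scaler0 ?mulr0 ?add0r.
Qed.

Lemma smooth_on_linear (V V' W : normedModType R) (L : V' -> V) (U : set V) (f : V -> W) :
  (forall x, differentiable L x) ->
  (forall (h : R) v x, L (h *: v + x) = h *: L v + L x) ->
  smooth_on U f -> smooth_on (L @^-1` U) (f \o L).
Proof.
move=> dL linL /smooth_onP sf; apply/smooth_onP => n; elim: n f {sf}(sf n) => [|n IH] f sf.
  split => // x Ux; apply: differentiable_comp => //; exact: Cn_differentiable sf.
split => [x Ux|v].
  by apply: differentiable_comp => //; exact: Cn_differentiable sf.
have -> : 'D_v (f \o L) = ('D_(L v) f) \o L.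
  by apply/funext => x; exact: derive_comp_linear.
exact/IH/Cn_derive.
Qed.

Lemma differentiable_snd (V : normedModType R) (x : R * V) : differentiable (@snd R V) x.
Proof.
by apply: linear_differentiable => -[a b]; exact: cvg_snd.
Qed.

Lemma differentiable_fst (V : normedModType R) (x : R * V) : differentiable (@fst R V) x.
Proof.
by apply: (@linear_differentiable _ _ R) => -[a b]; exact: cvg_fst.
Qed.

Lemma smooth_on_snd (V W : normedModType R) (U : set V) (f : V -> W) :
  smooth_on U f -> smooth_on [set z : R * V | U z.2] (fun z => f z.2).
Proof. exact: (smooth_on_linear (@differentiable_snd V)). Qed.

Lemma smooth_on_fst (V : normedModType R) (U : set (R * V)) : smooth_on U (fun z => z.1).
Proof.
have sid : smooth_on [set: R] (@id R).
  have dv v : 'D_v (@id R) = fun=> v by apply/funext => x; rewrite derive_id.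
  apply/smooth_onP => n; case: n => [|n]; split; try by move=> x _; exact: ex_diff.
    by [].
  by move=> v; rewrite dv; exact: Cn_cst.
apply: (smooth_on_subset _ (smooth_on_linear (@differentiable_fst V) _ sid)) => //.
Qed.

End Derivatives.

(** * Integrals of compactly supported functions *)

Section CompactlySupported.
Variable R : realType.
Implicit Types r c e : R.

Lemma coord_le_norm a b (x : 'M[R]_(a, b)) i j : `|x i j| <= `|x|.
Proof.
rewrite [leRHS]/Num.Def.normr/= mx_normrE.
exact: (le_bigmax _ (fun ij : 'I_a * 'I_b => `|x ij.1 ij.2|) (i, j)).
Qed.

Lemma mx_norm_le a b (x : 'M[R]_(a, b)) c :
  0 <= c -> (forall i j, `|x i j| <= c) -> `|x| <= c.
Proof.
by move=> c0 xc; rewrite [leLHS]/Num.Def.normr/= mx_normrE bigmax_le.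
Qed.

Definition slice m (F : 'rV[R]_m.+1 -> R) (s : R) : 'rV[R]_m -> R :=
  fun v => F (row_mx (s%:M : 'rV_1) v).

Lemma norm_row_mx_le m (s : R) (v : 'rV[R]_m) :
  `|row_mx (s%:M : 'rV_1) v : 'rV[R]_m.+1| <= Num.max `|s| `|v|.
Proof.
apply: mx_norm_le => [|i j]; first by rewrite le_max normr_ge0.
rewrite le_max; rewrite mxE; case: splitP => k _.
  by rewrite !ord1 mxE eqxx lexx.
by rewrite coord_le_norm orbT.
Qed.

Lemma norm_row_mx_ge m (s : R) (v : 'rV[R]_m) :
  `|s| <= `|row_mx (s%:M : 'rV_1) v : 'rV[R]_m.+1| /\
  `|v| <= `|row_mx (s%:M : 'rV_1) v : 'rV[R]_m.+1|.
Proof.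
split; last first.
  apply: mx_norm_le => // i j; have := @coord_le_norm 1 (1 + m) (row_mx (s%:M : 'rV_1) v) i (rshift 1 j).
  by rewrite row_mxEr.
have := @coord_le_norm 1 (1 + m) (row_mx (s%:M : 'rV_1) v) 0 (lshift m 0).
by rewrite (row_mxEl (s%:M : 'rV_1)) mxE eqxx.
Qed.

(** Joint continuity in the slice parameter and the remaining variables, in the form that a
    near-covering argument on a compact box consumes. *)
Lemma row_mx_cvg m (s : R) (v : 'rV[R]_m) (F : 'rV[R]_m.+1 -> R) :
  {for (row_mx (s%:M : 'rV_1) v : 'rV[R]_m.+1), continuous F} ->
  forall e, 0 < e -> \forall w \near v & s' \near s,
    `|F (row_mx (s%:M : 'rV_1) v) - F (row_mx (s'%:M : 'rV_1) w)| < e.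
Proof.
move=> /cvgrPdist_lt cF e /cF /nbhs_ballP[d /= d0 dF].
exists (ball v d, ball s d); first by split; exact: nbhsx_ballx.
move=> [w s'] [/= vw ss']; apply: dF; rewrite -ball_normE/=.
rewrite (_ : _ - _ = row_mx ((s - s')%:M : 'rV_1) (v - w)); last first.
  apply/rowP => i; rewrite !mxE; case: splitP => k _.
    by rewrite !mxE !ord1 eqxx.
  by rewrite !mxE.
by apply: le_lt_trans (norm_row_mx_le _ _) _; rewrite gt_max; move: vw ss';
  rewrite -!ball_normE/= => -> ->.
Qed.

(** The support is bounded by a radius for the sup norm, so a slice keeps the same [r] and the
    iterated integral can be treated by induction on the dimension. *)
Definition ccont r m (F : 'rV[R]_m -> R) : Prop :=
  continuous F /\ forall x, r < `|x| -> F x = 0.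

Lemma ccont_comb r m (F G : 'rV[R]_m -> R) c : ccont r F -> ccont r G ->
  ccont r (fun x => F x + c * G x).
Proof.
move=> [cF F0] [cG G0]; split=> [x|x rx]; last by rewrite F0// G0// mulr0 addr0.
have cFx : F y @[y --> x] --> F x by exact: cF.
have cGx : G y @[y --> x] --> G x by exact: cG.
exact: cvgD cFx (cvgM (cvg_cst c) cGx).
Qed.

Lemma ccont_slice r m (F : 'rV[R]_m.+1 -> R) s : ccont r F -> ccont r (slice F s).
Proof.
move=> [cF F0]; split=> [v|v rv]; last first.
  by rewrite /slice F0// (lt_le_trans rv)//; have [] := norm_row_mx_ge s v.
apply: (proj2 (@cvgrPdist_lt R R _ (nbhs v) _ (slice F s) (slice F s v))) => e e0.
have [[A B] [/= Av Bs] AB] := row_mx_cvg (cF (row_mx (s%:M : 'rV_1) v)) e0.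
apply: (@filterS _ (nbhs v) _ A) => // w Aw; apply: (AB (w, s)); split => //=; exact: nbhs_singleton.
Qed.

Definition box r m : set 'rV[R]_m := [set v | forall i, v ord0 i \in `[- r, r]].

Lemma box_compact r m : compact (@box r m).
Proof. by apply: (@rV_compact R m (fun=> [set` `[- r, r]])) => i; exact: segment_compact. Qed.

Lemma notin_box r m (v : 'rV[R]_m) : ~ box r v -> r < `|v|.
Proof.
move=> /existsNP[i vi]; apply: lt_le_trans (coord_le_norm v ord0 i).
by rewrite ltNge; apply/negP => vr; apply: vi; rewrite in_itv/= -ler_norml.
Qed.

Lemma ccont1_integrable r (f : R -> R) : continuous f -> (forall s, r < `|s| -> f s = 0) ->
  (@lebesgue_measure R).-integrable setT (EFin \o f).
Proof.
move=> cf f0; have -> : EFin \o f = (EFin \o f) \_ `[- r, r].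
  apply/funext => s; rewrite patchE; case: ifPn => //= /negP sr.
  rewrite f0// ltNge; apply/negP => ?; apply: sr.
  by rewrite inE/= in_itv/= -ler_norml.
apply: (proj1 (@integrable_mkcond _ _ R (@lebesgue_measure R) `[- r, r] (EFin \o f) (measurable_itv _))).
have := @continuous_compact_integrable R f `[- r, r].
apply; [exact: segment_compact|exact: continuous_subspaceT].
Qed.

Lemma ccont1_bound r c (f : R -> R) : 0 <= r -> continuous f -> (forall s, r < `|s| -> f s = 0) ->
  (forall s, `|f s| <= c) -> `|\int[@lebesgue_measure R]_(s in [set: R]) f s| <= 2 * r * c.
Proof.
move=> r0 cf f0 fc; have intf := ccont1_integrable cf f0.
apply: le_trans (le_normr_Rintegral _ _) _ => //.
have -> : (\int[@lebesgue_measure R]_(s in [set: R]) `|f s|) =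
    \int[@lebesgue_measure R]_(s in `[- r, r]) `|f s|.
  rewrite [RHS]Rintegral_mkcond; apply: eq_Rintegral => s _.
  rewrite patchE; case: ifPn => //= /negP sr.
  rewrite f0 ?normr0// ltNge; apply/negP => ?; apply: sr.
  by rewrite inE/= in_itv/= -ler_norml.
apply: (@le_trans _ _ (\int[@lebesgue_measure R]_(s in `[- r, r]) c)).
  apply: le_Rintegral => //.
  - apply: continuous_compact_integrable; first exact: segment_compact.
    apply: continuous_subspaceT => x; apply: continuous_comp; first exact: cf.
    exact: norm_continuous.
  - apply: continuous_compact_integrable; first exact: segment_compact.
    by apply: continuous_subspaceT => x; exact: cst_continuous.
rewrite Rintegral_cst//.
suff -> : fine (@lebesgue_measure R `[- r, r]%classic) = 2 * r by rewrite mulrC.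
rewrite lebesgue_measure_itv/= lte_fin.
by case: ifPn => [_|]; rewrite /=; lra.
Qed.

(** Linearity and the bound need each other in the induction. Both, in dimension [m], give
    continuity of the inner integral as a function of the outer variable; that continuity gives the
    integrability on which linearity and the bound in dimension [m.+1] rest. *)
Lemma integral_rV_linear_bounded m r : 0 <= r ->
  (forall (F G : 'rV[R]_m -> R) c, ccont r F -> ccont r G ->
    integral_rV (fun x => F x + c * G x) = integral_rV F + c * integral_rV G) /\
  (forall (F : 'rV[R]_m -> R) c, ccont r F -> (forall x, `|F x| <= c) ->
    `|integral_rV F| <= (2 * r) ^+ m * c).
Proof.
move=> r0; elim: m => [|m [IHlin IHbnd]].
  by split => // F c _ Fc; rewrite expr0 mul1r; exact: Fc.
have IF (F : 'rV[R]_m.+1 -> R) : ccont r F ->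
    continuous (fun s => integral_rV (slice F s)) /\
    (forall s, r < `|s| -> integral_rV (slice F s) = 0).
  move=> cF; split=> [s|s rs]; last first.
    have -> : slice F s = fun=> 0.
      apply/funext => v; rewrite /slice (proj2 cF)// (lt_le_trans rs)//.
      by have [] := norm_row_mx_ge s v.
    have cz : ccont r (fun _ : 'rV[R]_m => 0 : R) by split => // x; exact: cst_continuous.
    have z0 (x : 'rV[R]_m) : `|0 : R| <= 0 by rewrite normr0.
    by apply/eqP; have := IHbnd _ 0 cz z0; rewrite mulr0 normr_le0.
  apply/cvgrPdist_le => e e0.
  (* Chosen so that [(2 * r) ^+ m * e' <= e]; the summand 1 keeps the denominator positive when
     [r = 0]. *)
  pose e' := e / ((2 * r) ^+ m + 1).
  have p0 : 0 <= (2 * r) ^+ m by rewrite exprn_ge0// mulr_ge0.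
  have e'0 : 0 < e' by rewrite divr_gt0// ltr_wpDl.
  (* Compactness of the box makes nearby slices uniformly close on it; outside the box both slices
     vanish. *)
  have : \forall s' \near s, @box r m `<=` (fun v => `|slice F s v - slice F s' v| < e').
    have /compact_near_coveringP cov := @box_compact r m.
    apply: (cov _ (nbhs s) (fun s' v => `|slice F s v - slice F s' v| < e')) => v _.
    have e20 : 0 < e' / 2 by rewrite divr_gt0.
    have [[A B] [/= Av Bs] AB] := row_mx_cvg (proj1 cF (row_mx (s%:M : 'rV_1) v)) e20.
    exists (A, B) => //= -[w s'] [/= Aw Bs'].
    have /= H1 := AB (w, s') (conj Aw Bs').
    have /= H2 := AB (w, s) (conj Aw (nbhs_singleton Bs)).
    rewrite (splitr e') (le_lt_trans _ (ltrD H2 H1))// distrC.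
    rewrite distrC [X in _ <= X + _]distrC; apply: le_trans (ler_normD _ _).
    by rewrite addrA subrK.
  apply: filterS => s' Hs'.
  have -> : integral_rV (slice F s) - integral_rV (slice F s') =
      integral_rV (fun v => slice F s v + (-1) * slice F s' v).
    by rewrite IHlin ?mulN1r//; exact: ccont_slice.
  apply: (@le_trans _ _ ((2 * r) ^+ m * e')).
    apply: IHbnd; first by apply: ccont_comb; exact: ccont_slice.
    move=> v; rewrite mulN1r; have [/Hs'/ltW//|/notin_box rv] := pselect (box r v).
    by rewrite !(proj2 (ccont_slice _ cF))// subrr normr0 ltW.
  rewrite /e' mulrA ler_pdivrMr ?ltr_wpDl// mulrDr mulr1 mulrC.
  by rewrite lerDl ltW.
split=> [F G c cF cG|F c cF Fc].
  have [cIF IF0] := IF _ cF; have [cIG IG0] := IF _ cG.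
  rewrite /= -RintegralZl//; last exact: ccont1_integrable IG0.
  rewrite -RintegralD//.
  - by apply: eq_Rintegral => s _; apply: IHlin; exact: ccont_slice.
  - exact: ccont1_integrable IF0.
  - apply: (@ccont1_integrable r) => [s|s rs]; last by rewrite (IG0 _ rs) mulr0.
    by apply: cvgM; [exact: cvg_cst|exact: cIG].
have [cIF IF0] := IF _ cF.
rewrite exprS -mulrA; apply: (ccont1_bound r0 cIF IF0) => s.
by apply: IHbnd => [|v]; [exact: ccont_slice|exact: Fc].
Qed.

Lemma integral_rV_ge0 m (F : 'rV[R]_m -> R) : (forall x, 0 <= F x) -> 0 <= integral_rV F.
Proof.
elim: m F => [|m IH] F F0; first exact: F0.
by apply: Rintegral_ge0 => s _; apply: IH.
Qed.

Lemma le_integral_rV m r (F G : 'rV[R]_m -> R) : 0 <= r -> ccont r F -> ccont r G ->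
  (forall x, F x <= G x) -> integral_rV F <= integral_rV G.
Proof.
move=> r0 cF cG FG; rewrite -subr_ge0 -mulN1r.
have [lin _] := integral_rV_linear_bounded m r0.
by rewrite -lin//; apply: integral_rV_ge0 => x; rewrite mulN1r subr_ge0.
Qed.

Lemma MVT_symmetric (f df : R -> R) (t d h : R) :
  (forall s, `|s - t| < d -> is_derive s 1 f (df s)) -> `|h| < d ->
  exists2 c, `|c - t| <= `|h| & f (h + t) - f t = df c * h.
Proof.
move=> fd hd.
have cont a b : (forall s, s \in `[a, b] -> `|s - t| < d) -> {within `[a, b], continuous f}.
  move=> ab; apply: continuous_in_subspaceT => s; rewrite inE => /ab/fd[? _].
  by apply: differentiable_continuous; apply/derivable1_diffP.
have [h0|h0] := leP 0 h.
  have hP s : s \in `[t, h + t] -> `|s - t| <= h.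
    by rewrite in_itv/= => /andP[? ?]; rewrite ler_norml; lra.
  move: hd; rewrite ger0_norm// => hd.
  have htt : t <= h + t by rewrite lerDr.
  have [||c cin ->] := @MVT_segment R f df t (h + t) htt.
  - move=> s sin; apply: fd; apply: le_lt_trans hd; apply: hP.
    exact: subset_itv_oo_cc.
  - by apply: cont => s /hP/le_lt_trans; apply.
  by exists c; [exact: hP|rewrite addrK].
have hP s : s \in `[h + t, t] -> `|s - t| <= - h.
  by rewrite in_itv/= => /andP[? ?]; rewrite ler_norml; lra.
move: hd; rewrite ltr0_norm// => hd.
have htt : h + t <= t by rewrite gerDr ltW.
have [||c cin E] := @MVT_segment R f df (h + t) t htt.
- move=> s sin; apply: fd; apply: le_lt_trans hd; apply: hP.
  exact: subset_itv_oo_cc.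
- by apply: cont => s /hP/le_lt_trans; apply.
exists c; first exact: hP.
by rewrite -opprB E; ring.
Qed.

(** By the mean value theorem the difference quotient at [x] is a value of [dU] at a time close to
    [t]. Continuity of [dU] at the points [(t, x)] and compactness of the box make the error
    uniformly small, and the bound on integrals concludes. *)
Lemma derive_integral_rV m r (U dU : R * 'rV[R]_m -> R) (t d : R) : 0 <= r -> 0 < d ->
  (forall s, `|s - t| < d -> ccont r (fun x => U (s, x))) ->
  ccont r (fun x => dU (t, x)) ->
  (forall s x, `|s - t| < d -> is_derive s 1 (fun s => U (s, x)) (dU (s, x))) ->
  (forall x, {for (t, x), continuous dU}) ->
  is_derive t 1 (fun s => integral_rV (fun x => U (s, x))) (integral_rV (fun x => dU (t, x))).
Proof.
move=> r0 d0 cU cdU dUP cdUt.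
have [lin bnd] := integral_rV_linear_bounded m r0.
have ctt : ccont r (fun x => U (t, x)) by apply: cU; rewrite subrr normr0.
suff cvgI : (fun h : R => h^-1 *: (integral_rV (fun x => U (h *: (1 : R) + t, x)) -
    integral_rV (fun x => U (t, x)))) @ 0^' --> integral_rV (fun x => dU (t, x)).
  by split; [apply/cvg_ex; eexists; exact: cvgI|exact: cvg_lim cvgI].
apply/cvgrPdist_le => e e0.
pose e' := e / ((2 * r) ^+ m + 1).
have p0 : 0 <= (2 * r) ^+ m by rewrite exprn_ge0// mulr_ge0.
have e'0 : 0 < e' by rewrite divr_gt0// ltr_wpDl.
(* The error of the difference quotient; it equals [dU (t, x) - dU (c, x)] for some [c] with
   [|c - t| <= |h|]. *)
pose Q (h : R) (x : 'rV[R]_m) := dU (t, x) + (-1) * (h^-1 * (U (h + t, x) - U (t, x))).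
have hd : \forall h \near (0 : R)^', `|h| < d by exact: dnbhs0_lt.
have hn0 : \forall h \near (0 : R)^', h != 0 by exact: nbhs_dnbhs_neq.
have : \forall h \near (0 : R)^', @box r m `<=` (fun x => `|Q h x| <= e').
  have /compact_near_coveringP cov := @box_compact r m.
  apply: (cov _ ((0 : R)^') (fun h x => `|Q h x| <= e')) => x _.
  have e20 : 0 < e' / 2 by rewrite divr_gt0.
  have /cvgrPdist_lt/(_ _ e20)/nbhs_ballP[a /= a0 aP] := cdUt x.
  have ha : \forall h \near (0 : R)^', `|h| < a by exact: dnbhs0_lt.
  exists (ball x a, [set h : R | [/\ `|h| < d, h != 0 & `|h| < a]]).
    split; first exact: nbhsx_ballx.
    by apply: filterS3 hd hn0 ha => h.
  move=> [y h] [/= xy [hd' h0 ha']].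
  have [c ch E] := @MVT_symmetric (fun s => U (s, y)) (fun s => dU (s, y)) t d h (fun s sd => dUP s y sd) hd'.
  rewrite /Q E [h^-1 * _]mulrC mulfK// mulN1r.
  have yt : ball (t, x) a (t, y) by split => //=; exact: ballxx.
  have yc : ball (t, x) a (c, y).
    by split => //=; rewrite -ball_normE/= distrC; exact: le_lt_trans ha'.
  rewrite (splitr e') (le_trans _ (ltW (ltrD (aP _ yt) (aP _ yc))))//.
  by rewrite [X in _ <= X + _]distrC; apply: le_trans (ler_normD _ _); rewrite addrA subrK.
apply: filterS3 hd hn0 => h hd' h0 Qh; rewrite [h *: (1 : R)]mulr1.
have cht : ccont r (fun x => U (h + t, x)) by apply: cU; rewrite addrK.
have -> : integral_rV (fun x => dU (t, x)) -
    h^-1 *: (integral_rV (fun x => U (h + t, x)) - integral_rV (fun x => U (t, x))) =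
    integral_rV (Q h).
  have -> : Q h = fun x => (dU (t, x) + (- h^-1) * (U (h + t, x) + (-1) * U (t, x))).
    by apply/funext => x; rewrite /Q; ring.
  rewrite (lin _ _ _ cdU (ccont_comb (-1) cht ctt)) (lin _ _ _ cht ctt).
  by rewrite /GRing.scale/=; ring.
apply: (@le_trans _ _ ((2 * r) ^+ m * e')).
  apply: bnd.
    have -> : Q h = fun x => (dU (t, x) + (- h^-1) * (U (h + t, x) + (-1) * U (t, x))).
      by apply/funext => x; rewrite /Q; ring.
    by do 2 apply: ccont_comb => //.
  move=> x; have [/Qh//|/notin_box rv] := pselect (box r x).
  by rewrite /Q (proj2 cht)// (proj2 ctt)// (proj2 cdU)// subrr !mulr0 addr0 normr0 ltW.
rewrite /e' mulrA ler_pdivrMr ?ltr_wpDl// mulrDr mulr1 mulrC.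
by rewrite lerDl ltW.
Qed.

End CompactlySupported.

(** * Minima in one variable; integrals over a chart depending on a parameter *)

Section ChartIntegrals.
Variable R : realType.

Lemma derivable_near_quotient (G : R -> R) (c : R) : derivable G 0 1 -> derive1 G 0 = c -> c < 0 ->
  \forall h \near (0 : R)^', `|c - h^-1 *: (G (h *: (1 : R) + 0) - G 0)| < - c.
Proof.
move=> dG; rewrite derive1E => Gc c0.
have : (fun h : R => h^-1 *: (G (h *: (1 : R) + 0) - G 0)) @ 0^' --> 'D_1 G 0 by exact: dG.
by rewrite Gc => /cvgrPdist_lt; apply; rewrite oppr_gt0.
Qed.

(** The minimum is interior, so the first derivative vanishes at 0. If the second derivative were
    negative, the first would be negative just to the right of 0, and the mean value theorem would
    give a value below [F 0]. *)
Lemma second_derivative_min (F : R -> R) (d : R) : 0 < d ->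
  (forall t, `|t| < d -> derivable F t 1) -> derivable (derive1 F) 0 1 ->
  (forall t, `|t| < d -> F 0 <= F t) -> 0 <= derive1n 2 F 0.
Proof.
move=> d0 dF ddF Fmin; rewrite -[derive1n 2 F]/(derive1 (derive1 F)) leNgt; apply/negP => neg.
have n0 : `|0 : R| < d by rewrite normr0.
have F'0 : derive1 F 0 = 0.
  have ab : - d <= d by lra.
  have [|||_ dF0] := @derive1_at_min R F (- d) d 0 ab; last by rewrite derive1E.
  - by move=> t; rewrite in_itv/= => td; apply: dF; rewrite ltr_norml.
  - by rewrite in_itv/=; apply/andP; split; lra.
  - by move=> t; rewrite in_itv/= => td; apply: Fmin; rewrite ltr_norml.
have [c cE] : exists c, derive1 (derive1 F) 0 = c by exists (derive1 (derive1 F) 0).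
rewrite cE in neg.
have := derivable_near_quotient ddF cE neg; rewrite F'0.
move=> /nbhs_ballP[e /= e0 eP].
have F'neg h : 0 < h < e -> derive1 F h < 0.
  move=> /andP[h0 he]; have /= := eP h.
  rewrite -ball_normE/= add0r normrN gtr0_norm// => /(_ he (lt0r_neq0 h0)).
  rewrite subr0 [h *: _]mulr1 addr0 ltr_norml => /andP[+ _].
  rewrite opprK ltrBrDl gtrDr /GRing.scale/= pmulr_rlt0// invr_gt0//.
pose h := Num.min d e / 2.
have h0 : 0 < h by rewrite divr_gt0// lt_min d0.
have hd : h < d.
  by apply: (@lt_le_trans _ _ (Num.min d e)); [rewrite /h; have : 0 < Num.min d e by [rewrite lt_min d0]; lra|rewrite ge_min lexx].
have he : h < e.
  by apply: (@lt_le_trans _ _ (Num.min d e)); [rewrite /h; have : 0 < Num.min d e by [rewrite lt_min d0]; lra|rewrite ge_min lexx orbT].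
have [||x] := @MVT R F (derive1 F) 0 h h0.
- move=> x; rewrite in_itv/= => /andP[x0 xh]; rewrite derive1E; apply: derivableP.
  by apply: dF; rewrite gtr0_norm//; exact: lt_trans hd.
- apply: continuous_in_subspaceT => x; rewrite inE/= in_itv/= => /andP[x0 xh].
  apply: differentiable_continuous; apply/derivable1_diffP; apply: dF.
  by rewrite ger0_norm//; exact: le_lt_trans hd.
rewrite in_itv/= subr0 => /andP[x0 xh] E.
have := F'neg x; rewrite x0 (lt_trans xh he) => /(_ isT) F'x.
have := Fmin h; rewrite gtr0_norm// => /(_ hd); rewrite -subr_ge0 E.
by rewrite leNgt nmulr_rlt0// h0.
Qed.

Lemma near_snd (V : normedModType R) (P : set V) (z : R * V) :
  nbhs z.2 P -> \forall w \near z, P w.2.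
Proof. by case: z => t x nP; exact: (@cvg_snd R V (nbhs t) (nbhs x) _ P nP). Qed.

Lemma is_derive_fst (V W : normedModType R) (U : R * V -> W) (s : R) (x : V) :
  differentiable U (s, x) -> is_derive s 1 (fun s => U (s, x)) ('D_(1, 0) U (s, x)).
Proof.
have E s' : s' *: ((1, 0) : R * V) + (0, x) = (s', x).
  by congr (_, _); rewrite /= ?scaler0 ?add0r// [_ *: _]mulr1 addr0.
move=> dU; have := @is_derive_line R _ _ U ((1, 0) : R * V) (0, x) s; rewrite E.
rewrite (_ : (fun s => _) = (fun s => U (s, x))); last first.
  by apply/funext => s'; rewrite E.
by apply; exact: diff_derivable.
Qed.

Section Chart.
Variables (m : nat) (O K : set 'rV[R]_m) (b : 'rV[R]_m -> R).
Hypotheses (oO : open O) (cK : compact K) (KO : K `<=` O).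
Hypothesis cb : forall x, O x -> {for x, continuous b}.
Hypothesis bK : forall x, O x -> ~ K x -> b x = 0.

(** Extension by zero of the weighted integrand to the whole coordinate space; the weight [b] is
    supported in the compact set [K] inside the chart image [O]. *)
Definition chart_extend (T : Type) (U : T * 'rV[R]_m -> R) (z : T * 'rV[R]_m) : R :=
  ((fun x => b x * U (z.1, x)) \_ O) z.2.

Lemma chart_extendE (T : Type) (U : T * 'rV[R]_m -> R) z : O z.2 ->
  chart_extend U z = b z.2 * U z.
Proof. by move=> Oz; rewrite /chart_extend patchE mem_set//; case: z Oz. Qed.

Lemma chart_extend_out (T : Type) (U : T * 'rV[R]_m -> R) z : ~ K z.2 ->
  chart_extend U z = 0.
Proof.
move=> Kz; rewrite /chart_extend patchE; case: ifPn => //; rewrite inE => Oz.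
by rewrite bK// mul0r.
Qed.

(** Inside [O] this is a product of continuous functions. A point off [O] has the open complement of
    [K] as a neighbourhood, on which the extension vanishes; no control of [U] is needed there. *)
Lemma chart_extend_continuous (U : R * 'rV[R]_m -> R) (z : R * 'rV[R]_m) :
  (O z.2 -> {for z, continuous U}) -> {for z, continuous (chart_extend U)}.
Proof.
move=> cU; have [Oz|Oz] := pselect (O z.2).
  have nO : \forall w \near z, O w.2.
    by apply: near_snd; exact: open_nbhs_nbhs.
  have cbz : (fun w : R * 'rV[R]_m => b w.2) w @[w --> z] --> b z.2.
    case: z {cU nO} Oz => t x Ox; apply: (@cvg_comp _ _ _ snd b _ (nbhs x)); last exact: cb.
    exact: cvg_snd.
  have cUz : U w @[w --> z] --> U z by exact: cU.
  have cM : (fun w => b w.2 * U w) w @[w --> z] --> b z.2 * U z by exact: cvgM cbz cUz.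
  suff : chart_extend U w @[w --> z] --> chart_extend U z by [].
  rewrite (chart_extendE _ Oz).
  have E : {near z, (fun w => b w.2 * U w) =1 chart_extend U}.
    by apply: filterS nO => w Ow; rewrite chart_extendE.
  by apply: cvg_trans cM; move/near_eq_cvg : E; exact.
have Kz : ~ K z.2 by move=> /KO.
have nK : \forall w \near z, ~ K w.2.
  apply: (@near_snd _ (~` K)); apply: (@open_nbhs_nbhs _ _ (~` K)); split => //.
  by rewrite openC; apply: compact_closed => //; exact: norm_hausdorff.
suff : chart_extend U w @[w --> z] --> chart_extend U z by [].
rewrite (chart_extend_out _ Kz).
have E : {near z, (fun=> 0) =1 chart_extend U}.
  by apply: filterS nK => w Kw; rewrite chart_extend_out.
exact: cvg_trans (near_eq_cvg E) (cvg_cst (0 : R)).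
Qed.

Lemma chart_extend_ccont : exists2 r, 0 <= r & forall (U : R * 'rV[R]_m -> R) t,
  (forall x, O x -> {for (t, x), continuous U}) -> ccont r (fun x => chart_extend U (t, x)).
Proof.
have [M [_ MP]] := compact_bounded cK.
(* [compact_bounded] yields a bound for each number strictly above [M], whence [M + 1]; the maximum
   with 0 ensures a nonnegative radius. The radius depends on [K] alone. *)
exists (Num.max 0 (M + 1)); first by rewrite le_max lexx.
move=> U t cU; split=> [x|x]; last first.
  rewrite gt_max => /andP[_ Mx]; apply: chart_extend_out => /= Kx.
  have M1 : M < M + 1 by rewrite ltrDl.
  by have := MP (M + 1) M1 _ Kx => /(lt_le_trans Mx); rewrite ltxx.
apply: (@cvg_comp _ _ _ (fun x => (t, x)) (chart_extend U) _ (nbhs (t, x))).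
  apply: (@cvg_pair _ _ _ (nbhs x) (nbhs t) (nbhs x) _ _ _ (fun=> t) id); last exact: cvg_id.
  exact: cvg_cst.
exact: (@chart_extend_continuous U (t, x) (cU x)).
Qed.

Lemma derive_chart_integral (e : R) (U : R * 'rV[R]_m -> R) (t : R) :
  smooth_on [set z : R * 'rV[R]_m | `|z.1| < e /\ O z.2] U -> `|t| < e ->
  is_derive t 1 (fun t => integral_rV ((fun x => b x * U (t, x)) \_ O))
    (integral_rV ((fun x => b x * 'D_(1, 0) U (t, x)) \_ O)).
Proof.
move=> sU te; have [r r0 rP] := chart_extend_ccont.
have cont (V : R * 'rV[R]_m -> R) s x : smooth_on [set z : R * 'rV[R]_m | `|z.1| < e /\ O z.2] V ->
    `|s| < e -> O x -> {for (s, x), continuous V}.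
  by move=> sV se Ox; apply: differentiable_continuous; exact: smooth_on_differentiable sV _.
have sdU : smooth_on [set z : R * 'rV[R]_m | `|z.1| < e /\ O z.2] ('D_(1, 0) U).
  exact: smooth_on_derive.
have d0 : 0 < e - `|t| by rewrite subr_gt0.
have se s : `|s - t| < e - `|t| -> `|s| < e.
  move=> st; rewrite -[s](subrK t) (le_lt_trans (ler_normD _ _))//; lra.
have := @derive_integral_rV R m r (chart_extend U) (chart_extend ('D_(1, 0) U)) t (e - `|t|) r0 d0.
apply.
- by move=> s /se s_e; apply: rP => x Ox; exact: cont.
- by apply: rP => x Ox; exact: cont.
- move=> s x /se s_e; have [Ox|Ox] := pselect (O x).
    rewrite chart_extendE//= (_ : (fun s => _) = (fun s => b x * U (s, x))); last first.
      by apply/funext => s'; rewrite chart_extendE.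
    have : is_derive s 1 (fun s => U (s, x)) ('D_(1, 0) U (s, x)).
      by apply: is_derive_fst; apply: (smooth_on_differentiable sU); split.
    by move=> dU; exact: (@is_deriveZ _ _ _ (fun s => U (s, x)) (b x) s 1 _ dU).
  rewrite chart_extend_out; last by move=> /KO.
  rewrite (_ : (fun s => _) = fun=> 0); first exact: is_derive_cst.
  by apply/funext => s'; rewrite chart_extend_out// => /KO.
- by move=> x; apply: chart_extend_continuous => Ox; exact: cont.
Qed.

End Chart.
End ChartIntegrals.

(** * Linear algebra of submersions *)

Section LinearAlgebra.
Variables (R : realType) (m q : nat).
Implicit Types (G : 'M[R]_m) (D : 'M[R]_(m, q)) (W : 'M[R]_q).

Definition posdef n (G : 'M[R]_n) : Prop := forall u, u != 0 -> 0 < inner G u u.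

Lemma posdef_unit n (G : 'M[R]_n) : posdef G -> G \in unitmx.
Proof.
move=> Gp; rewrite -row_free_unit -kermx_eq0; apply/eqP/row_matrixP => i.
rewrite row0; apply/eqP; apply: contraT => /Gp.
by rewrite /inner -row_mul mulmx_ker row0 mul0mx mxE ltxx.
Qed.

Lemma innerC n (G : 'M[R]_n) u v : G^T = G -> inner G u v = inner G v u.
Proof.
move=> Gs; rewrite /inner -[in LHS]Gs -[u in LHS]trmxK -!trmx_mul mxE.
by rewrite mulmxA.
Qed.

Lemma mx_eq_forms a b (A B : 'M[R]_(a, b)) :
  (forall (u : 'rV_a) (v : 'rV_b), (u *m A *m v^T) 0 0 = (u *m B *m v^T) 0 0) -> A = B.
Proof.
move=> AB; apply/matrixP => i j; have := AB (delta_mx 0 i) (delta_mx 0 j).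
by rewrite -!rowE !trmx_delta -!colE !mxE.
Qed.

(** The isometry condition at one point, with [D] the matrix of the tangent map, [G] the source
    metric and [W] the target metric. *)
Definition submersive G D W : Prop := forall u v,
  (forall w, w *m D = 0 -> inner G u w = 0) ->
  (forall w, w *m D = 0 -> inner G v w = 0) ->
  inner G u v = inner W (u *m D) (v *m D).

Lemma invmx_sym n (G : 'M[R]_n) : G^T = G -> (invmx G)^T = invmx G.
Proof. by move=> Gs; rewrite trmx_inv Gs. Qed.

Lemma posdef_ge0 n (G : 'M[R]_n) u : posdef G -> 0 <= inner G u u.
Proof.
move=> Gp; have [->|/Gp/ltW//] := eqVneq u 0.
by rewrite /inner !mul0mx mxE.
Qed.

(** The vectors [w *m D^T *m invmx G] are horizontal. On them the isometry condition reads
    [S = S *m W *m S] for the pushed-forward dual metric [S], and full rank of [D] makes [S]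
    invertible: the dual metric of the source pushes forward to that of the target. *)
Lemma submersive_cometric G D W : G^T = G -> posdef G -> \rank D = q ->
  submersive G D W -> D^T *m invmx G *m D *m W = 1%:M.
Proof.
move=> Gs Gp rD sub; have Gu := posdef_unit Gp.
set S := D^T *m invmx G *m D.
have ST : S^T = S by rewrite /S !trmx_mul trmxK invmx_sym// mulmxA.
have horP (w : 'rV_q) v : v *m D = 0 -> inner G (w *m D^T *m invmx G) v = 0.
  move=> vD; rewrite /inner mulmxKV// -mulmxA -trmx_mul vD trmx0 mulmx0.
  by rewrite mxE.
have SWS : S = S *m W *m S.
  apply: mx_eq_forms => u v.
  have := sub _ _ (horP u) (horP v); rewrite /inner mulmxKV//.
  have -> : u *m D^T *m (v *m D^T *m invmx G)^T = u *m S *m v^T.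
    by rewrite !trmx_mul trmxK invmx_sym// /S !mulmxA.
  have E (w : 'rV_q) : w *m D^T *m invmx G *m D = w *m S by rewrite /S !mulmxA.
  by rewrite !E trmx_mul ST !mulmxA => ->.
have Su : S \in unitmx.
  rewrite -row_free_unit -kermx_eq0; apply/eqP/row_matrixP => i; rewrite row0.
  set w := row i _; have wS : w *m S = 0 by rewrite /w -row_mul mulmx_ker row0.
  have w0 : w *m D^T *m invmx G = 0.
    apply/eqP; apply: contraT => /Gp; rewrite /inner mulmxKV//.
    have -> : w *m D^T *m (w *m D^T *m invmx G)^T = w *m S *m w^T.
      by rewrite !trmx_mul trmxK invmx_sym// /S !mulmxA.
    by rewrite wS mul0mx mxE ltxx.
  have wD : w *m D^T = 0 by rewrite -[LHS](mulmxKV Gu) w0 mul0mx.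
  have DT : row_free D^T by rewrite /row_free mxrank_tr rD.
  by apply: (row_free_inj DT); rewrite wD mul0mx.
by rewrite -[LHS](mulmxK Su) -SWS mulmxV.
Qed.

(** A horizontal [u] equals [u *m D *m W *m D^T *m invmx G]: the difference is vertical, and
    orthogonal to itself. The isometry condition is then a computation with [W *m S = 1]. *)
Lemma cometric_submersive G D W : G^T = G -> posdef G -> W^T = W ->
  D^T *m invmx G *m D *m W = 1%:M -> submersive G D W.
Proof.
move=> Gs Gp Ws SW; have Gu := posdef_unit Gp.
set S := D^T *m invmx G *m D in SW.
have ST : S^T = S by rewrite /S !trmx_mul trmxK invmx_sym// mulmxA.
have WS : W *m S = 1%:M by rewrite -Ws -ST -trmx_mul SW trmx1.
have horE u : (forall w, w *m D = 0 -> inner G u w = 0) ->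
    u = u *m D *m W *m D^T *m invmx G.
  move=> hu; set u' := RHS; apply/eqP; rewrite -subr_eq0; apply/eqP.
  set v := u - u'.
  have vD : v *m D = 0.
    rewrite mulmxBl [X in _ - X](_ : _ = u *m D *m (W *m S)); last by rewrite /u' /S !mulmxA.
    by rewrite WS mulmx1 subrr.
  apply/eqP; apply: contraT => /Gp.
  rewrite [X in 0 < X](_ : _ = inner G u v - inner G u' v); last first.
    by rewrite /inner {1}/v mulmxBl mulmxBl !mxE.
  rewrite hu// sub0r /inner /u' mulmxKV// -mulmxA -trmx_mul vD trmx0 mulmx0 mxE.
  by rewrite oppr0 ltxx.
move=> u v hu hv; rewrite {1}(horE u hu) /inner mulmxKV// {1}(horE v hv).
rewrite !trmx_mul trmxK invmx_sym// Ws.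
have -> : u *m D *m W *m D^T *m (invmx G *m (D *m (W *m (D^T *m v^T)))) =
  u *m D *m (W *m S) *m W *m (D^T *m v^T) by rewrite /S !mulmxA.
by rewrite WS mulmx1.
Qed.

(** [D *m Th] squares to zero. The determinant is read off from two triangular factorizations of one
    block matrix. *)
Lemma det_unipotent (D : 'M[R]_(m, q)) (Th : 'M[R]_(q, m)) : Th *m D = 0 ->
  \det (1%:M - D *m Th) = 1.
Proof.
move=> ThD.
have E1 : block_mx 1%:M D Th 1%:M = block_mx 1%:M 0 Th 1%:M *m block_mx 1%:M D 0 1%:M.
  by rewrite mulmx_block !mulmx0 !mul0mx !mul1mx !mulmx1 !addr0 ThD add0r.
have E2 : block_mx 1%:M D Th 1%:M =
    block_mx (1%:M - D *m Th) D 0 1%:M *m block_mx 1%:M 0 Th 1%:M.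
  by rewrite mulmx_block !mulmx0 !mul0mx !mul1mx !mulmx1 !add0r subrK.
have := congr1 (fun A => \det A) (etrans (esym E1) E2).
by rewrite !det_mulmx !det_lblock !det_ublock !det1 !mulr1.
Qed.

(** The shear fixes vertical vectors and carries the lift [L] to the lift [L0], so it maps vertical
    and horizontal parts for [G] isometrically onto those for [G0]. Here [P] is the projection to
    the vertical space along [L], and the shear is [P + D *m L0]; the mixed terms of the congruence
    vanish by orthogonality. *)
Lemma shear_metric G0 G D W (L0 L : 'M[R]_(q, m)) : G^T = G -> G0^T = G0 -> W^T = W ->
  (forall u v, u *m D = 0 -> v *m D = 0 -> inner G u v = inner G0 u v) ->
  L0 *m D = 1%:M -> L *m D = 1%:M -> L0 *m G0 = W *m D^T -> L *m G = W *m D^T ->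
  G = (1%:M - D *m (L - L0)) *m G0 *m (1%:M - D *m (L - L0))^T.
Proof.
move=> Gs G0s Ws agree L0D LD L0G LG.
set P := 1%:M - D *m L.
have PD : P *m D = 0 by rewrite mulmxBl mul1mx -mulmxA LD mulmx1 subrr.
have DTP : D^T *m P^T = 0 by rewrite -trmx_mul PD trmx0.
have PGP : P *m G *m P^T = P *m G0 *m P^T.
  apply: mx_eq_forms => u v; have := agree (u *m P) (v *m P).
  by rewrite -!mulmxA PD !mulmx0 => /(_ erefl erefl); rewrite /inner trmx_mul !mulmxA.
have GLT : G *m L^T = D *m W by rewrite -[G]Gs -trmx_mul LG trmx_mul trmxK Ws.
have G0LT : G0 *m L0^T = D *m W by rewrite -[G0]G0s -trmx_mul L0G trmx_mul trmxK Ws.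
have GE : P *m G0 *m P^T = G - D *m W *m D^T.
  have DWP : D *m (W *m D^T) *m P^T = 0 by rewrite -!mulmxA DTP !mulmx0.
  rewrite -PGP {1}/P mulmxBl mul1mx mulmxBl -(mulmxA D L) LG DWP subr0.
  by rewrite /P linearB/= trmx1 trmx_mul mulmxBr mulmx1 mulmxA GLT.
have -> : 1%:M - D *m (L - L0) = P + D *m L0 by rewrite mulmxBr opprB addrA addrAC.
clearbody P.
rewrite [(P + _)^T]linearD/= mulmxDr !mulmxDl. rewrite GE.
have -> : D *m L0 *m G0 *m P^T = 0 by rewrite -(mulmxA D) L0G -!mulmxA DTP !mulmx0.
have -> : P *m G0 *m (D *m L0)^T = 0.
  by rewrite trmx_mul -mulmxA (mulmxA G0) G0LT -!mulmxA (mulmxA P) PD mul0mx.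
have -> : D *m L0 *m G0 *m (D *m L0)^T = D *m W *m D^T.
  by rewrite trmx_mul -(mulmxA D) L0G -!mulmxA (mulmxA D^T) -trmx_mul L0D trmx1 mul1mx.
by rewrite addr0 add0r subrK.
Qed.

End LinearAlgebra.

(** * The second fundamental form as a Lie derivative *)

Section SecondForm.
Variables (R : realType) (m q : nat).
Implicit Types (u v w x : 'rV[R]_m).

Lemma mx11_trmx (A : 'M[R]_1) : A^T = A.
Proof. by apply/matrixP => i j; rewrite !ord1 mxE. Qed.

Lemma form_sum (A : 'M[R]_m) u v :
  (u *m A *m v^T) 0 0 = \sum_i \sum_j u 0 i * v 0 j * A i j.
Proof.
rewrite mxE exchange_big; apply: eq_bigr => j _.
rewrite !mxE mulr_suml; apply: eq_bigr => i _; ring.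
Qed.

Lemma derive_gram_sum (G : 'rV[R]_m -> 'M[R]_m) x w i j : differentiable G x ->
  ('D_w G x) i j = \sum_k w 0 k * partial k (fun y => G y i j) x.
Proof.
move=> dG; rewrite (derive_mxE _ _ _ dG).
have dGij : differentiable (fun y => G y i j) x by have /differentiable_mxP := dG.
rewrite deriveE// {1}(row_sum_delta w) linear_sum/=; apply: eq_bigr => k _.
by rewrite linearZ/= /partial deriveE.
Qed.

Lemma christoffel_lower (G : 'rV[R]_m -> 'M[R]_m) x i j b :
  G x \in unitmx -> (G x)^T = G x ->
  \sum_k christoffel G x k i j * G x k b =
  2^-1 * (partial i (fun y => G y j b) x + partial j (fun y => G y i b) x
          - partial b (fun y => G y i j) x).
Proof.
move=> Gu Gs; under eq_bigr do rewrite /christoffel -mulrA mulr_suml.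
rewrite -mulr_sumr exchange_big/=; congr (_ * _).
have VG l : \sum_k invmx (G x) k l * G x k b = (l == b)%:R.
  have := congr1 (fun A : 'M[R]_m => A l b) (mulVmx Gu); rewrite !mxE => <-.
  by apply: eq_bigr => k _; rewrite -[in LHS](invmx_sym Gs) mxE.
under eq_bigr do under eq_bigr do rewrite mulrAC.
under eq_bigr do rewrite -mulr_suml VG.
by rewrite (bigD1 b)//= eqxx mul1r big1 ?addr0// => l /negbTE ->; rewrite mul0r.
Qed.

(** Contraction of the lowered Christoffel symbols with three vectors. Symbols and partial
    derivatives are abstract arrays here, so the proof is a mere reordering of finite sums. *)
Lemma gamma_pairing (G : 'M[R]_m) (c P : 'I_m -> 'I_m -> 'I_m -> R) (X Y w : 'rV[R]_m) :
  (forall i j b, \sum_k c k i j * G k b = 2^-1 * (P i j b + P j i b - P b i j)) ->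
  let A v : 'M[R]_m := \matrix_(i, j) \sum_k v 0 k * P k i j in
  ((\row_k \sum_i \sum_j c k i j * X 0 i * Y 0 j) *m G *m w^T) 0 0 =
  2^-1 * ((Y *m A X *m w^T) 0 0 + (X *m A Y *m w^T) 0 0 - (X *m A w *m Y^T) 0 0).
Proof.
move=> cP A; rewrite !form_sum.
have E1 : \sum_j \sum_b Y 0 j * w 0 b * A X j b =
    \sum_i \sum_j \sum_b X 0 i * Y 0 j * w 0 b * P i j b.
  rewrite [RHS]exchange_big; apply: eq_bigr => j _.
  rewrite [RHS]exchange_big; apply: eq_bigr => b _.
  rewrite mxE mulr_sumr; apply: eq_bigr => i _; ring.
have E2 : \sum_i \sum_b X 0 i * w 0 b * A Y i b =
    \sum_i \sum_j \sum_b X 0 i * Y 0 j * w 0 b * P j i b.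
  apply: eq_bigr => i _; rewrite [RHS]exchange_big; apply: eq_bigr => b _.
  rewrite mxE mulr_sumr; apply: eq_bigr => j _; ring.
have E3 : \sum_i \sum_j X 0 i * Y 0 j * A w i j =
    \sum_i \sum_j \sum_b X 0 i * Y 0 j * w 0 b * P b i j.
  apply: eq_bigr => i _; apply: eq_bigr => j _.
  rewrite mxE mulr_sumr; apply: eq_bigr => b _; ring.
rewrite E1 E2 E3 -big_split -sumrB mulr_sumr /=.
transitivity (\sum_i \sum_j \sum_b X 0 i * Y 0 j * w 0 b * (\sum_k c k i j * G k b)).
  transitivity (\sum_k \sum_b \sum_i \sum_j X 0 i * Y 0 j * w 0 b * (c k i j * G k b)).
    apply: eq_bigr => k _; apply: eq_bigr => b _; rewrite mxE !mulr_suml.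
    apply: eq_bigr => i _; rewrite !mulr_suml; apply: eq_bigr => j _; ring.
  rewrite exchange_big /=.
  under eq_bigr do rewrite exchange_big /=.
  rewrite exchange_big /=; apply: eq_bigr => i _.
  under eq_bigr do rewrite exchange_big /=.
  rewrite exchange_big /=; apply: eq_bigr => j _.
  by apply: eq_bigr => b _; rewrite -mulr_sumr.
apply: eq_bigr => i _; rewrite -big_split -sumrB mulr_sumr /=.
apply: eq_bigr => j _; rewrite -big_split -sumrB mulr_sumr /=.
apply: eq_bigr => b _; rewrite cP; ring.
Qed.

(** Koszul's formula in coordinates. It involves no inverse of the metric, so a congruence satisfied
    by [G] can be differentiated directly. *)
Lemma nabla_pairing (G : 'rV[R]_m -> 'M[R]_m) (X Y : 'rV[R]_m -> 'rV[R]_m) x w :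
  G x \in unitmx -> (G x)^T = G x -> differentiable G x ->
  (nabla G X Y x *m G x *m w^T) 0 0 = ('D_(X x) Y x *m G x *m w^T) 0 0 +
    2^-1 * ((Y x *m 'D_(X x) G x *m w^T) 0 0 + (X x *m 'D_(Y x) G x *m w^T) 0 0
            - (X x *m 'D_w G x *m (Y x)^T) 0 0).
Proof.
move=> Gu Gs dG; rewrite /nabla 2!mulmxDl mxE; congr (_ + _).
have A v : 'D_v G x = \matrix_(i, j) \sum_k v 0 k * partial k (fun y => G y i j) x.
  by apply/matrixP => i j; rewrite derive_gram_sum// mxE.
rewrite !A; apply: (@gamma_pairing (G x) (christoffel G x) (fun k i j => partial k (fun y => G y i j) x)).
by move=> i j b; exact: christoffel_lower.
Qed.

(* Minus one half of the Lie derivatives of G0 along the rows of L, at (u, v). *)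
Definition koszul (G0 : 'rV[R]_m -> 'M[R]_m) (L : 'rV[R]_m -> 'M[R]_(q, m)) x u v : 'rV[R]_q :=
  \row_c (- 2^-1 * ((v *m G0 x *m (row c ('D_u L x))^T) 0 0 +
                    (u *m G0 x *m (row c ('D_v L x))^T) 0 0 +
                    (u *m 'D_(row c (L x)) G0 x *m v^T) 0 0)).

Let koszul_arith (A B C E p p' k1 k2 k al be : R) :
  A = - p -> B = p - (k1 + al) -> C = p' - (k2 + be) -> p' = p -> E = - al + k - be ->
  A + 2^-1 * (B + C - E) = - 2^-1 * (k1 + k2 + k).
Proof. by move=> -> -> -> -> ->; field. Qed.

(** As [G *m L^T = D *m W^T], the left side lists the pairings of the covariant derivative with the
    lifts, the rows of [L]. Koszul's formula is evaluated by differentiating [Y *m D = 0],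
    [L *m D = 1], [L *m G = W *m D^T] and the congruence between [G] and [G0]. The second
    derivatives of the submersion cancel by [hess], and so do the terms with two lifts; the rest is
    affine in [L]. *)
Lemma second_form_koszul (D : 'rV[R]_m -> 'M[R]_(m, q)) (G G0 : 'rV[R]_m -> 'M[R]_m)
    (W : 'rV[R]_m -> 'M[R]_q) (L L0 : 'rV[R]_m -> 'M[R]_(q, m))
    (X Y : 'rV[R]_m -> 'rV[R]_m) x :
  (forall u v, u *m 'D_v D x = v *m 'D_u D x) ->
  differentiable D x -> differentiable G x -> differentiable G0 x ->
  differentiable W x -> differentiable L x -> differentiable L0 x -> differentiable Y x ->
  G x \in unitmx ->
  (\forall y \near x, (G y)^T = G y) -> (\forall y \near x, (G0 y)^T = G0 y) ->
  (\forall y \near x, L y *m D y = 1%:M) -> (\forall y \near x, L0 y *m D y = 1%:M) ->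
  (\forall y \near x, L y *m G y = W y *m (D y)^T) ->
  (\forall y \near x, G y = (1%:M - D y *m (L y - L0 y)) *m G0 y *m
                            (1%:M - D y *m (L y - L0 y))^T) ->
  X x *m D x = 0 -> (\forall y \near x, Y y *m D y = 0) ->
  nabla G X Y x *m D x *m (W x)^T = koszul G0 L x (X x) (Y x).
Proof.
move=> hess dD dG dG0 dW dL dL0 dY Gu Gs G0s LD L0D LG GE XD YD.
have Gsx := nbhs_singleton Gs; have G0sx := nbhs_singleton G0s.
have LDx := nbhs_singleton LD; have L0Dx := nbhs_singleton L0D.
have LGx := nbhs_singleton LG; have GEx := nbhs_singleton GE.
have YDx := nbhs_singleton YD.
have dDT := differentiable_trmx dD.
pose Th y := L y - L0 y.
have dTh : differentiable Th x by exact: differentiableB.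
have ThD : Th x *m D x = 0 by rewrite mulmxBl LDx L0Dx subrr.
pose T y := 1%:M - D y *m Th y.
have dT : differentiable T x.
  by apply: differentiableB; [exact: differentiable_cst|exact: differentiable_mulmx].
have dTE v : 'D_v T x = - ('D_v D x *m Th x + D x *m 'D_v Th x).
  rewrite deriveB; [|exact: derivable_cst|by apply: diff_derivable; exact: differentiable_mulmx].
  by rewrite derive_cst sub0r derive_mulmx.
have dYD v : 'D_v Y x *m D x = - (Y x *m 'D_v D x).
  apply/eqP; rewrite -addr_eq0 -derive_mulmx//; apply/eqP.
  have := near_eq_derive v (YD : \forall y \near x, Y y *m D y = (fun=> 0) y).
  by rewrite derive_cst.
have dLD v : 'D_v L x *m D x = - (L x *m 'D_v D x).
  apply/eqP; rewrite -addr_eq0 -derive_mulmx//; apply/eqP.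
  have := near_eq_derive v (LD : \forall y \near x, L y *m D y = (fun=> 1%:M) y).
  by rewrite derive_cst.
(* A vertical vector is fixed by the shear [T], so only the right factor of the congruence
   survives. *)
have GTh u : u *m D x = 0 -> u *m G x = u *m G0 x *m (T x)^T.
  move=> uD; rewrite {1}GEx !mulmxA; congr (_ *m _ *m _).
  by rewrite mulmxBr mulmx1 mulmxA uD mul0mx subr0.
have XT : X x *m T x = X x by rewrite mulmxBr mulmx1 mulmxA XD mul0mx subr0.
have YT : Y x *m T x = Y x by rewrite mulmxBr mulmx1 mulmxA YDx mul0mx subr0.
(* Derivative of [L *m G = W *m D^T] paired with a vertical vector: the derivative of [W] drops out,
   since it is followed by [(D x)^T *m u^T = 0]. *)
have dLG v u : u *m D x = 0 ->
    u *m 'D_v G x *m (L x)^T = u *m 'D_v D x *m (W x)^T - u *m G x *m ('D_v L x)^T.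
  move=> uD.
  have dGT : ('D_v G x)^T = 'D_v G x.
    rewrite -derive_trmx//; apply: near_eq_derive; exact: Gs.
  have H := near_eq_derive v LG; rewrite !derive_mulmx// derive_trmx// in H.
  have DTu : (D x)^T *m u^T = 0 by rewrite -trmx_mul uD trmx0.
  have {}H := congr1 (fun A : 'M[R]_(q, m) => A *m u^T) H.
  rewrite 2!mulmxDl -(mulmxA ('D_v W x)) DTu mulmx0 add0r in H.
  have -> : u *m 'D_v G x *m (L x)^T = (L x *m 'D_v G x *m u^T)^T.
    by rewrite !trmx_mul trmxK dGT mulmxA.
  rewrite (_ : L x *m _ *m _ = W x *m ('D_v D x)^T *m u^T - 'D_v L x *m G x *m u^T).
    by rewrite linearB/= !trmx_mul !trmxK Gsx !mulmxA.
  by rewrite -H addrC addKr.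
have dTG v : 'D_v (fun y => T y *m G0 y *m (T y)^T) x =
    'D_v T x *m G0 x *m (T x)^T + T x *m 'D_v G0 x *m (T x)^T + T x *m G0 x *m ('D_v T x)^T.
  rewrite derive_mulmx; [|exact: differentiable_mulmx|exact: differentiable_trmx].
  by rewrite derive_mulmx// derive_trmx// mulmxDl.
have GLT : G x *m (L x)^T = D x *m (W x)^T.
  by rewrite -{1}Gsx -trmx_mul LGx trmx_mul trmxK.
apply/rowP => c; rewrite [RHS]mxE.
have rowc (A : 'rV[R]_m) (B : 'M[R]_(q, m)) : (A *m B^T) 0 c = (A *m (row c B)^T) 0 0.
  by rewrite !mxE; apply: eq_bigr => k _; rewrite !mxE.
set xi := row c (L x); set u := X x in XD XT *; set v := Y x in YDx YT *.
rewrite -(mulmxA (nabla G X Y x)) -GLT mulmxA rowc nabla_pairing// -/xi -/u -/v.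
have t1 : ('D_u Y x *m G x *m xi^T) 0 0 = - (v *m 'D_u D x *m (W x)^T) 0 c.
  rewrite -rowc -(mulmxA ('D_u Y x)) GLT mulmxA dYD mulNmx.
  by rewrite mxE.
(* The derivative of a lift need not be vertical: by [L *m D = 1] its image under [D] is minus a
   second derivative of the submersion, so the shear moves it. This is where products of lifts come
   from. *)
have lamT (z : 'rV[R]_m) : row c ('D_z L x) *m T x = row c ('D_z L x) + z *m 'D_xi D x *m Th x.
  rewrite mulmxBr mulmx1 mulmxA -row_mul dLD linearN/= row_mul mulNmx opprK.
  by rewrite hess.
(* The part quadratic in the lifts, which cancels between t23 and t4. *)
pose al (z z' : 'rV[R]_m) : R := (z *m G0 x *m (z' *m 'D_xi D x *m Th x)^T) 0 0.
have Glam (z z' : 'rV[R]_m) : z *m D x = 0 -> (z *m G x *m (row c ('D_z' L x))^T) 0 0 =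
    (z *m G0 x *m (row c ('D_z' L x))^T) 0 0 + al z z'.
  move=> zD; rewrite GTh// -mulmxA -trmx_mul lamT linearD/= mulmxDr.
  by rewrite mxE.
have t23 (z z' : 'rV[R]_m) : z *m D x = 0 -> (z *m 'D_z' G x *m xi^T) 0 0 = (z *m 'D_z' D x *m (W x)^T) 0 c -
    ((z *m G0 x *m (row c ('D_z' L x))^T) 0 0 + al z z').
  move=> zD; rewrite -rowc dLG// -Glam// -[in RHS]rowc.
  by rewrite mxE [X in _ + X]mxE.
have t4 : (u *m 'D_xi G x *m v^T) 0 0 = - al v u + (u *m 'D_xi G0 x *m v^T) 0 0 - al u v.
  have udT (z : 'rV[R]_m) : z *m D x = 0 -> z *m 'D_xi T x = - (z *m 'D_xi D x *m Th x).
    by move=> zD; rewrite dTE mulmxN mulmxDr !mulmxA zD mul0mx addr0.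
  have TvT : (T x)^T *m v^T = v^T by rewrite -trmx_mul YT.
  rewrite (near_eq_derive xi GE) dTG mulmxDr mulmxDl mulmxDr mulmxDl 2!mxE.
  congr (_ + _ + _).
  - rewrite -!mulmxA TvT !mulmxA udT// !mulNmx mxE; congr (- _).
    by rewrite /al -(mx11_trmx (_ *m v^T)) !trmx_mul !trmxK G0sx !mulmxA.
  - by rewrite -!mulmxA TvT !mulmxA XT.
  - rewrite -!mulmxA -trmx_mul udT// !mulmxA XT linearN/= mulmxN mxE.
    by rewrite /al.
have pp : (u *m 'D_v D x *m (W x)^T) 0 c = (v *m 'D_u D x *m (W x)^T) 0 c by rewrite hess.
exact: (koszul_arith t1 (t23 v u YDx) (t23 u v XD) pp t4).
Qed.

End SecondForm.

#[local] Opaque derive jacobian.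

(** * Submersions in charts *)

Section Jacobians.
Variable R : realType.

Lemma mulmx_ext a b (A B : 'M[R]_(a, b)) : (forall u : 'rV_a, u *m A = u *m B) -> A = B.
Proof. by move=> AB; apply/row_matrixP => i; rewrite !rowE. Qed.

Lemma jacobian_near m q (f g : 'rV[R]_m -> 'rV[R]_q) x : differentiable f x ->
  (\forall y \near x, f y = g y) -> 'J f x = 'J g x.
Proof.
move=> df fg; have dg := near_eq_differentiable fg df.
have E := fun u => near_eq_derive u fg.
by apply: mulmx_ext => u; move: (E u); rewrite (deriveEjacobian u df) (deriveEjacobian u dg).
Qed.

Lemma jacobian_comp m q k (f : 'rV[R]_m -> 'rV[R]_q) (h : 'rV[R]_q -> 'rV[R]_k) x :
  differentiable f x -> differentiable h (f x) -> 'J (h \o f) x = 'J f x *m 'J h (f x).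
Proof.
move=> df dh; have dhf := differentiable_comp df dh; apply: mulmx_ext => u.
rewrite mulmxA -(deriveEjacobian u df) -(deriveEjacobian _ dh) -(deriveEjacobian u dhf).
rewrite (deriveE _ dhf) (deriveE _ dh) (deriveE _ df).
exact: (congr1 (@^~ u) (diff_comp df dh)).
Qed.

Lemma jacobianE m q (f : 'rV[R]_m -> 'rV[R]_q) x i j : differentiable f x ->
  ('J f x) i j = ('D_(delta_mx 0 i) f x) 0 j.
Proof. by move=> df; rewrite deriveEjacobian// -rowE [RHS]mxE. Qed.

Lemma smooth_on_jacobian m q (U : set 'rV[R]_m) (f : 'rV[R]_m -> 'rV[R]_q) : open U ->
  smooth_on U f -> smooth_on U (fun x => 'J f x).
Proof.
move=> oU sf; apply/(smooth_on_mxP _ oU) => i j.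
have /(smooth_on_mxP _ oU)/(_ 0 j) := smooth_on_derive (delta_mx 0 i) sf.
apply: smooth_on_eq => // x Ux; rewrite jacobianE//.
exact: smooth_on_differentiable Ux.
Qed.

(** Differentiating the Jacobian gives second derivatives of [f], symmetric by [derive_swap] in each
    component; this supplies the hypothesis [hess] of [second_form_koszul]. *)
Lemma jacobian_hessian m q (U : set 'rV[R]_m) (f : 'rV[R]_m -> 'rV[R]_q) x u v : open U ->
  smooth_on U f -> U x ->
  u *m 'D_v (fun y => 'J f y) x = v *m 'D_u (fun y => 'J f y) x.
Proof.
move=> oU sf Ux; have dJ := smooth_on_differentiable (smooth_on_jacobian oU sf) Ux.
have E w z : w *m 'D_z (fun y => 'J f y) x = 'D_z ('D_w f) x.
  have := @derive_mulmx R _ _ _ _ (fun=> w) _ x z (differentiable_cst w x) dJ.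
  rewrite derive_cst mul0mx add0r => <-; apply: near_eq_derive.
  have nU : nbhs x U by exact: open_nbhs_nbhs.
  apply: filterS nU => y Uy; rewrite deriveEjacobian//.
  exact: smooth_on_differentiable Uy.
suff S : 'D_v ('D_u f) x = 'D_u ('D_v f) x.
  exact: etrans (E u v) (etrans S (esym (E v u))).
apply/rowP => k.
have sfk : smooth_on U (fun y => f y 0 k) by have /(smooth_on_mxP _ oU) := sf; apply.
have D2 w z : ('D_z ('D_w f) x) 0 k = 'D_z ('D_w (fun y => f y 0 k)) x.
  rewrite derive_mxE; last by apply: (smooth_on_differentiable _ Ux); exact: smooth_on_derive.
  apply: near_eq_derive; have nU : nbhs x U by exact: open_nbhs_nbhs.
  apply: filterS nU => y Uy; rewrite derive_mxE//.
  exact: smooth_on_differentiable Uy.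
exact: etrans (D2 u v) (etrans (derive_swap v u oU sfk Ux) (esym (D2 v u))).
Qed.

End Jacobians.

Section Patches.
Variables (R : realType) (m q : nat) (M : manifold R m) (N : manifold R q) (f : M -> N).
Hypothesis sf : smooth_map f.

(** [tangent_map] selects its target chart point by point, so it may jump with [x]. On a patch the
    target chart [a] is fixed and all matrices are smooth; passing between target charts multiplies
    by an invertible Jacobian. *)
Definition chart_patch (i : chart M) (a : chart N) : set 'rV[R]_m :=
  Defs.coord M i @` (dom M i `&` f @^-1` dom N a).

Definition local_map (i : chart M) (a : chart N) : 'rV[R]_m -> 'rV[R]_q :=
  Defs.coord N a \o f \o param M i.

Lemma chart_image_open k (P : manifold R k) (i : chart P) : open (chart_image i).
Proof. exact: coord_open. Qed.

Lemma chart_open_image k (P : manifold R k) (i : chart P) (A : set P) :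
  open A -> open (Defs.coord P i @` (dom P i `&` A)).
Proof.
move=> oA; rewrite openE => y [p [ip Ap] <-].
have iy : chart_image i (Defs.coord P i p) by exists p.
have pc : param P i y @[y --> Defs.coord P i p] --> param P i (Defs.coord P i p).
  exact: param_cont.
rewrite coordK// in pc.
have nA : \forall y \near Defs.coord P i p, A (param P i y).
  by apply: pc; exact: open_nbhs_nbhs.
have nO : nbhs (Defs.coord P i p) (chart_image i).
  by apply: open_nbhs_nbhs; split => //; exact: chart_image_open.
apply: filterS2 nA nO => z Az [p' ip' zp'].
by exists p' => //; split => //; move: Az; rewrite -zp' coordK.
Qed.

Lemma chart_patch_open i a : open (chart_patch i a).
Proof.
apply: chart_open_image.
have [cf _] := sf; have [+ _] := @continuousP _ _ f.
by apply => //; exact: dom_open.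
Qed.

Lemma patch_chart i a : chart_patch i a `<=` chart_image i.
Proof. by move=> _ [p [ip _] <-]; exists p. Qed.

Lemma local_map_smooth i a : smooth_on (chart_patch i a) (local_map i a).
Proof. by have [_ +] := sf; apply. Qed.

Lemma target_patch i x : chart_image i x -> chart_patch i (target_chart f i x) x.
Proof.
move=> [p ip <-]; exists p => //; split => //.
by rewrite /target_chart /= coordK//; exact: chart_at_dom.
Qed.

Lemma patch_param i a x : chart_patch i a x -> dom M i (param M i x) /\ dom N a (f (param M i x)).
Proof. by move=> [p [ip fp] <-]; rewrite coordK. Qed.

Lemma local_map_image i a x : chart_patch i a x -> chart_image a (local_map i a x).
Proof. by move=> /patch_param[_ ap]; exists (f (param M i x)). Qed.

Definition target_jacobian i a b x : 'M[R]_q :=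
  'J (Defs.coord N b \o param N a) (local_map i a x).

Lemma transition_differentiable k (P : manifold R k) (i j : chart P) (p : P) :
  dom P i p -> dom P j p -> differentiable (Defs.coord P j \o param P i) (Defs.coord P i p).
Proof.
move=> ip jp; apply: (smooth_on_differentiable (@transition_smooth _ _ P i j)).
by exists p.
Qed.

Lemma local_map_change i a b x : chart_patch i a x -> chart_patch i b x ->
  'J (local_map i b) x = 'J (local_map i a) x *m target_jacobian i a b x.
Proof.
move=> ax bx; have [_ ap] := patch_param ax; have [_ bp] := patch_param bx.
have da := smooth_on_differentiable (@local_map_smooth i a) ax.
have dt : differentiable (Defs.coord N b \o param N a) (local_map i a x).
  exact: transition_differentiable ap bp.
transitivity ('J ((Defs.coord N b \o param N a) \o local_map i a) x); last first.
  exact: jacobian_comp da dt.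
apply: jacobian_near.
  exact: smooth_on_differentiable (@local_map_smooth i b) bx.
have nO : nbhs x (chart_patch i a) by apply: open_nbhs_nbhs; split => //; exact: chart_patch_open.
apply: filterS nO => y /patch_param[_ fy].
by rewrite /local_map /= coordK.
Qed.

Lemma target_jacobian_unit i a b x : chart_patch i a x -> chart_patch i b x ->
  target_jacobian i a b x \in unitmx.
Proof.
move=> /patch_param[_ ap] /patch_param[_ bp]; rewrite unitmxE unitfE gt_eqF//.
exact: transition_oriented.
Qed.

Section Target.
Variable gN : metric N.

Definition local_gram i a x : 'M[R]_q := gN a (local_map i a x).

Lemma local_gram_change i a b x : chart_patch i a x -> chart_patch i b x ->
  local_gram i a x = target_jacobian i a b x *m local_gram i b x *m (target_jacobian i a b x)^T.
Proof.
by move=> /patch_param[_ ap] /patch_param[_ bp]; have := gram_transition gN ap bp.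
Qed.

Lemma local_gram_sym i a x : chart_patch i a x -> (local_gram i a x)^T = local_gram i a x.
Proof. by move=> /local_map_image; exact: gram_sym. Qed.

Lemma local_gram_posdef i a x : chart_patch i a x -> posdef (local_gram i a x).
Proof. by move=> /local_map_image ax u; exact: gram_pos. Qed.

Lemma local_gram_smooth i a : smooth_on (chart_patch i a) (local_gram i a).
Proof.
have H := @smooth_on_comp_mx R _ q q q _ _ _ _ (@chart_patch_open i a) (@chart_image_open _ N a)
  (@local_map_image i a) (@local_map_smooth i a) (@gram_smooth _ _ _ gN a).
exact: H.
Qed.

Lemma local_jacobian_smooth i a : smooth_on (chart_patch i a) (fun x => 'J (local_map i a) x).
Proof. by apply: smooth_on_jacobian; [exact: chart_patch_open|exact: local_map_smooth]. Qed.

Lemma vertical_patch i a x v : chart_patch i a x -> vertical f i x v <-> v *m 'J (local_map i a) x = 0.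
Proof.
move=> ax; have bx := target_patch (patch_chart ax).
rewrite /vertical -[tangent_map f i x]/('J (local_map i (target_chart f i x)) x).
rewrite (local_map_change ax bx) mulmxA.
split=> [|->]; last by rewrite mul0mx.
by move/(congr1 (mulmx^~ (invmx (target_jacobian i a (target_chart f i x) x))));
  rewrite mulmxK ?mul0mx//; exact: target_jacobian_unit.
Qed.

Lemma submersion_patch (g : metric M) i a x : riemannian_submersion f g gN -> chart_patch i a x ->
  \rank ('J (local_map i a) x) = q /\
  submersive (g i x) ('J (local_map i a) x) (local_gram i a x).
Proof.
move=> [_ sub] ax; have bx := target_patch (patch_chart ax).
have /= [rk sb] := sub i x (patch_chart ax).
have E : tangent_map f i x = 'J (local_map i a) x *m target_jacobian i a (target_chart f i x) x.
  exact: local_map_change.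
have Ku := target_jacobian_unit ax bx.
split.
  by rewrite -[LHS](mxrankMfree _ (_ : row_free (target_jacobian i a (target_chart f i x) x)))
    -?E// row_free_unit.
move=> u v hu hv.
have hor w : (forall z, z *m 'J (local_map i a) x = 0 -> inner (g i x) w z = 0) ->
    horizontal f g i x w by move=> hw z /(vertical_patch z ax); exact: hw.
rewrite (sb _ _ (hor u hu) (hor v hv)) E (local_gram_change ax bx) /inner.
by rewrite !trmx_mul !mulmxA.
Qed.

Lemma submersion_of_patch (g : metric M) :
  (forall i x, chart_image i x -> exists2 a, chart_patch i a x &
     \rank ('J (local_map i a) x) = q /\
     submersive (g i x) ('J (local_map i a) x) (local_gram i a x)) ->
  riemannian_submersion f g gN.
Proof.
move=> H; split => // i x ix /=; have [a ax [rk sb]] := H i x ix.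
have bx := target_patch ix.
have E : tangent_map f i x = 'J (local_map i a) x *m target_jacobian i a (target_chart f i x) x.
  exact: local_map_change.
have Ku := target_jacobian_unit ax bx.
split; first by rewrite E mxrankMfree// row_free_unit.
move=> u v hu hv; rewrite sb; last 2 first.
- by move=> w wD; apply: hu; apply/(vertical_patch w ax).
- by move=> w wD; apply: hv; apply/(vertical_patch w ax).
rewrite E (local_gram_change ax bx) /inner.
by rewrite !trmx_mul !mulmxA.
Qed.

(** A vector and its horizontal projection differ by a vertical vector, so they have the same image
    in the target, and the submersion is isometric on the projection. The projection thus disappears
    from the norms. *)
Lemma horizontal_proj_norm (g : metric M) i a x v : riemannian_submersion f g gN -> chart_patch i a x ->
  inner (g i x) (horizontal_proj f g i x v) (horizontal_proj f g i x v) =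
  inner (local_gram i a x) (v *m 'J (local_map i a) x) (v *m 'J (local_map i a) x).
Proof.
move=> sub ax; have [rk sb] := submersion_patch sub ax.
have ix := patch_chart ax.
set V := vertical_space f i x; set H := horizontal_space f g i x.
have Gu : g i x \in unitmx by apply: posdef_unit; exact: gram_pos.
have VE (w : 'rV[R]_m) : (w <= V)%MS = (w *m tangent_map f i x == 0).
  by apply/idP/eqP => [|?]; [move/sub_kermxP|exact/sub_kermxP].
have vertV (w : 'rV[R]_m) : w *m 'J (local_map i a) x = 0 -> (w <= V)%MS.
  by move=> wD; rewrite VE; apply/eqP; exact: (proj2 (vertical_patch w ax) wD).
have Vvert (w : 'rV[R]_m) : (w <= V)%MS -> w *m 'J (local_map i a) x = 0.
  by rewrite VE => /eqP wD; exact: (proj1 (vertical_patch w ax) wD).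
have horH (w z : 'rV_m) : (w <= H)%MS -> (z <= V)%MS -> inner (g i x) w z = 0.
  move=> /sub_kermxP wH /submxP[c ->]; rewrite /inner trmx_mul mulmxA.
  by rewrite -(mulmxA w) wH mul0mx mxE.
have HV0 : (H :&: V)%MS = 0.
  apply/eqP/rowV0P => w; rewrite sub_capmx => /andP[wH wV].
  apply/eqP; apply: contraT => /(gram_pos g ix).
  by rewrite horH// ltxx.
(* Dimension count from the trivial intersection; a full sum is what makes [v - h] vertical for
   [proj_mx]. *)
have full : row_full (H + V)%MS.
  rewrite /row_full; have := mxrank_sum_cap H V; rewrite HV0 mxrank0 addn0 => ->.
  rewrite /H /horizontal_space mxrank_ker.
  have rGV : \rank (g i x *m V^T) = \rank V.
    rewrite -mxrank_tr trmx_mul trmxK mxrankMfree// row_free_unit unitmx_tr//.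
  by rewrite rGV subnK// rank_leq_row.
set h := horizontal_proj f g i x v.
have hH : (h <= H)%MS by exact: proj_mx_sub.
have hV : (v - h <= V)%MS by apply: proj_mx_compl_sub; exact: submx_full.
have hD : h *m 'J (local_map i a) x = v *m 'J (local_map i a) x.
  by apply/eqP; rewrite -subr_eq0 -mulmxBl -oppr_eq0 -mulNmx opprB Vvert.
rewrite -hD; apply: sb => w /vertV; exact: horH.
Qed.

End Target.
End Patches.

(** * Inner products and frame-free expressions of the energies *)

Section Inner.
Variables (R : realType) (m : nat).
Implicit Types (G : 'M[R]_m) (u v w : 'rV[R]_m).

Lemma innerBl G u v w : inner G (u - v) w = inner G u w - inner G v w.
Proof. by rewrite /inner !mulmxBl !mxE. Qed.

Lemma innerDl G u v w : inner G (u + v) w = inner G u w + inner G v w.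
Proof. by rewrite /inner !mulmxDl !mxE. Qed.

Lemma innerZl G c u w : inner G (c *: u) w = c * inner G u w.
Proof. by rewrite /inner -!scalemxAl mxE. Qed.

Lemma innerZr G c u w : inner G u (c *: w) = c * inner G u w.
Proof. by rewrite /inner linearZ/= -scalemxAr mxE. Qed.

Lemma inner_suml G (I : Type) (r : seq I) (P : pred I) (F : I -> 'rV[R]_m) w :
  inner G (\sum_(i <- r | P i) F i) w = \sum_(i <- r | P i) inner G (F i) w.
Proof. by rewrite /inner !mulmx_suml summxE. Qed.

Lemma smooth_on_inner (V : normedModType R) (U : set V) (G : V -> 'M[R]_m)
    (u v : V -> 'rV[R]_m) : open U ->
  smooth_on U G -> smooth_on U u -> smooth_on U v ->
  smooth_on U (fun x => inner (G x) (u x) (v x)).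
Proof.
move=> oU sG su sv.
have := smooth_on_mulmx oU (smooth_on_mulmx oU su sG) (smooth_on_trmx oU sv).
by move=> /(smooth_on_mxP _ oU); apply.
Qed.

(** The gap between the two sides is [s * (1 - s) * inner G (v - u) (v - u)]. *)
Lemma inner_convex G u v (s : R) : posdef G -> G^T = G -> 0 <= s <= 1 ->
  inner G (u + s *: (v - u)) (u + s *: (v - u)) <= (1 - s) * inner G u u + s * inner G v v.
Proof.
move=> Gp Gs /andP[s0 s1]; rewrite -subr_ge0.
rewrite (_ : _ - _ = s * (1 - s) * inner G (v - u) (v - u)).
  by rewrite mulr_ge0 ?posdef_ge0// mulr_ge0// subr_ge0.
have flip w z : inner G (w + s *: z) (w + s *: z) =
    inner G w w + 2 * s * inner G w z + s ^+ 2 * inner G z z.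
  rewrite innerDl innerZl !(innerC _ (w + _) Gs) !innerDl !innerZl (innerC z w Gs).
  by ring.
rewrite flip (innerC u (v - u) Gs) !innerBl (innerC u (v - u) Gs) (innerC v (v - u) Gs) !innerBl.
rewrite (innerC v u Gs).
by ring.
Qed.

End Inner.

Section Energy.
Variables (R : realType) (m q : nat).

(* For k the second fundamental form paired with the horizontal lifts and E an
   orthonormal vertical frame, this is the squared norm of h if b is true and of
   H if b is false. *)
Definition energy (b : bool) n (Q : 'M[R]_q) (k : 'rV[R]_m -> 'rV[R]_m -> 'rV[R]_q)
    (E : 'I_n -> 'rV[R]_m) : R :=
  if b then \sum_a \sum_c inner Q (k (E a) (E c)) (k (E a) (E c))
  else inner Q (\sum_a k (E a) (E a)) (\sum_a k (E a) (E a)).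

(** The energy without a frame: [C] stands for the sum of the [E_a^T *m E_a], the dual of the
    vertical metric, and [K c] for the matrix of the c-th component of [k]. Both independence of the
    frame and smoothness are read off from this form. *)
Definition trace_form (b : bool) (Q : 'M[R]_q) (C : 'M[R]_m) (K : 'I_q -> 'M[R]_m) : R :=
  \sum_c \sum_d Q c d *
    (if b then \tr (K c *m C *m (K d)^T *m C) else \tr (K c *m C) * \tr (K d *m C)).

Lemma inner_sum n (Q : 'M[R]_n) (u v : 'rV[R]_n) :
  inner Q u v = \sum_c \sum_d Q c d * (u 0 c * v 0 d).
Proof.
rewrite /inner form_sum; apply: eq_bigr => c _; apply: eq_bigr => d _; ring.
Qed.

Lemma energy_trace b n (Q : 'M[R]_q) (k : 'rV[R]_m -> 'rV[R]_m -> 'rV[R]_q)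
    (K : 'I_q -> 'M[R]_m) (E : 'I_n -> 'rV[R]_m) :
  (forall u v c, k u v 0 c = (u *m K c *m v^T) 0 0) ->
  energy b Q k E =
  trace_form b Q ((\matrix_a E a)^T *m (\matrix_a E a)) K.
Proof.
move=> kK; set F := \matrix_a E a.
have kF a a' c : k (E a) (E a') 0 c = (F *m K c *m F^T) a a'.
  rewrite kK; have -> : E a = row a F by rewrite rowK.
  have -> : E a' = row a' F by rewrite rowK.
  rewrite -row_mul [LHS]mxE [RHS]mxE; apply: eq_bigr => l _.
  by rewrite [(row _ _) _ _]mxE [((row _ _)^T) _ _]mxE [(row _ _) _ _]mxE [(F^T) _ _]mxE.
have trF c : \tr (K c *m (F^T *m F)) = \tr (F *m K c *m F^T).
  by rewrite mulmxA mxtrace_mulC mulmxA.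
case: b; rewrite /energy /trace_form.
  under eq_bigr do under eq_bigr do rewrite inner_sum.
  under eq_bigr do rewrite exchange_big /=.
  rewrite exchange_big /=; apply: eq_bigr => c _.
  under eq_bigr do rewrite exchange_big /=.
  rewrite exchange_big /=; apply: eq_bigr => d _.
  under eq_bigr do rewrite -mulr_sumr.
  rewrite -mulr_sumr; congr (_ * _).
  have -> : K c *m (F^T *m F) *m (K d)^T *m (F^T *m F) =
    (K c *m F^T) *m (F *m (K d)^T *m F^T *m F) by rewrite !mulmxA.
  rewrite mxtrace_mulC.
  have -> : F *m (K d)^T *m F^T *m F *m (K c *m F^T) = (F *m K d *m F^T)^T *m (F *m K c *m F^T).
    by rewrite !trmx_mul trmxK !mulmxA.
  rewrite mxtrace_mulC /mxtrace; apply: eq_bigr => a _; rewrite [RHS]mxE; apply: eq_bigr => a' _.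
  by rewrite !kF [(_ ^T) _ _]mxE.
rewrite inner_sum; apply: eq_bigr => c _; apply: eq_bigr => d _; congr (_ * _).
by rewrite !trF !summxE /mxtrace; congr (_ * _); apply: eq_bigr => a _; rewrite kF.
Qed.

(** Orthonormality gives [E] rank [m - q], so its rows span the kernel of [D] and [E' = A *m E]. The
    matrix [A] is orthogonal and cancels in [E'^T *m E']. *)
Lemma orthonormal_frames_cometric (G : 'M[R]_m) (D : 'M[R]_(m, q)) (E E' : 'M[R]_(m - q, m)) :
  \rank D = q -> E *m D = 0 -> E' *m D = 0 ->
  E *m G *m E^T = 1%:M -> E' *m G *m E'^T = 1%:M -> E'^T *m E' = E^T *m E.
Proof.
move=> rD ED E'D EG E'G.
have rE : \rank E = (m - q)%N.
  apply/eqP; rewrite eqn_leq rank_leq_row /= -[X in (X <= _)%N](mxrank1 R) -EG -mulmxA.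
  exact: mxrankM_maxl.
have EK : (E <= kermx D)%MS by apply/sub_kermxP.
have KE : (kermx D <= E)%MS.
  by rewrite -(geq_leqif (mxrank_leqif_sup EK)) mxrank_ker rE rD.
have /submxP[A E'A] : (E' <= E)%MS by apply: submx_trans KE; apply/sub_kermxP.
have AA : A *m A^T = 1%:M.
  by rewrite -E'G E'A trmx_mul -!mulmxA (mulmxA E) (mulmxA (E *m G)) EG mul1mx.
by rewrite E'A trmx_mul -mulmxA (mulmxA A^T) (mulmx1C AA) mul1mx.
Qed.

(** The matrix of the bilinear form given by component [c] of [koszul]; row [i] of [N] is the i-th
    partial derivative of the c-th lift. *)
Definition koszul_mx (G0 : 'rV[R]_m -> 'M[R]_m) (L : 'rV[R]_m -> 'M[R]_(q, m)) x (c : 'I_q) : 'M[R]_m :=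
  let N := \matrix_(i, l) ('D_(delta_mx 0 i) L x) c l in
  - 2^-1 *: (N *m G0 x + G0 x *m N^T + 'D_(row c (L x)) G0 x).

Lemma koszul_mxE (G0 : 'rV[R]_m -> 'M[R]_m) (L : 'rV[R]_m -> 'M[R]_(q, m)) x u v c :
  differentiable L x -> (G0 x)^T = G0 x ->
  koszul G0 L x u v 0 c = (u *m koszul_mx G0 L x c *m v^T) 0 0.
Proof.
move=> dL G0s; rewrite /koszul_mx; set N := \matrix_(i, l) _.
have rowN w : row c ('D_w L x) = w *m N.
  rewrite (deriveE _ dL) {1}(row_sum_delta w) linear_sum/=.
  apply/rowP => l; rewrite !mxE summxE; apply: eq_bigr => k _.
  by rewrite linearZ/= !mxE deriveE.
rewrite mxE !rowN -scalemxAr -scalemxAl [RHS]mxE; congr (_ * _).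
rewrite !mulmxDr !mulmxDl [RHS]mxE [X in _ = X + _]mxE; congr (_ + _ + _).
  by rewrite -[in LHS](mx11_trmx (_ *m (u *m N)^T)) !trmx_mul !trmxK G0s !mulmxA.
by rewrite trmx_mul !mulmxA.
Qed.

End Energy.

(** * Horizontal lifts and the pointwise values of the norms *)

Section Lift.
Variables (R : realType) (m q : nat) (M : manifold R m) (N : manifold R q) (f : M -> N).
Variable gN : metric N.
Hypothesis sf : smooth_map f.

Definition local_jac (i : chart M) (a : chart N) (x : 'rV[R]_m) : 'M[R]_(m, q) :=
  'J (local_map f i a) x.

(* Row c is the g-horizontal lift of the c-th coordinate vector field of the chart a. *)
Definition hlift (g : metric M) (i : chart M) (a : chart N) (x : 'rV[R]_m) : 'M[R]_(q, m) :=
  local_gram f gN i a x *m (local_jac i a x)^T *m invmx (g i x).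

Lemma gram_unit (g : metric M) i x : chart_image i x -> g i x \in unitmx.
Proof. by move=> ix; apply: posdef_unit; exact: gram_pos. Qed.

Lemma lift_jac g i a x : riemannian_submersion f g gN -> chart_patch f i a x ->
  hlift g i a x *m local_jac i a x = 1%:M.
Proof.
move=> sub ax; have [rk sb] := submersion_patch sf sub ax; have ix := patch_chart ax.
have SW := submersive_cometric (gram_sym g ix) (gram_pos g ix) rk sb.
by rewrite /hlift -2!mulmxA (mulmxA _^T); exact: mulmx1C SW.
Qed.

Lemma lift_gram g i a x : chart_patch f i a x ->
  hlift g i a x *m g i x = local_gram f gN i a x *m (local_jac i a x)^T.
Proof. by move=> /patch_chart ix; rewrite mulmxKV// gram_unit. Qed.

Lemma lift_smooth g i a : smooth_on (chart_patch f i a) (hlift g i a).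
Proof.
have oP := @chart_patch_open _ _ _ _ _ _ sf i a.
apply: smooth_on_mulmx => //.
  apply: smooth_on_mulmx => //; first exact: local_gram_smooth.
  by apply: smooth_on_trmx => //; exact: local_jacobian_smooth.
apply: smooth_on_invmx => //; first by move=> x /patch_chart; exact: gram_unit.
by apply: smooth_on_subset (@gram_smooth _ _ _ g i); exact: patch_chart.
Qed.

Definition jac_smooth i a : smooth_on (chart_patch f i a) (local_jac i a) :=
  @local_jacobian_smooth _ _ _ _ _ _ sf i a.

Lemma shear_patch g0 g i a x : riemannian_submersion f g0 gN -> riemannian_submersion f g gN ->
  riem_rel_vertical f g0 g -> chart_patch f i a x ->
  let T := 1%:M - local_jac i a x *m (hlift g i a x - hlift g0 i a x) in
  g i x = T *m g0 i x *m T^T /\ \det T = 1.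
Proof.
move=> sub0 sub agree ax T; have ix := patch_chart ax.
have agree' u v : u *m local_jac i a x = 0 -> v *m local_jac i a x = 0 ->
    inner (g i x) u v = inner (g0 i x) u v.
  move=> uD vD; apply: (agree i x ix).
    exact: (proj2 (vertical_patch sf u ax) uD).
  exact: (proj2 (vertical_patch sf v ax) vD).
split.
  apply: (shear_metric (gram_sym g ix) (gram_sym g0 ix) (local_gram_sym gN ax) agree').
  - exact: lift_jac.
  - exact: lift_jac.
  - exact: lift_gram.
  - exact: lift_gram.
by apply: det_unipotent; rewrite mulmxBl !lift_jac// subrr.
Qed.

Lemma second_form_lift g0 g i a x (X Y : 'rV[R]_m -> 'rV[R]_m) :
  riemannian_submersion f g0 gN -> riemannian_submersion f g gN ->
  riem_rel_vertical f g0 g -> chart_patch f i a x ->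
  differentiable Y x -> vertical f i x (X x) -> (\forall y \near x, vertical f i y (Y y)) ->
  nabla (g i) X Y x *m local_jac i a x *m (local_gram f gN i a x)^T =
  koszul (g0 i) (hlift g i a) x (X x) (Y x).
Proof.
move=> sub0 sub agree ax dY XV YV.
have oP := @chart_patch_open _ _ _ _ _ _ sf i a.
have nP : nbhs x (chart_patch f i a) by exact: open_nbhs_nbhs.
have hess u v : u *m 'D_v (local_jac i a) x = v *m 'D_u (local_jac i a) x.
  exact: (jacobian_hessian u v oP (@local_map_smooth _ _ _ _ _ _ sf i a) ax).
apply: (@second_form_koszul _ _ _ (local_jac i a) (g i) (g0 i) (local_gram f gN i a)
  (hlift g i a) (hlift g0 i a) X Y x hess).
- exact: smooth_on_differentiable (@jac_smooth i a) ax.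
- exact: smooth_on_differentiable (@gram_smooth _ _ _ g i) (patch_chart ax).
- exact: smooth_on_differentiable (@gram_smooth _ _ _ g0 i) (patch_chart ax).
- exact: smooth_on_differentiable (@local_gram_smooth _ _ _ _ _ _ sf gN i a) ax.
- exact: smooth_on_differentiable (@lift_smooth g i a) ax.
- exact: smooth_on_differentiable (@lift_smooth g0 i a) ax.
- exact: dY.
- exact: gram_unit (patch_chart ax).
- by apply: filterS nP => y /patch_chart; exact: gram_sym.
- by apply: filterS nP => y /patch_chart; exact: gram_sym.
- by apply: filterS nP => y ay; exact: lift_jac.
- by apply: filterS nP => y ay; exact: lift_jac.
- by apply: filterS nP => y ay; exact: lift_gram.
- by apply: filterS nP => y ay; have [] := shear_patch sub0 sub agree ay.
- exact: (proj1 (vertical_patch sf (X x) ax) XV).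
- by apply: filterS2 nP YV => y ay Yy; exact: (proj1 (vertical_patch sf (Y y) ay) Yy).
Qed.

(** The Koszul identity yields the vector [v *m W] with lowered index, so norms are taken with the
    inverse of [W]. That matrix does not depend on the metric on the source. *)
Lemma inner_lower (W : 'M[R]_q) (v : 'rV[R]_q) : W^T = W -> W \in unitmx ->
  inner W v v = inner (invmx W) (v *m W) (v *m W).
Proof. by move=> Ws Wu; rewrite /inner mulmxK// trmx_mul Ws mulmxA. Qed.

Definition sqnorm (b : bool) (g : metric M) (i : chart M) (x : 'rV[R]_m) : R :=
  if b then sqnorm_second_form f g i x else sqnorm_mean_curvature f g i x.

Lemma horizontal_proj_sum (g : metric M) i x n (v : 'I_n -> 'rV[R]_m) :
  \sum_a horizontal_proj f g i x (v a) = horizontal_proj f g i x (\sum_a v a).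
Proof. by rewrite /horizontal_proj mulmx_suml. Qed.

Section Value.
Variables (g0 g : metric M) (i : chart M) (a : chart N) (x : 'rV[R]_m).
Hypotheses (sub0 : riemannian_submersion f g0 gN) (sub : riemannian_submersion f g gN).
Hypotheses (agree : riem_rel_vertical f g0 g) (ax : chart_patch f i a x).

Let kos := koszul (g0 i) (hlift g i a) x.
Let Q := invmx (local_gram f gN i a x).

Lemma frame_value (b : bool) E : vertical_frame f g i x E ->
  (if b then \sum_a \sum_b let h := second_form f g i (E a) (E b) x in inner (g i x) h h
   else let H := \sum_a second_form f g i (E a) (E a) x in inner (g i x) H H) =
  energy b Q kos (fun k => E k x).
Proof.
move=> [U [oU Ux Ui sE EP]].
have nU : nbhs x U by exact: open_nbhs_nbhs.
have Ws := local_gram_sym gN ax.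
have Wu : local_gram f gN i a x \in unitmx by apply: posdef_unit; exact: local_gram_posdef.
have II k l : nabla (g i) (E k) (E l) x *m local_jac i a x *m local_gram f gN i a x =
    kos (E k x) (E l x).
  rewrite -[X in _ *m X = _]Ws; apply: second_form_lift => //.
  - exact: smooth_on_differentiable (sE l) Ux.
  - by have [] := EP x Ux.
  - by apply: filterS nU => y /EP[].
rewrite /energy; case: b.
  apply: eq_bigr => k _; apply: eq_bigr => l _ /=.
  by rewrite /second_form (horizontal_proj_norm sf _ sub ax) inner_lower// -/(local_jac i a x) II.
rewrite /= /second_form horizontal_proj_sum (horizontal_proj_norm sf _ sub ax) inner_lower//.
have -> : (\sum_k nabla (g i) (E k) (E k) x) *m 'J (local_map f i a) x *m local_gram f gN i a x =
    \sum_k kos (E k x) (E k x).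
  by rewrite !mulmx_suml; apply: eq_bigr => k _; exact: II.
by [].
Qed.

(** The frame condition reads the metric on vertical vectors only, so one frame serves all metrics
    that agree there. *)
Lemma vertical_frame_agree E : vertical_frame f g0 i x E -> vertical_frame f g i x E.
Proof.
move=> [U [oU Ux Ui sE EP]]; exists U; split => // y Uy; have [EV Eo] := EP y Uy.
by split => // k l; rewrite agree//; exact: Ui.
Qed.

Lemma kosE u v c : kos u v 0 c = (u *m koszul_mx (g0 i) (hlift g i a) x c *m v^T) 0 0.
Proof.
apply: koszul_mxE.
  exact: smooth_on_differentiable (@lift_smooth g i a) ax.
exact: gram_sym (patch_chart ax).
Qed.

(** Shows that the set from which [xget] selects has at most one element. *)
Lemma frame_energy_unique b E E' : vertical_frame f g i x E -> vertical_frame f g i x E' ->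
  energy b Q kos (fun k => E' k x) = energy b Q kos (fun k => E k x).
Proof.
move=> [U [_ Ux _ _ /(_ x Ux)[EV Eo]]] [U' [_ Ux' _ _ /(_ x Ux')[EV' Eo']]].
rewrite !(energy_trace _ _ _ kosE); congr (trace_form _ _ _ _).
have [rk _] := submersion_patch sf sub ax.
have vert (F : 'I_(m - q) -> 'rV[R]_m -> 'rV[R]_m) : (forall k, vertical f i x (F k x)) ->
    (\matrix_k F k x) *m local_jac i a x = 0.
  move=> FV; apply/row_matrixP => k; rewrite row_mul rowK row0.
  exact: (proj1 (vertical_patch sf _ ax) (FV k)).
have orth (F : 'I_(m - q) -> 'rV[R]_m -> 'rV[R]_m) :
    (forall k l, inner (g i x) (F k x) (F l x) = (k == l)%:R) ->
    (\matrix_k F k x) *m g i x *m (\matrix_k F k x)^T = 1%:M.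
  move=> Fo; apply/matrixP => k l; rewrite [RHS]mxE -Fo /inner.
  rewrite -[F k x](rowK (fun k => F k x)) -[F l x in RHS](rowK (fun k => F k x)).
  by rewrite -row_mul [LHS]mxE [RHS]mxE; apply: eq_bigr => p _;
    rewrite [(row _ _) _ _]mxE [((row _ _)^T) _ _]mxE [(row _ _) _ _]mxE [(_^T) _ _]mxE.
by apply: (orthonormal_frames_cometric rk); [exact: vert|exact: vert|exact: orth|exact: orth].
Qed.

(** Existence of a frame together with uniqueness of the value means that [xget] never returns its
    default 0. The frame is one for [g0], so it stays fixed while [g] varies. *)
Lemma sqnormE b E : vertical_frame f g0 i x E ->
  sqnorm b g i x = energy b Q kos (fun k => E k x).
Proof.
move=> /vertical_frame_agree EP.
have valE := frame_value b EP.
case: b valE => valE; rewrite /sqnorm; apply: xget_unique.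
- by exists E.
- move=> r [E' E'P ->]; rewrite -(frame_energy_unique true EP E'P).
  exact: (frame_value true E'P).
- by exists E.
- move=> r [E' E'P ->]; rewrite -(frame_energy_unique false EP E'P).
  exact: (frame_value false E'P).
Qed.

End Value.
End Lift.

(** * Local orthonormal vertical frames *)

Section Frames.
Variables (R : realType) (m q : nat) (M : manifold R m) (N : manifold R q) (f : M -> N).
Variable gN : metric N.
Hypothesis sf : smooth_map f.
Variables (g : metric M) (i : chart M) (a : chart N) (x : 'rV[R]_m).
Hypotheses (sub : riemannian_submersion f g gN) (ax : chart_patch f i a x).

Let D := local_jac f i a.

(** The first [k] fields of a Gram-Schmidt construction. Fields are indexed by [nat], so that adding
    one does not change the type; those of index at least [k] are irrelevant. *)
Definition partial_frame (k : nat) (U : set 'rV[R]_m) (E : nat -> 'rV[R]_m -> 'rV[R]_m) : Prop :=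
  [/\ open U, U x, U `<=` chart_patch f i a,
      forall b, (b < k)%N -> smooth_on U (E b)
    & forall y, U y -> (forall b, (b < k)%N -> E b y *m D y = 0) /\
        (forall b c, (b < k)%N -> (c < k)%N -> inner (g i y) (E b y) (E c y) = (b == c)%:R)].

Lemma smooth_on_vecB (U : set 'rV[R]_m) (u v : 'rV[R]_m -> 'rV[R]_m) : open U ->
  smooth_on U u -> smooth_on U v -> smooth_on U (fun y => u y - v y).
Proof. by move=> oU su sv; apply: smooth_onD => //; exact: smooth_onN_mx. Qed.

Lemma smooth_on_vec_sum k (U : set 'rV[R]_m) (F : 'I_k -> 'rV[R]_m -> 'rV[R]_m) : open U ->
  (forall b, smooth_on U (F b)) -> smooth_on U (fun y => \sum_b F b y).
Proof.
move=> oU sF; apply/(smooth_on_mxP _ oU) => r s.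
apply: (@smooth_on_eq _ _ _ _ (fun y => \sum_b F b y r s)) => //.
  by move=> y _; rewrite summxE.
apply: smooth_on_sum => // b _; have /(smooth_on_mxP _ oU) := sF b; apply.
Qed.

Lemma partial_frame0 : partial_frame 0 (chart_patch f i a) (fun _ _ => 0).
Proof. by split => //; exact: chart_patch_open. Qed.

(** A vertical vector at [x] orthogonal to the first [k] fields is extended to a smooth vertical
    field orthogonal to them. The domain shrinks to the interior of the set where that field has
    positive norm, so that it can be normalized. *)
Lemma partial_frameS k U E : (k < m - q)%N -> partial_frame k U E ->
  exists U' E', partial_frame k.+1 U' E'.
Proof.
move=> km [oU Ux Ua sE EP].
have Gs y : U y -> (g i y)^T = g i y by move=> /Ua/patch_chart; exact: gram_sym.
have [w w0 [wD wE]] : exists2 w : 'rV[R]_m, w != 0 &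
    w *m D x = 0 /\ forall b, (b < k)%N -> inner (g i x) w (E b x) = 0.
  (* The conditions on [w] are [q + k] linear equations in [m] unknowns, and [k < m - q]. *)
  pose A := row_mx (D x) (g i x *m (\matrix_(b < k) E b x)^T).
  have : kermx A != 0.
    rewrite -mxrank_eq0 mxrank_ker subn_eq0 -ltnNge.
    by apply: leq_ltn_trans (rank_leq_col A) _; rewrite -ltn_subRL.
  move=> /rowV0Pn[w /sub_kermxP wA w0]; exists w => //.
  move: wA; rewrite mul_mx_row -[RHS]row_mx0 => /eq_row_mx[-> wB]; split => // b bk.
  have := congr1 (fun B : 'rV[R]_k => B 0 (Ordinal bk)) wB.
  rewrite [RHS]mxE => <-; rewrite mulmxA /inner !mxE; apply: eq_bigr => l _.
  by rewrite !mxE.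
(* Gram-Schmidt step, applied to the vertical projection p of a constant field. *)
pose p y := w *m (1%:M - D y *m hlift f gN g i a y).
pose v y := p y - \sum_(b < k) inner (g i y) (p y) (E b y) *: E b y.
have sD : smooth_on U D by apply: smooth_on_subset Ua _; exact: jac_smooth.
have sG : smooth_on U (g i).
  by apply: (smooth_on_subset (fun y Uy => patch_chart (Ua y Uy))); exact: gram_smooth.
have sp : smooth_on U p.
  apply: smooth_on_mulmx => //; first exact: smooth_on_cst.
  apply: smooth_onD => //; first exact: smooth_on_cst.
  apply: smooth_onN_mx => //; apply: smooth_on_mulmx => //.
  by apply: smooth_on_subset Ua _; exact: lift_smooth.
have sv : smooth_on U v.
  apply: smooth_on_vecB => //; apply: smooth_on_vec_sum => // b.
  by apply: smooth_on_scalemx => //; [apply: smooth_on_inner => //|]; exact: sE.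
have pD y : U y -> p y *m D y = 0.
  move=> /Ua ay; rewrite /p -mulmxA mulmxBl mul1mx -mulmxA lift_jac//.
  by rewrite mulmx1 subrr mulmx0.
have vD y : U y -> v y *m D y = 0.
  move=> Uy; rewrite /v mulmxBl (pD y Uy) sub0r mulmx_suml.
  apply/eqP; rewrite oppr_eq0; apply/eqP; apply: big1 => b _.
  by rewrite -scalemxAl (proj1 (EP y Uy) b (ltn_ord b)) scaler0.
have vE y c : U y -> (c < k)%N -> inner (g i y) (v y) (E c y) = 0.
  move=> Uy ck; rewrite /v innerBl inner_suml (bigD1 (Ordinal ck))//= innerZl.
  rewrite (proj2 (EP y Uy) _ _ ck ck) eqxx mulr1 big1; first by rewrite addr0 subrr.
  move=> b bc; rewrite innerZl (proj2 (EP y Uy) _ _ (ltn_ord b) ck).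
  rewrite (_ : (_ == _) = false); first by rewrite mulr0.
  by apply: contraNF bc => /eqP bc; apply/eqP/val_inj.
have px : p x = w by rewrite /p mulmxBr mulmx1 mulmxA wD mul0mx subr0.
have vx : v x = w.
  rewrite /v px big1; first by rewrite subr0.
  by move=> b _; rewrite (wE b (ltn_ord b)) scale0r.
pose n y := inner (g i y) (v y) (v y).
have sn : smooth_on U n by exact: smooth_on_inner.
have nx : 0 < n x by rewrite /n vx; apply: gram_pos => //; exact: patch_chart ax.
pose B := [set y | U y /\ 0 < n y].
have nB : nbhs x B.
  have nU : nbhs x U by exact: open_nbhs_nbhs.
  have cn : n y @[y --> x] --> n x.
    by apply: differentiable_continuous; exact: smooth_on_differentiable sn Ux.
  have np : \forall y \near x, 0 < n y by exact: (cvgr_gt (n x) cn).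
  by apply: filterS2 nU np => y.
have BU : B° `<=` U by move=> y /interior_subset[].
have Bn y : B° y -> 0 < n y by move=> /interior_subset[].
have oB : open B° by exact: open_interior.
pose E' b y := if (b < k)%N then E b y else (Num.sqrt (n y))^-1 *: v y.
exists B°, E'; split; [exact: oB|exact: nB| | |].
- by move=> y /BU /Ua.
- move=> b bk; have [bk'|bk'] := boolP (b < k)%N; rewrite /E' ?bk' ?(negbTE bk').
    exact: smooth_on_subset BU (sE b bk').
  apply: (smooth_on_scalemx oB); last exact: smooth_on_subset BU sv.
  apply: (smooth_onV oB); first by move=> y /Bn ny; rewrite gt_eqF// sqrtr_gt0.
  by apply: (smooth_on_sqrt oB Bn); exact: smooth_on_subset BU sn.
- move=> y By; have Uy := BU y By; have ny := Bn y By; split.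
    move=> b _; rewrite /E'; case: ifPn => [bk|_]; first exact: (proj1 (EP y Uy)).
    by rewrite -scalemxAl (vD y Uy) scaler0.
  move=> b c bk ck; rewrite /E'; case: ifPn => bk'; case: ifPn => ck'.
  + exact: (proj2 (EP y Uy)).
  + rewrite innerZr (innerC _ _ (Gs y Uy)) (vE y b Uy bk') mulr0; case: eqP => // bc.
    by move: ck'; rewrite -bc bk'.
  + rewrite innerZl (vE y c Uy ck') mulr0; case: eqP => // bc.
    by move: bk'; rewrite bc ck'.
  + rewrite -leqNgt in bk'; rewrite -leqNgt in ck'.
    have -> : b = k by apply/eqP; rewrite eqn_leq bk' andbT.
    have -> : c = k by apply/eqP; rewrite eqn_leq ck' andbT.
    have ny0 : n y != 0 by rewrite gt_eqF.
    rewrite innerZl innerZr -/(n y) mulrA -invfM -expr2 sqr_sqrtr; last exact: ltW.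
    by rewrite mulVf// eqxx.
Qed.

Lemma vertical_frame_exists : exists U : set 'rV[R]_m,
  exists E : 'I_(m - q) -> 'rV[R]_m -> 'rV[R]_m,
  [/\ open U, U x, U `<=` chart_patch f i a, forall k, smooth_on U (E k) &
      forall y, U y -> vertical_frame f g i y E].
Proof.
have H k : (k <= m - q)%N -> exists U E, partial_frame k U E.
  elim: k => [_|k IH km]; first by exists (chart_patch f i a), (fun _ _ => 0); exact: partial_frame0.
  by have [U [E UE]] := IH (ltnW km); exact: partial_frameS UE.
have [U [E [oU Ux Ua sE EP]]] := H _ (leqnn _).
exists U, (fun k => E k); split => // [k|y Uy]; first exact: sE.
exists U; split => //.
- by move=> z /Ua/patch_chart.
- by move=> k; exact: sE.
- move=> z Uz; have [EV Eo] := EP z Uz; split=> [k|k l]; last by rewrite Eo.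
  exact: (proj2 (vertical_patch sf _ (Ua z Uz)) (EV k (ltn_ord k))).
Qed.

End Frames.

(** * Joint smoothness along a variation *)

Section Regularity.
Variables (R : realType) (m q : nat) (M : manifold R m) (N : manifold R q) (f : M -> N).
Variable gN : metric N.
Hypothesis sf : smooth_map f.

(** [smooth_on] is a condition at each point separately; its set only selects the points. *)
Lemma smooth_on_local (V W : normedModType R) (U : set V) (F : V -> W) :
  (forall x, U x -> exists2 U', U' x & smooth_on U' F) -> smooth_on U F.
Proof. by move=> H s x /H[U' U'x sF]; exact: sF. Qed.

Definition strip (eps : R) (U : set 'rV[R]_m) : set (R * 'rV[R]_m) :=
  [set z | `|z.1| < eps /\ U z.2].

Lemma strip_open eps U : open U -> open (strip eps U).
Proof.
move=> oU; rewrite openE => -[t x] [/= te Ux].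
have nt : \forall s \near t, `|s| < eps.
  have cn : `|s| @[s --> t] --> `|t| by exact: norm_continuous.
  exact: (cvgr_lt `|t| cn).
exists ([set s : R | `|s| < eps], U) => //=; split => //.
exact: open_nbhs_nbhs.
Qed.

Lemma smooth_on_trace_form b (V : normedModType R) (U : set V) (Q : V -> 'M[R]_q)
    (C : V -> 'M[R]_m) (K : V -> 'I_q -> 'M[R]_m) : open U ->
  smooth_on U Q -> smooth_on U C -> (forall c, smooth_on U (fun z => K z c)) ->
  smooth_on U (fun z => trace_form b (Q z) (C z) (K z)).
Proof.
move=> oU sQ sC sK; apply: smooth_on_sum => // c _; apply: smooth_on_sum => // d _.
apply: smooth_onM => //; first by have /(smooth_on_mxP _ oU) := sQ; apply.
have str (A : V -> 'M[R]_m) : smooth_on U A -> smooth_on U (fun z => \tr (A z)).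
  by move=> /(smooth_on_mxP _ oU) sA; apply: smooth_on_sum => // l _; exact: sA.
case: b; last first.
  by apply: smooth_onM => //; apply: str; exact: smooth_on_mulmx.
apply: str; apply: smooth_on_mulmx => //; apply: smooth_on_mulmx => //.
  exact: smooth_on_mulmx.
exact: smooth_on_trmx.
Qed.

Section Variation.
Variables (g0 : metric M) (eps : R) (g : R -> metric M).
Hypothesis sub0 : riemannian_submersion f g0 gN.
Hypothesis var : preserving_variation f gN g0 eps g.

Lemma variation_submersion t : `|t| < eps -> riemannian_submersion f (g t) gN.
Proof. by have [_] := var; apply. Qed.

Lemma variation_agree t : `|t| < eps -> riem_rel_vertical f g0 (g t).
Proof. by have [[_ + _ _] _] := var; apply. Qed.

Lemma hlift_variation_smooth i a :
  smooth_on (strip eps (chart_patch f i a)) (fun z => hlift f gN (g z.1) i a z.2).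
Proof.
have oP := @chart_patch_open _ _ _ _ _ _ sf i a.
have oS := @strip_open eps _ oP.
have lft k l (F : 'rV[R]_m -> 'M[R]_(k, l)) : smooth_on (chart_patch f i a) F ->
    smooth_on (strip eps (chart_patch f i a)) (fun z => F z.2).
  by move=> sF; apply: smooth_on_subset (smooth_on_snd sF) => z [].
apply: smooth_on_mulmx => //.
  apply: smooth_on_mulmx => //.
    exact: (lft _ _ _ (@local_gram_smooth _ _ _ _ _ _ sf gN i a)).
  apply: (smooth_on_trmx oS); exact: (lft _ _ _ (@jac_smooth _ _ _ _ _ _ sf i a)).
apply: smooth_on_invmx => //.
  by move=> z [_ /patch_chart]; exact: gram_unit.
have [[_ _ _ sg] _] := var.
by apply: smooth_on_subset (sg i) => z [ze /patch_chart].
Qed.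

Lemma koszul_mx_variation_smooth i a c :
  smooth_on (strip eps (chart_patch f i a))
    (fun z => koszul_mx (g0 i) (hlift f gN (g z.1) i a) z.2 c).
Proof.
have oP := @chart_patch_open _ _ _ _ _ _ sf i a.
have oS := @strip_open eps _ oP.
set S := strip eps _ in oS *.
have lft (F : 'rV[R]_m -> R) : smooth_on (chart_patch f i a) F -> smooth_on S (fun z => F z.2).
  by move=> sF; apply: smooth_on_subset (smooth_on_snd sF) => z [].
have sG0 : smooth_on (chart_patch f i a) (g0 i).
  by apply: smooth_on_subset (@gram_smooth _ _ _ g0 i) => y /patch_chart.
have sG0ij := (smooth_on_mxP _ oP).1 sG0.
have sG : smooth_on S (fun z => g0 i z.2).
  by apply: smooth_on_subset (smooth_on_snd sG0) => z [].
have sL := @hlift_variation_smooth i a; rewrite -/S in sL.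
have sLij := (smooth_on_mxP _ oS).1 sL.
have sN : smooth_on S (fun z => \matrix_(k, l) ('D_(delta_mx 0 k) (hlift f gN (g z.1) i a) z.2) c l : 'M[R]_m).
  apply/(smooth_on_mxP _ oS) => k l.
  (* The derivative in space of the lift at fixed time is the derivative of the joint function along
     [(0, delta_mx 0 k)]. *)
  have /(smooth_on_mxP _ oS)/(_ c l) := smooth_on_derive ((0 : R), delta_mx 0 k : 'rV[R]_m) sL.
  apply: smooth_on_eq => // -[t y] Sty; rewrite mxE -derive_slice//.
have sD : smooth_on S (fun z => 'D_(row c (hlift f gN (g z.1) i a z.2)) (g0 i) z.2).
  apply/(smooth_on_mxP _ oS) => k l.
  (* The direction of this derivative varies with [z]; it is expanded in partial derivatives of
     [g0], with entries of the lift as coefficients. *)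
  apply: (@smooth_on_eq _ _ _ _ (fun z => \sum_p hlift f gN (g z.1) i a z.2 c p *
      partial p (fun y => g0 i y k l) z.2)) => //.
    move=> z [_ az]; rewrite derive_gram_sum; last exact: smooth_on_differentiable sG0 az.
    by apply: eq_bigr => p _; rewrite [(row _ _) _ _]mxE.
  apply: smooth_on_sum => // p _; apply: smooth_onM => //; apply: lft.
  exact: (smooth_on_derive (delta_mx 0 p) (sG0ij k l)).
apply: (smooth_on_scalemx oS); first exact: smooth_on_cst.
apply: smooth_onD => //; apply: smooth_onD => //; apply: smooth_on_mulmx => //.
exact: smooth_on_trmx.
Qed.

(** In the trace form the frame and the target metric are independent of [t]; time enters only
    through the matrices [koszul_mx] of the moving lift. *)
Lemma sqnorm_variation_smooth b i :
  smooth_on (strip eps (chart_image i)) (fun z => sqnorm f b (g z.1) i z.2).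
Proof.
apply: smooth_on_local => -[t x] [/= te ix].
pose a := target_chart f i x; have ax : chart_patch f i a x by exact: target_patch.
have [U [E [oU Ux Ua sE EP]]] := vertical_frame_exists sf sub0 ax.
have oS := @strip_open eps _ oU.
have SP : strip eps U `<=` strip eps (chart_patch f i a) by move=> z [? /Ua].
exists (strip eps U) => //.
pose F y : 'M[R]_(m - q, m) := \matrix_k E k y.
pose K z c := koszul_mx (g0 i) (hlift f gN (g z.1) i a) z.2 c.
apply: (@smooth_on_eq _ _ _ _ (fun z : R * 'rV[R]_m => trace_form b (invmx (local_gram f gN i a z.2))
    ((F z.2)^T *m F z.2) (K z))) => //.
  move=> [s y] [/= se Uy].
  have subs := variation_submersion se; have ags := variation_agree se.
  rewrite (sqnormE sf sub0 subs ags (Ua y Uy) b (EP y Uy)).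
  rewrite (energy_trace _ _ _ (kosE gN sf g0 (g s) (Ua y Uy))) //.
have sF : smooth_on U F.
  apply/(smooth_on_mxP _ oU) => k l.
  have /(smooth_on_mxP _ oU)/(_ 0 l) := sE k.
  by apply: smooth_on_eq => // y _; rewrite mxE.
have sF2 : smooth_on (strip eps U) (fun z => F z.2).
  by apply: smooth_on_subset (smooth_on_snd sF) => z [].
apply: smooth_on_trace_form => //.
- have sW : smooth_on (chart_patch f i a) (fun y => invmx (local_gram f gN i a y)).
    have oP := @chart_patch_open _ _ _ _ _ _ sf i a.
    apply: (smooth_on_invmx oP); last exact: local_gram_smooth.
    by move=> y ay; apply: posdef_unit; exact: local_gram_posdef.
  by apply: smooth_on_subset (smooth_on_snd sW) => z [_ /Ua].
- by apply: smooth_on_mulmx => //; exact: smooth_on_trmx.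
- by move=> c; apply: smooth_on_subset SP (@koszul_mx_variation_smooth i a c).
Qed.

End Variation.
End Regularity.

(** * Affine paths of metrics *)

Section Shear.
Variables (R : realType) (m q : nat).

Lemma smooth_on_shear (V : normedModType R) (U : set V) (c : V -> R)
    (D : V -> 'M[R]_(m, q)) (Th : V -> 'M[R]_(q, m)) (G : V -> 'M[R]_m) : open U ->
  smooth_on U c -> smooth_on U D -> smooth_on U Th -> smooth_on U G ->
  smooth_on U (fun z => (1%:M - c z *: (D z *m Th z)) *m G z *m (1%:M - c z *: (D z *m Th z))^T).
Proof.
move=> oU sc sD sTh sG.
have sT : smooth_on U (fun z => 1%:M - c z *: (D z *m Th z) : 'M[R]_m).
  apply: smooth_onD => //; first exact: smooth_on_cst.
  by apply: smooth_onN_mx => //; apply: smooth_on_scalemx => //; exact: smooth_on_mulmx.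
apply: (smooth_on_mulmx oU (smooth_on_mulmx oU sT sG)); exact: smooth_on_trmx.
Qed.

Lemma invmx_congruence (J G : 'M[R]_m) : J \in unitmx -> G \in unitmx ->
  J^T *m invmx (J *m G *m J^T) *m J = invmx G.
Proof.
move=> Ju Gu; have JTu : J^T \in unitmx by rewrite unitmx_tr.
have Au : J *m G *m J^T \in unitmx by rewrite !unitmx_mul Ju Gu JTu.
apply: (can_inj (mulmxK Gu)); rewrite mulVmx//.
apply: (can_inj (mulmxK JTu)); rewrite mul1mx.
have -> : J^T *m invmx (J *m G *m J^T) *m J *m G *m J^T =
  J^T *m (invmx (J *m G *m J^T) *m (J *m G *m J^T)) by rewrite !mulmxA.
by rewrite (mulVmx Au) mulmx1.
Qed.

(** A covariant 2-tensor times a difference of two dual metrics is an endomorphism of the tangent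
    space, and so changes by conjugation. *)
Lemma shear_conjugate (s : R) (J B G G' : 'M[R]_m) :
  J \in unitmx -> G \in unitmx -> G' \in unitmx ->
  (1%:M - s *: (J *m B *m J^T *m (invmx (J *m G *m J^T) - invmx (J *m G' *m J^T)))) *m J =
  J *m (1%:M - s *: (B *m (invmx G - invmx G'))).
Proof.
move=> Ju Gu G'u; rewrite [LHS]mulmxBl mul1mx [RHS]mulmxBr mulmx1; congr (_ - _).
rewrite -scalemxAl -scalemxAr; congr (_ *: _).
rewrite -(invmx_congruence Ju Gu) -(invmx_congruence Ju G'u) -!mulmxA; congr (_ *m (_ *m _)).
by rewrite mulmxBl mulmxBr !mulmxA.
Qed.

End Shear.

Section ShearPath.
Variables (R : realType) (m q : nat) (M : manifold R m) (N : manifold R q) (f : M -> N).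
Variable gN : metric N.
Variables (g0 g1 : metric M).
Hypothesis sub0 : riemannian_submersion f g0 gN.
Hypothesis sub1 : riemannian_submersion f g1 gN.
Hypothesis agree : riem_rel_vertical f g0 g1.
Let sf : smooth_map f := proj1 sub0.

Definition pullback_gram (i : chart M) (x : 'rV[R]_m) : 'M[R]_m :=
  let D := tangent_map f i x in
  D *m gN (target_chart f i x) (Defs.coord N (target_chart f i x) (f (param M i x))) *m D^T.

(** On a patch the bracketed product is [D *m (L1 - L0)] for the two lifts. Written with the
    pullback of [gN] and the dual metrics it refers to no choice of target chart, which gives the
    transition law on M. *)
Definition shear (s : R) (i : chart M) (x : 'rV[R]_m) : 'M[R]_m :=
  1%:M - s *: (pullback_gram i x *m (invmx (g1 i x) - invmx (g0 i x))).

(* The metric whose horizontal lift is the affine combination of those of g0 and g1. *)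
Definition path_gram (s : R) (i : chart M) (x : 'rV[R]_m) : 'M[R]_m :=
  shear s i x *m g0 i x *m (shear s i x)^T.

Let Th i a x := hlift f gN g1 i a x - hlift f gN g0 i a x.

Lemma pullback_patch i a x : chart_patch f i a x ->
  pullback_gram i x = local_jac f i a x *m local_gram f gN i a x *m (local_jac f i a x)^T.
Proof.
move=> ax; have bx := target_patch f (patch_chart ax).
rewrite (local_gram_change gN ax bx) /local_jac.
set K := target_jacobian f i a (target_chart f i x) x.
have E : tangent_map f i x = 'J (local_map f i a) x *m K by exact: (local_map_change sf ax bx).
by rewrite /pullback_gram E trmx_mul !mulmxA.
Qed.

Lemma shear_patchE s i a x : chart_patch f i a x ->
  shear s i x = 1%:M - s *: (local_jac f i a x *m Th i a x).
Proof.
move=> ax; rewrite /shear (pullback_patch ax); congr (_ - _ *: _).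
by rewrite /Th /hlift -mulmxBr !mulmxA.
Qed.

Lemma Th_jac i a x : chart_patch f i a x -> Th i a x *m local_jac f i a x = 0.
Proof. by move=> ax; rewrite mulmxBl !(lift_jac sf) ?subrr. Qed.

Lemma det_shear s i x : chart_image i x -> \det (shear s i x) = 1.
Proof.
move=> ix; have ax := target_patch f ix; rewrite (shear_patchE s ax) scalemxAr.
by apply: det_unipotent; rewrite -scalemxAl Th_jac// scaler0.
Qed.

Lemma jacobian_chart_change i j a p : dom M i p -> dom M j p -> dom N a (f p) ->
  local_jac f i a (Defs.coord M i p) =
  'J (Defs.coord M j \o param M i) (Defs.coord M i p) *m local_jac f j a (Defs.coord M j p).
Proof.
move=> ip jp ap; have iax : chart_patch f i a (Defs.coord M i p) by exists p.
have jax : chart_patch f j a (Defs.coord M j p) by exists p.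
have E : (Defs.coord M j \o param M i) (Defs.coord M i p) = Defs.coord M j p by rewrite /= coordK.
have dt := transition_differentiable ip jp.
have dj : differentiable (local_map f j a) ((Defs.coord M j \o param M i) (Defs.coord M i p)).
  by rewrite E; exact: smooth_on_differentiable (@local_map_smooth _ _ _ _ _ _ sf j a) jax.
have JE := jacobian_comp dt dj; rewrite E in JE.
rewrite /local_jac -[RHS]JE; apply: jacobian_near.
  exact: smooth_on_differentiable (@local_map_smooth _ _ _ _ _ _ sf i a) iax.
have nO : nbhs (Defs.coord M i p) (Defs.coord M i @` (dom M i `&` dom M j)).
  apply: open_nbhs_nbhs; split; last by exists p.
  by apply: chart_open_image; exact: dom_open.
apply: filterS nO => _ [r [ir jr] <-].
by rewrite /local_map /= !coordK.
Qed.

Lemma pullback_transition i j p : dom M i p -> dom M j p ->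
  let J := 'J (Defs.coord M j \o param M i) (Defs.coord M i p) in
  pullback_gram i (Defs.coord M i p) = J *m pullback_gram j (Defs.coord M j p) *m J^T.
Proof.
move=> ip jp J; pose a := chart_at N (f p); have ap : dom N a (f p) := chart_at_dom _.
have iax : chart_patch f i a (Defs.coord M i p) by exists p.
have jax : chart_patch f j a (Defs.coord M j p) by exists p.
rewrite (pullback_patch iax) (pullback_patch jax) (jacobian_chart_change ip jp ap) -/J.
rewrite trmx_mul !mulmxA; congr (_ *m _ *m _ *m _ *m _).
by rewrite /local_gram /local_map /= !coordK.
Qed.

Lemma jacobian_transition_unit i j p : dom M i p -> dom M j p ->
  'J (Defs.coord M j \o param M i) (Defs.coord M i p) \in unitmx.
Proof. by move=> ip jp; rewrite unitmxE unitfE gt_eqF// transition_oriented. Qed.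

Lemma shear_transition s i j p : dom M i p -> dom M j p ->
  let J := 'J (Defs.coord M j \o param M i) (Defs.coord M i p) in
  shear s i (Defs.coord M i p) *m J = J *m shear s j (Defs.coord M j p).
Proof.
move=> ip jp J; have Ju : J \in unitmx := jacobian_transition_unit ip jp.
have ji : chart_image j (Defs.coord M j p) by exists p.
rewrite /shear (pullback_transition ip jp) (gram_transition g0 ip jp) (gram_transition g1 ip jp) -/J.
by apply: shear_conjugate => //; exact: gram_unit.
Qed.

Lemma path_gram_transition s i j p : dom M i p -> dom M j p ->
  let J := 'J (Defs.coord M j \o param M i) (Defs.coord M i p) in
  path_gram s i (Defs.coord M i p) = J *m path_gram s j (Defs.coord M j p) *m J^T.
Proof.
move=> ip jp J; rewrite /path_gram (gram_transition g0 ip jp) -/J.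
rewrite !mulmxA (shear_transition s ip jp) -/J -!mulmxA; do 3 congr (_ *m _).
by rewrite -!trmx_mul (shear_transition s ip jp).
Qed.

Lemma path_gram_sym s i x : chart_image i x -> (path_gram s i x)^T = path_gram s i x.
Proof. by move=> ix; rewrite /path_gram !trmx_mul trmxK gram_sym// mulmxA. Qed.

Lemma inner_path s i x u v :
  inner (path_gram s i x) u v = inner (g0 i x) (u *m shear s i x) (v *m shear s i x).
Proof. by rewrite /inner /path_gram trmx_mul !mulmxA. Qed.

(** A congruence by a matrix of determinant 1; this holds for every real [s], also outside the unit
    interval. *)
Lemma path_gram_pos s i x : chart_image i x -> forall u, u != 0 -> 0 < inner (path_gram s i x) u u.
Proof.
move=> ix u u0; rewrite inner_path; apply: gram_pos => //.
apply: contraNneq u0 => uT.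
have Tu : shear s i x \in unitmx by rewrite unitmxE det_shear// unitr1.
by rewrite -[u](mulmxK Tu) uT mul0mx.
Qed.

Lemma Th_smooth i a : smooth_on (chart_patch f i a) (Th i a).
Proof.
have oP := @chart_patch_open _ _ _ _ _ _ sf i a.
apply: smooth_onD => //; first exact: lift_smooth.
apply: smooth_onN_mx => //; exact: lift_smooth.
Qed.

Lemma g0_patch_smooth i a : smooth_on (chart_patch f i a) (g0 i).
Proof. by apply: smooth_on_subset (@gram_smooth _ _ _ g0 i) => y /patch_chart. Qed.

Lemma path_gram_smooth s i : smooth_on (chart_image i) (path_gram s i).
Proof.
apply: smooth_on_local => x ix; have ax := target_patch f ix.
set a := target_chart f i x in ax; exists (chart_patch f i a) => //.
have oP := @chart_patch_open _ _ _ _ _ _ sf i a.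
have sc : smooth_on (chart_patch f i a) (fun=> s) by exact: smooth_on_cst.
have := smooth_on_shear oP sc (@jac_smooth _ _ _ _ _ _ sf i a) (@Th_smooth i a) (@g0_patch_smooth i a).
by apply: smooth_on_eq => // y ay; rewrite /path_gram (shear_patchE s ay).
Qed.

Definition path_metric (s : R) : metric M :=
  @Defs.Metric R m M (path_gram s) (path_gram_smooth s) (@path_gram_sym s) (@path_gram_pos s)
    (@path_gram_transition s).

(** The lift of a metric is the solution [X] of [X *m G = W *m D^T]. The right side qualifies: the
    shear maps it to the lift of [g0], and the shear does not change [D]. *)
Lemma hlift_path s i a x : chart_patch f i a x ->
  hlift f gN (path_metric s) i a x =
  hlift f gN g0 i a x + s *: (hlift f gN g1 i a x - hlift f gN g0 i a x).
Proof.
move=> ax; have ix := patch_chart ax.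
set X := RHS; have Pu : path_gram s i x \in unitmx by exact: (@gram_unit _ _ _ (path_metric s)).
have TE := shear_patchE s ax.
have XT : X *m shear s i x = hlift f gN g0 i a x.
  rewrite TE /X -/(Th i a x) mulmxBr mulmx1 mulmxDl -scalemxAr mulmxA (lift_jac sf)// mul1mx.
  by rewrite -!scalemxAl -scalemxAr mulmxA Th_jac// mul0mx !scaler0 addr0 addrK.
have TD : shear s i x *m local_jac f i a x = local_jac f i a x.
  by rewrite TE mulmxBl mul1mx -scalemxAl -mulmxA Th_jac// mulmx0 scaler0 subr0.
rewrite /hlift -[X in _ = X](mulmxK Pu); congr (_ *m _).
by rewrite /path_gram !mulmxA XT lift_gram// -mulmxA -trmx_mul TD.
Qed.

(** The dual form of the submersion condition says that the lift times [D] is the identity, which an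
    affine combination of two lifts inherits. *)
Lemma path_submersion s : riemannian_submersion f (path_metric s) gN.
Proof.
apply: (submersion_of_patch sf) => i x ix; have ax := target_patch f ix.
set a := target_chart f i x in ax; exists a => //; have [rk _] := submersion_patch sf sub0 ax.
split => //; apply: cometric_submersive.
- exact: path_gram_sym.
- exact: path_gram_pos.
- exact: local_gram_sym.
apply: mulmx1C; rewrite !mulmxA -/(local_jac f i a x).
have := hlift_path s ax; rewrite {1}/hlift => ->.
rewrite mulmxDl -scalemxAl -/(Th i a x) Th_jac// scaler0 addr0; exact: lift_jac.
Qed.

Lemma path_agree s : riem_rel_vertical f g0 (path_metric s).
Proof.
move=> i x ix u v uV vV; have ax := target_patch f ix; rewrite /= inner_path.
have vT w : vertical f i x w -> w *m shear s i x = w.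
  move=> /(vertical_patch sf w ax) wD.
  by rewrite (shear_patchE s ax) mulmxBr mulmx1 -scalemxAr mulmxA wD mul0mx scaler0 subr0.
by rewrite !vT.
Qed.

Lemma path0 i x : path_metric 0 i x = g0 i x.
Proof. by rewrite /= /path_gram /shear scale0r subr0 mul1mx trmx1 mulmx1. Qed.

Lemma path1 i x : chart_image i x -> path_metric 1 i x = g1 i x.
Proof.
move=> ix; have ax := target_patch f ix.
have [-> _] := shear_patch sf sub0 sub1 agree ax.
by rewrite /= /path_gram (shear_patchE 1 ax) scale1r.
Qed.

(** Any [eps] is allowed, as the path exists for all real parameters. In a patch the parameter
    enters only as the scalar in the shear, whence joint smoothness. *)
Lemma path_preserving eps : 0 < eps -> preserving_variation f gN g0 eps path_metric.
Proof.
move=> eps0; split; last by move=> t _; exact: path_submersion.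
split => // [t _|i x _|i]; [exact: path_agree|exact: path0|].
apply: smooth_on_local => -[t x] [/= te ix]; have ax := target_patch f ix.
set a := target_chart f i x in ax.
have oP := @chart_patch_open _ _ _ _ _ _ sf i a.
have oS := @strip_open R m eps _ oP.
exists (strip eps (chart_patch f i a)) => //.
have lft k l (F : 'rV[R]_m -> 'M[R]_(k, l)) : smooth_on (chart_patch f i a) F ->
    smooth_on (strip eps (chart_patch f i a)) (fun z => F z.2).
  by move=> sF; apply: smooth_on_subset (smooth_on_snd sF) => z [].
have := smooth_on_shear oS (@smooth_on_fst _ _ _) (lft _ _ _ (@jac_smooth _ _ _ _ _ _ sf i a))
  (lft _ _ _ (@Th_smooth i a)) (lft _ _ _ (@g0_patch_smooth i a)).
by apply: smooth_on_eq => // -[s y] [/= _ ay]; rewrite /path_gram (shear_patchE s ay).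
Qed.

End ShearPath.

(** * Convexity of the functionals *)

Section Convexity.
Variables (R : realType) (m q : nat).

Let affine_sum (h s k k0 k1 A B C a b c a1 b1 c1 : R) :
  k = h * (A + B + C) -> k0 = h * (a + b + c) -> k1 = h * (a1 + b1 + c1) ->
  A = a + s * (a1 - a) -> B = b + s * (b1 - b) -> C = c + s * (c1 - c) ->
  k = k0 + s * (k1 - k0).
Proof. by move=> -> -> -> -> -> ->; ring. Qed.

Lemma affine_comb (s a b : R) : (1 - s) * a + s * b = a + s * (b + (-1) * a).
Proof. by ring. Qed.

Lemma convex_scale (s b u u0 u1 : R) : 0 <= b -> u <= (1 - s) * u0 + s * u1 ->
  b * u <= b * u0 + s * (b * u1 + (-1) * (b * u0)).
Proof. by move=> b0 /(ler_wpM2l b0) H; rewrite -affine_comb; nra. Qed.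

(** With [G0] fixed, every term is linear in either a derivative of [L] or the direction
    [row c (L x)]. *)
Lemma koszul_affine (G0 : 'rV[R]_m -> 'M[R]_m) (L L0 L1 : 'rV[R]_m -> 'M[R]_(q, m)) s x u v :
  differentiable G0 x -> differentiable L0 x -> differentiable L1 x ->
  (\forall y \near x, L y = L0 y + s *: (L1 y - L0 y)) ->
  koszul G0 L x u v = koszul G0 L0 x u v + s *: (koszul G0 L1 x u v - koszul G0 L0 x u v).
Proof.
move=> dG0 dL0 dL1 LE; have Lx := nbhs_singleton LE.
have dLE w : 'D_w L x = 'D_w L0 x + s *: ('D_w L1 x - 'D_w L0 x).
  have E := near_eq_derive w LE.
  have d0 : derivable L0 x w by exact: diff_derivable.
  have d1 : derivable L1 x w by exact: diff_derivable.
  have H := is_deriveD (derivableP d0) (is_deriveZ s (is_deriveB (derivableP d1) (derivableP d0))).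
  by rewrite E; have [_ HD] := H; exact: HD.
have lin (A : 'rV[R]_m) (P P1 : 'M[R]_(q, m)) c : (A *m (row c (P + s *: (P1 - P)))^T) 0 0 =
    (A *m (row c P)^T) 0 0 + s * ((A *m (row c P1)^T) 0 0 - (A *m (row c P)^T) 0 0).
  have -> : row c (P + s *: (P1 - P)) = row c P + s *: (row c P1 - row c P).
    by apply/rowP => l; rewrite !mxE.
  by rewrite linearD linearZ linearB/= mulmxDr -scalemxAr mulmxBr !mxE.
have linG c : (u *m 'D_(row c (L x)) G0 x *m v^T) 0 0 = (u *m 'D_(row c (L0 x)) G0 x *m v^T) 0 0 +
    s * ((u *m 'D_(row c (L1 x)) G0 x *m v^T) 0 0 - (u *m 'D_(row c (L0 x)) G0 x *m v^T) 0 0).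
  have -> : row c (L x) = row c (L0 x) + s *: (row c (L1 x) - row c (L0 x)).
    by rewrite Lx; apply/rowP => l; rewrite !mxE.
  rewrite !(deriveE _ dG0) linearD linearZ linearB/= mulmxDr mulmxDl -scalemxAr -scalemxAl.
  by rewrite mulmxBr mulmxBl !mxE.
apply/rowP => c.
have l1 := lin (v *m G0 x) ('D_u L0 x) ('D_u L1 x) c; rewrite -dLE in l1.
have l2 := lin (u *m G0 x) ('D_v L0 x) ('D_v L1 x) c; rewrite -dLE in l2.
have KE L' : koszul G0 L' x u v 0 c = - 2^-1 * ((v *m G0 x *m (row c ('D_u L' x))^T) 0 0 +
    (u *m G0 x *m (row c ('D_v L' x))^T) 0 0 + (u *m 'D_(row c (L' x)) G0 x *m v^T) 0 0).
  by rewrite mxE.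
have -> : (koszul G0 L0 x u v + s *: (koszul G0 L1 x u v - koszul G0 L0 x u v)) 0 c =
    koszul G0 L0 x u v 0 c + s * (koszul G0 L1 x u v 0 c - koszul G0 L0 x u v 0 c).
  by move: (koszul _ _ _ _ _) (koszul _ _ _ _ _) => k0 k1; rewrite !mxE.
exact: (affine_sum (KE L) (KE L0) (KE L1) l1 l2 (linG c)).
Qed.

Lemma koszul_near (G0 : 'rV[R]_m -> 'M[R]_m) (L L' : 'rV[R]_m -> 'M[R]_(q, m)) x :
  (\forall y \near x, L y = L' y) -> koszul G0 L x = koszul G0 L' x.
Proof.
move=> LE; have DE w : 'D_w L x = 'D_w L' x by exact: near_eq_derive.
apply/funext => u; apply/funext => v.
by rewrite /koszul (DE u) (DE v) (nbhs_singleton LE).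
Qed.

(** Each energy is a nonnegative quadratic form in [k], and [k] is affine in [s]. For the mean
    curvature the trace is taken inside the form, which preserves affineness. *)
Lemma energy_convex b n (Q : 'M[R]_q) (k k0 k1 : 'rV[R]_m -> 'rV[R]_m -> 'rV[R]_q)
    (E : 'I_n -> 'rV[R]_m) (s : R) : posdef Q -> Q^T = Q -> 0 <= s <= 1 ->
  (forall u v, k u v = k0 u v + s *: (k1 u v - k0 u v)) ->
  energy b Q k E <= (1 - s) * energy b Q k0 E + s * energy b Q k1 E.
Proof.
move=> Qp Qs s01 kE; rewrite /energy; case: b.
  rewrite !mulr_sumr -big_split; apply: ler_sum => a _ /=.
  rewrite !mulr_sumr -big_split; apply: ler_sum => c _ /=.
  by rewrite kE; exact: inner_convex.
under eq_bigr do rewrite kE.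
rewrite big_split -scaler_sumr sumrB /=; exact: inner_convex.
Qed.

Lemma posdef_inv (W : 'M[R]_q) : posdef W -> W^T = W -> posdef (invmx W).
Proof.
move=> Wp Ws u u0; have Wu := posdef_unit Wp.
have -> : inner (invmx W) u u = inner W (u *m invmx W) (u *m invmx W).
  by rewrite /inner trmx_mul invmx_sym// mulmxKV// mulmxA.
apply: Wp; apply: contraNneq u0 => uW; by rewrite -[u](mulmxKV Wu) uW mul0mx.
Qed.

End Convexity.

(** Convexity bounds the difference quotient at small positive [h] by [phi 1 - phi 0], while the
    quotient tends to 0. *)
Lemma convex_critical_min (R : realType) (phi : R -> R) :
  is_derive (0 : R) 1 phi 0 ->
  (forall s, 0 <= s <= 1 -> phi s <= (1 - s) * phi 0 + s * phi 1) -> phi 0 <= phi 1.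
Proof.
move=> [dphi D0] conv; rewrite leNgt; apply/negP => neg.
pose c := phi 0 - phi 1; have c0 : 0 < c by rewrite subr_gt0.
have : (fun h : R => h^-1 *: (phi (h *: (1 : R) + 0) - phi 0)) @ 0^' --> (0 : R).
  by rewrite -[X in _ --> X]D0; exact: dphi.
move=> /cvgrPdist_lt/(_ _ c0)/nbhs_ballP[e /= e0 eP].
pose h := Num.min e 1 / 2.
have m0 : 0 < Num.min e 1 by rewrite lt_min e0 ltr01.
have h0 : 0 < h by rewrite divr_gt0.
have hm : h < Num.min e 1 by rewrite /h; lra.
have he : h < e by apply: lt_le_trans hm _; rewrite ge_min lexx.
have h1 : h < 1 by apply: lt_le_trans hm _; rewrite ge_min lexx orbT.
have := eP h; rewrite -ball_normE/= sub0r normrN gtr0_norm// => /(_ he (lt0r_neq0 h0)).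
rewrite sub0r normrN [h *: _]mulr1 addr0 ltr_norml => /andP[+ _].
rewrite /GRing.scale/= mulrC ltr_pdivlMr//.
have hb : 0 <= h <= 1 by rewrite (ltW h0) (ltW h1).
by have := conv h hb; rewrite /c; nra.
Qed.

(** * Second variation at a critical metric *)

Section Final.
Variables (R : realType) (m q : nat) (M : manifold R m) (N : manifold R q) (f : M -> N).
Variables (gN : metric N) (g0 : metric M) (rho : partition_of_unity M).
Hypothesis cM : compact [set: M].
Hypothesis sub0 : riemannian_submersion f g0 gN.
Let sf : smooth_map f := proj1 sub0.

(** Two metrics representing the same tensor may differ as functions off the chart images. The lifts
    therefore agree only near [x], which suffices because [koszul] depends on their germ. *)
Lemma sqnorm_congr b (g g' : metric M) i x :
  riemannian_submersion f g gN -> riemannian_submersion f g' gN ->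
  riem_rel_vertical f g0 g -> riem_rel_vertical f g0 g' ->
  (forall y, chart_image i y -> g i y = g' i y) -> chart_image i x ->
  sqnorm f b g i x = sqnorm f b g' i x.
Proof.
move=> sub sub' ag ag' gg' ix; have ax := target_patch f ix.
set a := target_chart f i x in ax.
have [U [E [oU Ux Ua sE EP]]] := vertical_frame_exists sf sub0 ax.
rewrite (sqnormE sf sub0 sub ag ax b (EP x Ux)) (sqnormE sf sub0 sub' ag' ax b (EP x Ux)).
have LE : \forall y \near x, hlift f gN g i a y = hlift f gN g' i a y.
  have nP : nbhs x (chart_patch f i a).
    by apply: open_nbhs_nbhs; split => //; exact: chart_patch_open.
  by apply: filterS nP => y /patch_chart iy; rewrite /hlift gg'.
by rewrite (koszul_near (g0 i) LE).
Qed.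

Lemma sqnorm_path_convex b (g1 : metric M) (sub1 : riemannian_submersion f g1 gN) i x s : chart_image i x -> 0 <= s <= 1 ->
  sqnorm f b (path_metric sub0 sub1 s) i x <=
  (1 - s) * sqnorm f b (path_metric sub0 sub1 0) i x + s * sqnorm f b (path_metric sub0 sub1 1) i x.
Proof.
move=> ix s01; have ax := target_patch f ix; set a := target_chart f i x in ax.
have [U [E [oU Ux Ua sE EP]]] := vertical_frame_exists sf sub0 ax.
have subp t := path_submersion sub0 sub1 t; have agp t := path_agree sub0 sub1 t.
have sqE t := sqnormE sf sub0 (subp t) (agp t) ax b (EP x Ux).
rewrite !sqE.
have nP : nbhs x (chart_patch f i a).
  by apply: open_nbhs_nbhs; split => //; exact: chart_patch_open.
have dL g : differentiable (hlift f gN g i a) x.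
  exact: smooth_on_differentiable (@lift_smooth _ _ _ _ _ _ gN sf g i a) ax.
have dG0 : differentiable (g0 i) x.
  exact: smooth_on_differentiable (@gram_smooth _ _ _ g0 i) ix.
apply: energy_convex => //.
- by apply: posdef_inv; [exact: local_gram_posdef|exact: local_gram_sym].
- by apply: invmx_sym; exact: local_gram_sym.
move=> u v; apply: koszul_affine => //.
apply: filterS nP => y ay; rewrite !hlift_path//.
by rewrite scale0r addr0 scale1r; congr (_ + _ *: _); rewrite [RHS]addrC addKr.
Qed.

(** Reduces to [J_h] for [true] and to [J_H] for [false], so both halves of the theorem are
    instances of one statement. *)
Definition J_gen b (g : metric M) : R := integral_vol rho g (sqnorm f b g).

Section Bump.
Variable k : 'I_(bump_num rho).
Let i := bump_chart k.

Definition bump_support : set 'rV[R]_m := Defs.coord M i @` closure [set p | Defs.bump k p != 0].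

(** The volume factor is that of [g0]: by [det_agree] it is the same for every metric of a
    preserving variation, so time enters only through [sqnorm]. *)
Definition bump_density (x : 'rV[R]_m) : R :=
  Defs.bump k (param M i x) * Num.sqrt (\det (g0 i x)).

(** Compactness of M enters here: the support is closed in M, and the chart is continuous on it. *)
Lemma bump_support_compact : compact bump_support.
Proof.
apply: continuous_compact; last first.
  by apply: (subclosed_compact _ cM) => //; exact: closed_closure.
apply: continuous_in_subspaceT => p; rewrite inE => /(@bump_supp _ _ _ rho k) ip.
exact: coord_cont.
Qed.

Lemma bump_support_sub : bump_support `<=` chart_image i.
Proof. by move=> _ [p /(@bump_supp _ _ _ rho k) ip <-]; exists p. Qed.

Lemma bump_density_continuous x : chart_image i x -> {for x, continuous bump_density}.
Proof.
move=> ix.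
have c1 : Defs.bump k (param M i y) @[y --> x] --> Defs.bump k (param M i x).
  exact: (differentiable_continuous (smooth_on_differentiable (@bump_smooth _ _ _ rho k i) ix)).
have c2 : \det (g0 i y) @[y --> x] --> \det (g0 i x).
  have sd := smooth_on_det (@chart_image_open _ _ M i) (@gram_smooth _ _ _ g0 i).
  exact: (differentiable_continuous (smooth_on_differentiable sd ix)).
have c3 : Num.sqrt (\det (g0 i y)) @[y --> x] --> Num.sqrt (\det (g0 i x)).
  exact: (continuous_cvg _ (@sqrt_continuous R _) c2).
exact: cvgM c1 c3.
Qed.

Lemma bump_density_out x : chart_image i x -> ~ bump_support x -> bump_density x = 0.
Proof.
move=> [p ip <-] Kx; rewrite /bump_density coordK//.
have -> : Defs.bump k p = 0; last by rewrite mul0r.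
apply/eqP/negPn/negP => bp; apply: Kx; exists p => //; exact: subset_closure.
Qed.

Definition bump_integral (U : R * 'rV[R]_m -> R) (t : R) : R :=
  integral_rV ((fun x => bump_density x * U (t, x)) \_ (chart_image i)).

Lemma derive_bump_integral eps (U : R * 'rV[R]_m -> R) (t : R) : smooth_on (strip eps (chart_image i)) U -> `|t| < eps ->
  is_derive t 1 (bump_integral U) (bump_integral ('D_(1, 0) U) t).
Proof.
move=> sU te; exact: (derive_chart_integral (@chart_image_open _ _ M i) bump_support_compact
  bump_support_sub bump_density_continuous bump_density_out sU te).
Qed.

End Bump.

Lemma det_agree (g : metric M) i x : riemannian_submersion f g gN -> riem_rel_vertical f g0 g ->
  chart_image i x -> \det (g i x) = \det (g0 i x).
Proof.
move=> sub ag ix; have ax := target_patch f ix.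
have [-> dT] := shear_patch sf sub0 sub ag ax.
by rewrite !det_mulmx det_tr dT mul1r mulr1.
Qed.

Lemma J_bump b (g : R -> metric M) t : riemannian_submersion f (g t) gN ->
  riem_rel_vertical f g0 (g t) ->
  J_gen b (g t) = \sum_k bump_integral k (fun z => sqnorm f b (g z.1) (bump_chart k) z.2) t.
Proof.
move=> sub ag; apply: eq_bigr => k _; congr (integral_rV _).
apply/funext => x; rewrite !patchE; case: ifPn => //; rewrite inE => ix.
by rewrite (det_agree sub ag ix) /bump_density mulrAC.
Qed.

(** The integrand is jointly smooth, so one may differentiate twice under the integral sign: [F1]
    and [F2] are the resulting derivatives of [F0]. The functional coincides with [F0] only for
    [|t| < eps], so derivatives are transferred by equality near a point. *)
Lemma J_second_derivative b eps g : preserving_variation f gN g0 eps g ->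
  (forall t, `|t| < eps -> J_gen b (g 0) <= J_gen b (g t)) ->
  second_derivative_ge0 (fun t => J_gen b (g t)).
Proof.
move=> var Jmin; have [[eps0 _ _ _] _] := var.
pose U (k : 'I_(bump_num rho)) (z : R * 'rV[R]_m) := sqnorm f b (g z.1) (bump_chart k) z.2.
have sU k : smooth_on (strip eps (chart_image (bump_chart k))) (U k).
  exact: (sqnorm_variation_smooth sf sub0 var b).
pose F0 : R -> R := \sum_k bump_integral k (U k).
pose F1 : R -> R := \sum_k bump_integral k ('D_(1, 0) (U k)).
pose F2 : R -> R := \sum_k bump_integral k ('D_(1, 0) ('D_(1, 0) (U k))).
have D0 (t : R) : `|t| < eps -> is_derive t 1 F0 (F1 t).
  move=> te; rewrite /F1 fct_sumE; apply: is_derive_sum => k.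
  exact: derive_bump_integral (sU k) te.
have D1 (t : R) : `|t| < eps -> is_derive t 1 F1 (F2 t).
  move=> te; rewrite /F2 fct_sumE; apply: is_derive_sum => k.
  exact: derive_bump_integral (smooth_on_derive _ (sU k)) te.
pose F (t : R) : R := J_gen b (g t).
have nearI (t : R) : `|t| < eps -> \forall s \near t, `|s| < eps.
  move=> te; have cn : `|s| @[s --> t] --> `|t| by exact: norm_continuous.
  exact: (cvgr_lt `|t| cn).
have FE (t : R) : `|t| < eps -> F t = F0 t.
  move=> te; rewrite /F0 fct_sumE; apply: (J_bump b (g := g)).
    exact (variation_submersion var te).
  exact (variation_agree var te).
have DF (t : R) : `|t| < eps -> is_derive t 1 F (F1 t).
  move=> te; apply: near_eq_is_derive (D0 t te).
  by apply: filterS (nearI t te) => s se; rewrite FE.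
have DF1 (t : R) : `|t| < eps -> derive1 F t = F1 t.
  by move=> te; rewrite derive1E; have [_ ->] := DF t te.
have z0 : `|0 : R| < eps by rewrite normr0.
have ddF : derivable (derive1 F) 0 1.
  apply: (@near_eq_derivable _ _ _ F1); last by have [] := D1 0 z0.
  by apply: filterS (nearI 0 z0) => s se; rewrite DF1.
have dF (t : R) : `|t| < eps -> derivable F t 1 by move=> te; have [] := DF t te.
split => //.
  by apply: filterS (nearI 0 z0) => s se; exact: dF.
exact: second_derivative_min eps0 dF ddF Jmin.
Qed.

Lemma J_path_convex b (g1 : metric M) (sub1 : riemannian_submersion f g1 gN) s : 0 <= s <= 1 ->
  J_gen b (path_metric sub0 sub1 s) <=
  (1 - s) * J_gen b (path_metric sub0 sub1 0) + s * J_gen b (path_metric sub0 sub1 1).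
Proof.
(* Width 2 places the closed unit interval inside the open parameter range. *)
move=> s01; have var := path_preserving sub0 sub1 (ltr0n R 2).
have J_E t := J_bump b (g := path_metric sub0 sub1) (path_submersion sub0 sub1 t) (path_agree sub0 sub1 t).
rewrite !J_E !mulr_sumr -big_split; apply: ler_sum => k _ /=.
set U := fun z : R * 'rV[R]_m => sqnorm _ _ _ _ _.
have [r r0 rP] := chart_extend_ccont (@chart_image_open _ _ M (bump_chart k))
  (@bump_support_compact k) (@bump_support_sub k) (@bump_density_continuous k) (@bump_density_out k).
have sU : smooth_on (strip 2 (chart_image (bump_chart k))) U.
  exact: (sqnorm_variation_smooth sf sub0 var b).
have cc t : 0 <= t <= 1 -> ccont r (fun x => chart_extend (chart_image (bump_chart k)) (bump_density k) U (t, x)).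
  move=> /andP[t0 t1]; apply: rP => x ix; apply: differentiable_continuous.
  apply: (smooth_on_differentiable sU); split => //=; rewrite ger0_norm//; lra.
have cs := cc s s01.
have c0 := cc 0 (introT andP (conj (lexx 0) ler01)).
have c1 := cc 1 (introT andP (conj ler01 (lexx 1))).
have [lin _] := integral_rV_linear_bounded m r0.
(* Linearity of the integral is stated for [F + c * G], hence this nested shape of the convex
   combination. *)
have E : (1 - s) * bump_integral k U 0 + s * bump_integral k U 1 =
    integral_rV (fun x => chart_extend (chart_image (bump_chart k)) (bump_density k) U (0, x) +
      s * (chart_extend (chart_image (bump_chart k)) (bump_density k) U (1, x) +
      (-1) * chart_extend (chart_image (bump_chart k)) (bump_density k) U (0, x))).
  rewrite (lin _ _ _ c0 (ccont_comb (-1) c1 c0)) (lin _ _ _ c1 c0); exact: affine_comb.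
rewrite E; apply: (le_integral_rV r0 cs).
  exact: (ccont_comb s c0 (ccont_comb (-1) c1 c0)).
move=> x; have [ix|ix] := pselect (chart_image (bump_chart k) x); last first.
  have Kx : ~ bump_support k x by move=> /bump_support_sub.
  by rewrite !(chart_extend_out (@bump_density_out k))// mulr0 addr0 mulr0 addr0.
rewrite !chart_extendE//=; have b0 : 0 <= bump_density k x.
  by rewrite mulr_ge0 ?sqrtr_ge0// bump_ge0.
exact: (convex_scale b0 (sqnorm_path_convex b sub1 ix s01)).
Qed.

Lemma J_congr b (g g' : metric M) :
  riemannian_submersion f g gN -> riemannian_submersion f g' gN ->
  riem_rel_vertical f g0 g -> riem_rel_vertical f g0 g' ->
  (forall i y, chart_image i y -> g i y = g' i y) -> J_gen b g = J_gen b g'.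
Proof.
move=> sub sub' ag ag' gg'; apply: eq_bigr => k _; congr (integral_rV _).
apply/funext => x; rewrite !patchE; case: ifPn => //; rewrite inE => ix.
by rewrite (sqnorm_congr b sub sub' ag ag' (gg' _) ix) gg'.
Qed.

(** For each fixed [t] criticality is applied to the affine path from [g0] to [g t], not to the
    given variation; this yields the minimum at 0 that [J_second_derivative] asks for. *)
Lemma critical_second_derivative b : critical f gN (J_gen b) g0 ->
  forall eps g, preserving_variation f gN g0 eps g ->
  second_derivative_ge0 (fun t => J_gen b (g t)).
Proof.
move=> crit eps g var; apply: (J_second_derivative var) => t te.
have [[eps0 _ g00 _] _] := var.
have z0 : `|0 : R| < eps by rewrite normr0.
have subt := variation_submersion var te; have agt := variation_agree var te.
have subz := variation_submersion var z0; have agz := variation_agree var z0.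
(* [g 0] and the path at 0 are known to agree on chart images only, so their functionals are
   compared by [J_congr]; likewise for [g t] and the path at 1. *)
have -> : J_gen b (g 0) = J_gen b (path_metric sub0 subt 0).
  apply: J_congr => //; [exact: path_submersion|exact: path_agree|].
  by move=> i y iy; rewrite g00// path0.
have -> : J_gen b (g t) = J_gen b (path_metric sub0 subt 1).
  apply: J_congr => //; [exact: path_submersion|exact: path_agree|].
  by move=> i y iy; rewrite path1.
apply: (@convex_critical_min R (fun s => J_gen b (path_metric sub0 subt s))).
  (* Only the derivative at 0 matters here, so any positive width serves; 1 is taken. *)
  exact: crit (path_preserving sub0 subt ltr01).
by move=> s s01; exact: J_path_convex.
Qed.

End Final.

Theorem theorem4p8 (R : realType) (m q : nat)
    (M : manifold R m) (N : manifold R q)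
    (f : M -> N) (g0 : metric M) (gN : metric N)
    (rho : partition_of_unity M) :
  compact [set: M]%classic ->
  riemannian_submersion f g0 gN ->
  (critical f gN (J_h f rho) g0 ->
     forall (eps : R) (g : R -> metric M),
       preserving_variation f gN g0 eps g ->
       second_derivative_ge0 (fun t => J_h f rho (g t)))
  /\
  (critical f gN (J_H f rho) g0 ->
     forall (eps : R) (g : R -> metric M),
       preserving_variation f gN g0 eps g ->
       second_derivative_ge0 (fun t => J_H f rho (g t))).
Proof.
move=> cM sub0; split.
  exact: (critical_second_derivative (rho := rho) cM sub0 (b := true)).
exact: (critical_second_derivative (rho := rho) cM sub0 (b := false)).
Qed.
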